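(* There exist absolute constants $c,C>0$ such that the following holds. Let $w\colon\mathbb N^2\to[0,\infty)$ be a nonzero admissible weight (nonincreasing in each variable with $\|w\|_{\mathrm{ft}}<\infty$). (1) For every admissible pair $(\Omega,\mathcal U)$ in the bi-parameter setting, one can choose a $1/8$-sparse $\mathcal G_0\subset\mathcal U$ such that $$\int_{\mathbb R^{d_1+d_2}}\bigl(e^{c\|w\|_{\mathrm{ft}}^{-1}H_w(x)}-1\bigr)\,dx\le\int_{\mathbb R^{d_1+d_2}}\bigl(e^{Ch_{\mathcal G_0}(x)}-1\bigr)\,dx\lesssim|\operatorname{sh}(\mathcal G_0)|.$$ (2) For every admissible pair $(\Omega,\mathcal U)$ in the Zygmund setting, one can choose a $1/8$-sparse $\mathcal G_0\subset\mathcal U$ such that $$\int_{\mathbb R^{d_1+d_2+d_3}}\Bigl[\cosh\bigl(c\sqrt{\|w\|_{\mathrm{ft}}^{-1}H_w(x)}\bigr)-1\Bigr]dx\le\int_{\mathbb R^{d_1+d_2+d_3}}\Bigl[\cosh\bigl(C\sqrt{h_{\mathcal G_0}(x)}\bigr)-1\Bigr]dx\lesssim|\operatorname{sh}(\mathcal G_0)|.$$ Here $A\lesssim B$ means $A\le C'B$ with a constant $C'$ depending only on the dimensions $d_1,d_2,d_3$.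
   Context: $\mathbb N=\{0,1,2,\dots\}$; $|\cdot|$ is Lebesgue measure. Fix dyadic grids $\mathcal D^i$ of cubes in $\mathbb R^{d_i}$, $i=1,2,3$ (side lengths $2^k$, $k\in\mathbb Z$). $\ell(Q)$ is the side length of $Q$, and $Q^{(k)}$ is its $k$th dyadic ancestor (the cube of the same grid containing $Q$ with side length $2^k\ell(Q)$). For a collection $\mathcal B$ of rectangles, $M_{\mathcal B}f(x):=\sup_{R\in\mathcal B,\,x\in R}\frac1{|R|}\int_R|f|$. Bi-parameter setting: rectangles are $I=I^1\times I^2\in\mathcal D^1\times\mathcal D^2$. For $\Omega\subset\mathbb R^{d_1+d_2}$ measurable of finite measure, $\widetilde\Omega:=\{M_{\mathcal D^1\times\mathcal D^2}1_\Omega>1/2\}$. Zygmund setting: rectangles are the dyadic Zygmund rectangles $I=I^1\times I^2\times I^3$, $I^i\in\mathcal D^i$, with $\ell(I^3)=\ell(I^1)\ell(I^2)$. For $\Omega\subset\mathbb R^{d_1+d_2+d_3}$ measurable of finite measure, $\widetilde\Omega:=\{M_{\mathcal D_{\mathrm{sZ}}}1_\Omega>1/2\}$, where $\mathcal D_{\mathrm{sZ}}$ consists of all $I^1\times I^2\times I^3$, $I^i\in\mathcal D^i$, with $\ell(I^3)\le\ell(I^1)\ell(I^2)$. In both settings, for a rectangle $I\subset\Omega$ and $i=1,2$, $I_i^{(k)}$ is obtained from $I$ by replacing only $I^i$ by $(I^i)^{(k)}$, and $e_i(I;\Omega):=\max\{k\ge0: I_i^{(k)}\subset\widetilde\Omega\}$.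 In either setting, $(\Omega,\mathcal U)$ is an admissible pair if $\Omega$ is measurable with finite measure and $\mathcal U$ is a family of rectangles of that setting, all contained in $\Omega$, which is incomparable: no member is contained in a different member. For $w\colon\mathbb N^2\to[0,\infty)$: $W_w(I;\Omega):=w(e_1(I;\Omega),e_2(I;\Omega))$, $H_w(x):=\sum_{I\in\mathcal U}W_w(I;\Omega)1_I(x)$, and $\|w\|_{\mathrm{ft}}:=\sup_{N\ge0}\sum_{a=0}^Nw(a,N-a)$. A weight $w$ is admissible if it is nonincreasing in each variable separately and $\|w\|_{\mathrm{ft}}<\infty$. $\operatorname{sh}(\mathcal G):=\bigcup_{I\in\mathcal G}I$ and $h_{\mathcal G}:=\sum_{I\in\mathcal G}1_I$. For $0<\eta\le1$, a family $\mathcal G$ is $\eta$-sparse if there are pairwise disjoint measurable sets $E_I\subset I$, $I\in\mathcal G$, with $|E_I|\ge\eta|I|$. *)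

(* Defs.v *)
From HB Require Import structures.
From mathcomp Require Import all_boot all_order all_algebra.
From mathcomp Require Import all_classical all_reals all_analysis.

Set Implicit Arguments.
Unset Strict Implicit.
Unset Printing Implicit Defensive.
Import Order.TTheory GRing.Theory Num.Theory.
Import numFieldNormedType.Exports.

Local Open Scope classical_set_scope.
Local Open Scope ring_scope.
Local Open Scope ereal_scope.

(* R^n with its Borel sigma-algebra (generated by the coordinates) *)
Notation vec R n := (n.-tuple (measurableTypeR R)).

(* the library has this fact, but its instance is not found by unification *)
Lemma sigma_finite_prod d1 d2 (T1 : measurableType d1) (T2 : measurableType d2)
    (R : realType) (m1 : {sigma_finite_measure set T1 -> \bar R})
    (m2 : {sigma_finite_measure set T2 -> \bar R}) :
  sigma_finite setT (m1 \x m2).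
Proof.
have /sigma_finiteP[F [TF ndF Foo]] := sigma_finiteT m1.
have /sigma_finiteP[G [TG ndG Goo]] := sigma_finiteT m2.
exists (fun n => F n `*` G n).
  rewrite -setXTT TF TG predeqE => -[x y]; split.
    move=> [/= [n _ Fnx] [k _ Gky]]; exists (maxn n k) => //; split.
    - by move: x Fnx; exact/subsetPset/ndF/leq_maxl.
    - by move: y Gky; exact/subsetPset/ndG/leq_maxr.
  by move=> [n _ []/= ? ?]; split; exists n.
move=> k; have [? ?] := Foo k; have [? ?] := Goo k.
split; first exact: measurableX.
by rewrite product_measure1E// lte_mul_pinfty// ge0_fin_numE.
Qed.

Section lebesgue_vec.
Context (R : realType).

Definition vec_cons n (p : measurableTypeR R * vec R n) : vec R n.+1 :=
  [the n.+1.-tuple (measurableTypeR R) of p.1 :: p.2].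

Lemma measurable_vec_cons n :
  measurable_fun [set: measurableTypeR R * vec R n] (@vec_cons n).
Proof. by apply: measurable_cons. Qed.

Section lebesgue_succ.
Context n (mu : {sigma_finite_measure set (vec R n) -> \bar R}).

Definition lebesgue_succ : set (vec R n.+1) -> \bar R :=
  pushforward (@lebesgue_measure R \x mu) (@vec_cons n).

Let lebesgue_succ0 : lebesgue_succ set0 = 0.
Proof. by rewrite /lebesgue_succ /pushforward preimage_set0 measure0. Qed.

Let lebesgue_succ_ge0 A : 0 <= lebesgue_succ A.
Proof. by rewrite /lebesgue_succ /pushforward measure_ge0. Qed.

Let lebesgue_succ_sigma_additive : semi_sigma_additive lebesgue_succ.
Proof.
exact: (@measure_semi_sigma_additive _ _ _
  (measure_function_pushforward__canonical__measure_function_Measure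
     (@lebesgue_measure R \x mu) (@measurable_vec_cons n))).
Qed.

HB.instance Definition _ := isMeasure.Build _ _ _ lebesgue_succ
  lebesgue_succ0 lebesgue_succ_ge0 lebesgue_succ_sigma_additive.

Let lebesgue_succ_sigma_finite : sigma_finite setT lebesgue_succ.
Proof.
have [F TF Foo] : sigma_finite setT (@lebesgue_measure R \x mu).
  exact: sigma_finite_prod.
pose uncons (t : vec R n.+1) : measurableTypeR R * vec R n :=
  (tnth t ord0, [tuple of behead t]).
have consK : cancel (@vec_cons n) uncons.
  by move=> [x t]; congr pair; exact: val_inj.
have muncons : measurable_fun setT uncons.
  apply: measurable_fun_pair; first exact: measurable_tnth.
  exact: measurable_behead.
exists (fun k => uncons @^-1` F k).
  by rewrite -preimage_bigcup -TF preimage_setT.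
move=> k; have [mF Fk] := Foo k; split.
  by rewrite -[X in measurable X]setTI; exact: muncons.
rewrite /lebesgue_succ /pushforward -comp_preimage.
rewrite (_ : _ @^-1` _ = F k)//.
by apply/seteqP; split => x /=; rewrite consK.
Qed.

HB.instance Definition _ := Measure_isSigmaFinite.Build _ _ _ lebesgue_succ
  lebesgue_succ_sigma_finite.

End lebesgue_succ.

(* Lebesgue measure on the Borel sets of R^n, as an iterated product *)
Fixpoint lebesgue_vec n : {sigma_finite_measure set (vec R n) -> \bar R} :=
  if n is n'.+1 return {sigma_finite_measure set (vec R n) -> \bar R}
  then lebesgue_succ (lebesgue_vec n') else dirac [tuple].

Lemma lebesgue_vec_box n (a b : 'I_n -> R) : (forall i, a i <= b i)%R ->
  lebesgue_vec n [set x | forall i, (a i <= tnth x i < b i)%R] =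
  (\prod_(i < n) (b i - a i))%:E.
Proof.
elim: n a b => [|n IH] a b ab /=.
  by rewrite diracE mem_set ?big_ord0//= => -[].
rewrite /lebesgue_succ /pushforward.
rewrite (_ : _ @^-1` _ = `[a ord0, b ord0[ `*`
  [set x : vec R n | forall i, (a (lift ord0 i) <= tnth x i < b (lift ord0 i))%R]);
  last first.
  apply/seteqP; split => -[x t] /= xt.
    split; first by have := xt ord0; rewrite tnth0 in_itv.
    by move=> i; have := xt (lift ord0 i); rewrite tnthS.
  move=> i; have [j ->|->] := unliftP ord0 i.
    by rewrite tnthS; have [_] := xt; exact.
  by have [] := xt => + _; rewrite tnth0 in_itv.
have mB : measurable [set x : vec R n |
    forall i, (a (lift ord0 i) <= tnth x i < b (lift ord0 i))%R].
  rewrite (_ : [set x | _] = \bigcap_(i in [set: 'I_n])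
      ((@tnth _ (measurableTypeR R) ^~ i) @^-1`
        `[a (lift ord0 i), b (lift ord0 i)[)); last first.
    apply/seteqP; split => x /= xB i.
      by move=> _; rewrite /= in_itv; exact: xB.
    by have := xB i Logic.I; rewrite /= in_itv.
  apply: fin_bigcap_measurable => // i _.
  rewrite -[X in measurable X]setTI; apply: measurable_tnth => //.
rewrite product_measure1E//= IH//.
rewrite lebesgue_measure_itv/= lte_fin big_ord_recl EFinM.
have := ab ord0; rewrite le_eqVlt => /orP[/eqP ->|->].
  by rewrite ltxx subrr.
by rewrite EFinB.
Qed.
End lebesgue_vec.

(* Lebesgue measure on R^(d1+d2) = R^d1 x R^d2, resp.
   R^(d1+d2+d3) = R^d1 x R^d2 x R^d3, on the Lebesgue measurable sets, i.e.,
   the completion of the product measure; the carriers are still the plain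
   product types *)
Section lebesgue_product.
Context (R : realType).

Definition borel2 d1 d2 : {measure set (vec R d1 * vec R d2) -> \bar R} :=
  lebesgue_vec R d1 \x lebesgue_vec R d2.
Definition space2 d1 d2 : measurableType _ :=
  caratheodory_type (borel2 d1 d2)^*%mu.
Definition leb2 d1 d2 : {measure set (space2 d1 d2) -> \bar R} :=
  @completed_measure_extension _ _ _ (borel2 d1 d2).

Definition borel3 d1 d2 d3 :
    {measure set (vec R d1 * vec R d2 * vec R d3) -> \bar R} :=
  borel2 d1 d2 \x lebesgue_vec R d3.
Definition space3 d1 d2 d3 : measurableType _ :=
  caratheodory_type (borel3 d1 d2 d3)^*%mu.
Definition leb3 d1 d2 d3 : {measure set (space3 d1 d2 d3) -> \bar R} :=
  @completed_measure_extension _ _ _ (borel3 d1 d2 d3).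

End lebesgue_product.

Section dyadic.
Context (R : realType) (n : nat).

(* (x, k) stands for the half-open cube with lower corner x and side 2 ^ k *)
Definition cube : choiceType := (n.-tuple R * int)%type.

Definition side (Q : cube) : R := (2 ^ Q.2)%R.

Definition cube_set (Q : cube) : set (vec R n) :=
  [set x | forall i, (tnth Q.1 i <= tnth x i < tnth Q.1 i + side Q)%R].

(* a general dyadic grid, not only the standard one *)
Record dyadic_grid (D : set cube) : Prop := DyadicGrid {
  dyadic_partition : forall (k : int) (x : vec R n),
    exists! Q : cube, [/\ D Q, Q.2 = k & cube_set Q x];
  dyadic_nested : forall P Q : cube, D P -> D Q ->
    cube_set P `&` cube_set Q !=set0 ->
    cube_set P `<=` cube_set Q \/ cube_set Q `<=` cube_set P }.

(* for n > 0, D a grid and Q in D, exactly one P satisfies the condition *)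
Definition ancestor (D : set cube) (k : nat) (Q : cube) : cube :=
  xget Q [set P | [/\ D P, side P = (2 ^+ k * side Q)%R
                    & cube_set Q `<=` cube_set P]].

End dyadic.

Section weight.
Context (R : realType).
Implicit Types w : nat -> nat -> R.

Definition ft_norm w : \bar R :=
  ereal_sup (range (fun N : nat => \sum_(a < N.+1) (w a (N - a)%N)%:E)).

Definition admissible_weight w : Prop :=
  [/\ forall a b, (0 <= w a b)%R,
      forall a a' b, (a <= a')%N -> (w a' b <= w a b)%R,
      forall a b b', (b <= b')%N -> (w a b' <= w a b)%R &
      ft_norm w < +oo].

End weight.

(* the notions common to both settings: T is the ambient space, rect the type
   of (codes of) rectangles and rset I the set of points of I *)
Section families.
Context (R : realType) d (T : measurableType d) (mu : set T -> \bar R).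
Context (rect : choiceType) (rset : rect -> set T).
Implicit Types (F U G : set rect) (Om : set T).

Definition maximal (B : set rect) (f : T -> R) (x : T) : \bar R :=
  ereal_sup [set (\int[mu]_(y in rset I) `|(f y)%:E|) / mu (rset I) |
             I in [set I | B I /\ rset I x]].

Definition enlargement (B : set rect) Om : set T :=
  [set x | (2^-1)%:E < maximal B \1_Om x].

(* max {k | anc k is contained in A}; the default value 0 is not used when A is
   an enlargement containing I = anc 0 and anc k are its extensions, since A
   then has finite measure *)
Definition max_extension (anc : nat -> rect) (A : set T) : nat :=
  xget 0%N [set k | rset (anc k) `<=` A /\
    forall m, rset (anc m) `<=` A -> (m <= k)%N].

Definition admissible_pair (F : set rect) Om U : Prop :=
  [/\ measurable Om, mu Om < +oo, U `<=` F,
      forall I, U I -> rset I `<=` Om &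
      forall I J, U I -> U J -> rset I `<=` rset J -> I = J].

Definition weighted_height (W : rect -> R) U (x : T) : \bar R :=
  \esum_(I in U) (W I * \1_(rset I) x)%:E.

Definition height G (x : T) : \bar R := \esum_(I in G) (\1_(rset I) x)%:E.

Definition shadow G : set T := \bigcup_(I in G) rset I.

Definition sparse (eta : R) G : Prop := exists E : rect -> set T,
  [/\ forall I, G I -> measurable (E I), forall I, G I -> E I `<=` rset I,
      trivIset G E & forall I, G I -> eta%:E * mu (rset I) <= mu (E I)].

End families.

Arguments height {R d T rect} rset G x.
Arguments shadow {d T rect} rset G.

Section biparameter.
Context (R : realType) (d1 d2 : nat).
Context (D1 : set (cube R d1)) (D2 : set (cube R d2)).

Definition rect2 : choiceType := (cube R d1 * cube R d2)%type.

Definition rset2 (I : rect2) : set (space2 R d1 d2) :=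
  cube_set I.1 `*` cube_set I.2.

Definition rects2 : set rect2 := [set I | D1 I.1 /\ D2 I.2].

Definition enlargement2 (Om : set (space2 R d1 d2)) :=
  enlargement (leb2 R d1 d2) rset2 rects2 Om.

Definition e1_2 (I : rect2) Om : nat :=
  max_extension rset2 (fun k => (ancestor D1 k I.1, I.2)) (enlargement2 Om).
Definition e2_2 (I : rect2) Om : nat :=
  max_extension rset2 (fun k => (I.1, ancestor D2 k I.2)) (enlargement2 Om).

Definition H2 (w : nat -> nat -> R) Om U : space2 R d1 d2 -> \bar R :=
  weighted_height rset2 (fun I => w (e1_2 I Om) (e2_2 I Om)) U.

End biparameter.

Arguments rset2 {R d1 d2} I.

Section zygmund.
Context (R : realType) (d1 d2 d3 : nat).
Context (D1 : set (cube R d1)) (D2 : set (cube R d2)) (D3 : set (cube R d3)).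

Definition rect3 : choiceType := (cube R d1 * cube R d2 * cube R d3)%type.

Definition rset3 (I : rect3) : set (space3 R d1 d2 d3) :=
  cube_set I.1.1 `*` cube_set I.1.2 `*` cube_set I.2.

Definition zygmund_rects : set rect3 :=
  [set I | [/\ D1 I.1.1, D2 I.1.2, D3 I.2 &
               side I.2 = (side I.1.1 * side I.1.2)%R]].

Definition subzygmund_rects : set rect3 :=
  [set I | [/\ D1 I.1.1, D2 I.1.2, D3 I.2 &
               (side I.2 <= side I.1.1 * side I.1.2)%R]].

Definition enlargement3 (Om : set (space3 R d1 d2 d3)) :=
  enlargement (leb3 R d1 d2 d3) rset3 subzygmund_rects Om.

Definition e1_3 (I : rect3) Om : nat :=
  max_extension rset3 (fun k => (ancestor D1 k I.1.1, I.1.2, I.2))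
    (enlargement3 Om).
Definition e2_3 (I : rect3) Om : nat :=
  max_extension rset3 (fun k => (I.1.1, ancestor D2 k I.1.2, I.2))
    (enlargement3 Om).

Definition H3 (w : nat -> nat -> R) Om U : space3 R d1 d2 d3 -> \bar R :=
  weighted_height rset3 (fun I => w (e1_3 I Om) (e2_3 I Om)) U.

End zygmund.

Arguments rset3 {R d1 d2 d3} I.

(* hyperbolic cosine on the extended reals, with value +oo at -oo and +oo *)
Definition coshe (R : realType) (x : \bar R) : \bar R :=
  (2^-1)%:E * (expeR x + expeR (- x)).

(* Main.v *)
Require Import Defs.
From HB Require Import structures.
From mathcomp Require Import all_boot all_order all_algebra.
From mathcomp Require Import ring lra.
Import Order.TTheory GRing.Theory Num.Theory.
Set Implicit Arguments.
Unset Strict Implicit.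
Unset Printing Implicit Defensive.
Local Open Scope ring_scope.

(* Only finitely many rectangles matter at a time, and cutting space into the atoms they generate
   turns everything into statements on a finite product X1 x X2 x X3 of weighted sets; the bi-
   parameter setting is the case where the third sides all coincide.

   The weights W = w(e1, e2) / |w|_ft of an admissible pair satisfy a Carleson condition. For S in
   U, call a point x of J in S good if neither its line through the first extension of J outside
   of the enlargement, nor its line through the second one, is contained in sh S. The rectangles
   for which x is good form a chain whose scales put their pairs (e1, e2) above a staircase, so
   that their total weight is at most an antidiagonal sum of w, and the sum of W(J) |good J| over
   S is at most |sh S|. As these extensions have at most half of their mass in Omega, maximal
   inequalities show that the J with |good J| < kappa^2 |J| cover at most half of sh S. Induction
   on S concludes.

   By incomparability the rectangles through a point form a chain: the first sides increase while
   the second ones decrease. Let F_J (y1) count, with weights c W, the chains below J whose first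
   sides contain y1, and similarly G_J (y2). The Carleson embedding bounds the integrals of the
   heights weighted by F and by G. At a point x, the rectangles J with 2^k <= F_J < 2^(k+1) and
   2^l <= G_J < 2^(l+1) have bounded total weight, so the height is at most of order n^2 if 2^n is
   of the order of the weighted heights: this gives the integrability of cosh (sqrt H). If there
   is no third side, F alone suffices: the height is of order n, and exp H is integrable.

   A greedy selection gives a sparse G0 with |sh U| <= 2 * 84 |sh G0|. The convexity inequality
   exp (t x) - 1 <= t (exp x - 1) (the same holds for cosh) then bounds the left-hand side by t
   |sh U|, whereas the right-hand side is at least a constant times |sh G0| because the height of
   G0 is at least 1 on sh G0. *)

(** * Maximal functions of laminar families *)

(** The chain count F_J stands in for an exponential of the part of the height that lies below J: it
    at least doubles whenever the chains below J pass a further amount of weight of order 1/c. Yet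
    it obeys a linear recursion. Averaged over J, this recursion produces the bilinear form of the
    Carleson embedding, because two rectangles in the right relation intersect in a product of sides
    of the one and of the other. With c a small multiple of the inverse Carleson constant the form
    is absorbed. So exponential integrability costs only first and second powers, and the maximal
    functions enter only through L^2 bounds, the weak L^1 bound being false in several parameters.

    The third sides are the obstacle in the Zygmund setting. I is counted in F_J only if its second
    and third sides contain those of J, whereas third sides need not be monotone along a chain.
    Compared with the member of a cell that has the smallest third side, each other member is
    counted in F or in G, but which of the two varies. This is why two functions, cells with two
    indices and in the end a square root appear. *)

Section laminar_maximal.
Context (R : realFieldType) (X : finType) (mu : X -> R).
Hypothesis mu_ge0 : forall x, 0 <= mu x.
Implicit Types (A Q : {set X}) (F : {set {set X}}) (f g v : X -> R).

Definition meas A : R := \sum_(x in A) mu x.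

Definition laminar F := forall A B, A \in F -> B \in F ->
  [\/ A \subset B, B \subset A | [disjoint A & B]].

Lemma meas_ge0 A : 0 <= meas A.
Proof. by apply: sumr_ge0. Qed.

Lemma laminar_sub F F' : F' \subset F -> laminar F -> laminar F'.
Proof. by move=> /subsetP sF lF A B /sF AF /sF; exact: lF. Qed.

(** The maximal members of a laminar family are pairwise disjoint and have the same union, so their
    sums add up. This is the covering lemma of the proof: [g] may change sign and is a difference of
    two densities in the applications. *)
Lemma laminar_cover_ge0 F g : laminar F ->
  (forall Q, Q \in F -> 0 <= \sum_(x in Q) g x) -> 0 <= \sum_(x in cover F) g x.
Proof.
move=> lF g0.
pose P := [set Q in F | [forall B in F, (Q \subset B) ==> (B == Q)]].
have tP : trivIset P.
  apply/trivIsetP => A B; rewrite !inE => /andP[AF /forall_inP mA] /andP[BF /forall_inP mB] AB.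
  case: (lF _ _ AF BF) => // [sAB|sBA].
  - by have := mA _ BF; rewrite sAB /= eq_sym (negPf AB).
  - by have := mB _ AF; rewrite sBA /= (negPf AB).
have cP : cover P = cover F.
  apply/setP => x; apply/bigcupP/bigcupP => -[Q QP xQ].
    by exists Q => //; move: QP; rewrite inE => /andP[].
  have [M /maxsetP[/andP[MF QM] mM] _] :=
    @maxset_exists X (fun B => (B \in F) && (Q \subset B)) Q (introT andP (conj QP (subxx Q))).
  exists M; last exact: (subsetP QM).
  rewrite inE MF; apply/forall_inP => B BF; apply/implyP => MB.
  by rewrite (mM B)// BF (subset_trans QM MB).
rewrite -cP big_trivIset//=; apply: sumr_ge0 => Q.
by rewrite inE => /andP[QF _]; exact: g0.
Qed.

Definition avg f Q : R := (\sum_(x in Q) mu x * f x) / meas Q.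

Definition mx F f x : R := \big[Num.max/0]_(Q in F | x \in Q) avg f Q.

Lemma mx_ge0 F f x : 0 <= mx F f x.
Proof. exact: bigmax_ge_id. Qed.

Lemma sum_le_mx F f Q x : (forall y, 0 <= f y) -> Q \in F -> x \in Q ->
  \sum_(y in Q) mu y * f y <= meas Q * mx F f x.
Proof.
move=> f0 QF xQ.
have [Q0|Q0] := eqVneq (meas Q) 0.
  rewrite Q0 mul0r big1// => y yQ.
  have /(_ y yQ) -> := psumr_eq0P (fun y _ => mu_ge0 y) Q0.
  by rewrite mul0r.
have Qp : 0 < meas Q by rewrite lt_neqAle eq_sym Q0 meas_ge0.
rewrite mulrC -ler_pdivrMr//; apply: (@le_bigmax_cond _ _ _ _ _ _ (avg f)).
by rewrite QF xQ.
Qed.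

(** The superlevel set is the union of the members with average at least [l], and on each of these
    the sum of [mu * (f - l)] is nonnegative. *)
Lemma mx_weak F f (l : R) : laminar F -> (forall y, 0 <= f y) -> 0 < l ->
  l * meas [set x | l <= mx F f x] <= \sum_(x | l <= mx F f x) mu x * f x.
Proof.
move=> lF f0 l0; pose F' := [set Q in F | l <= avg f Q].
have cF' : cover F' = [set x | l <= mx F f x].
  apply/setP => x; rewrite inE; apply/bigcupP/idP => [[Q]|].
    rewrite inE => /andP[QF lQ] xQ; apply: (le_trans lQ).
    by apply: (@le_bigmax_cond _ _ _ _ _ _ (avg f)); rewrite QF xQ.
  move=> lx; have [/existsP[Q /andP[QF' xQ]]|/existsPn nQ] :=
    boolP [exists Q, (Q \in F') && (x \in Q)].
    by exists Q.
  suff : mx F f x < l by rewrite ltNge lx.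
  apply: bigmax_lt => // Q /andP[QF xQ]; rewrite ltNge; apply/negP => lQ.
  by have := nQ Q; rewrite inE QF lQ xQ.
have lF' : laminar F' by apply: laminar_sub lF; apply/subsetP => Q; rewrite inE => /andP[].
have := @laminar_cover_ge0 F' (fun x => mu x * f x - l * mu x) lF'.
rewrite cF' sumrB -mulr_sumr => H.
rewrite -subr_ge0.
rewrite (eq_bigl (fun x => x \in [set x | l <= mx F f x])); last by move=> x; rewrite inE.
apply: H => Q; rewrite inE => /andP[QF].
rewrite sumrB -mulr_sumr subr_ge0 /avg => lQ.
have [Q0|Q0] := eqVneq (meas Q) 0.
  by move: lQ; rewrite Q0 invr0 mulr0 leNgt l0.
have Qp : 0 < meas Q by rewrite lt_neqAle eq_sym Q0 meas_ge0.
by rewrite -ler_pdivlMr.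
Qed.

(* Layer-cake with a shift [t] of the levels, which makes the induction on the support close. *)
Lemma layer_cake n f v (t : R) : (forall x, 0 <= v x) -> 0 <= t ->
  (#|[set x | (0 < v x)%R]| <= n)%N ->
  (forall l : R, 0 < l -> (l + t) * meas [set x | l <= v x] <= \sum_(x | l <= v x) mu x * f x) ->
  \sum_x mu x * (v x ^+ 2 + 2 * t * v x) <= 2 * \sum_x mu x * (f x * v x).
Proof.
elim: n v t => [|n IH] v t v0 t0 vn H.
  have vz x : v x = 0.
    move: vn; rewrite leqn0 cards_eq0 => /eqP/setP/(_ x).
    by rewrite !inE => /negbT; rewrite -leNgt => h; apply/eqP; rewrite eq_le h v0.
  rewrite !big1 ?mulr0// => x _; rewrite vz; ring.
have [S0|] := set_0Vmem [set x | 0 < v x].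
  by apply: (IH v t) => //; rewrite S0 cards0.
move=> [x0]; rewrite inE => vx0.
case: (@arg_minP _ R X x0 (fun x => 0 < v x) v vx0) => i vi mini.
(* Lowering the positive values of [v] by their minimum [l] takes at least one point out of the
   support. Level [l'] of [v'] is level [l' + l] of [v], which is where the larger shift [t + l]
   comes from. *)
pose l := v i; pose v' x := if 0 < v x then v x - l else 0.
have v'0 x : 0 <= v' x by rewrite /v'; case: ifPn => // /mini; rewrite subr_ge0.
have Hm : [set x | l <= v x] = [set x | 0 < v x].
  by apply/setP => x; rewrite !inE; apply/idP/idP => [/(lt_le_trans vi)//|/mini].
have v'n : (#|[set x | (0 < v' x)%R]| <= n)%N.
  rewrite -ltnS; apply: leq_trans vn; apply: proper_card; apply/properP; split.
    by apply/subsetP => x; rewrite !inE /v'; case: ifP => //; rewrite ltxx.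
  by exists i; rewrite !inE// /v' vi subrr ltxx.
have H' (l' : R) : 0 < l' -> (l' + (t + l)) * meas [set x | l' <= v' x] <= \sum_(x | l' <= v' x) mu
  x * f x.
  move=> l'0.
  have E x : (l' <= v' x) = (l' + l <= v x).
    rewrite /v'; case: ifPn; first by rewrite lerBrDr.
    rewrite -leNgt => h; rewrite leNgt l'0/=; apply/esym/negbTE; rewrite -ltNge.
    by apply: (le_lt_trans h); rewrite addr_gt0.
  under eq_bigl do rewrite E.
  rewrite (_ : [set x | l' <= v' x] = [set x | l' + l <= v x]); last first.
    by apply/setP => x; rewrite !inE E.
  by rewrite (addrC t) addrA; apply: H; rewrite addr_gt0.
have := IH v' (t + l) v'0 (addr_ge0 t0 (ltW vi)) v'n H'.
have Hl := H l vi; rewrite Hm in Hl.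
have E1 : \sum_x mu x * (v x ^+ 2 + 2 * t * v x) =
  \sum_x mu x * (v' x ^+ 2 + 2 * (t + l) * v' x) + (l ^+ 2 + 2 * t * l) * meas [set x | 0 < v x].
  rewrite /meas mulr_sumr [X in _ = _ + X]big_mkcond -big_split; apply: eq_bigr => x _.
  rewrite inE /v' /=; case: ifPn => [_|]; first ring.
  rewrite -leNgt => h; have -> : v x = 0 by apply/eqP; rewrite eq_le h v0.
  ring.
have E2 : \sum_x mu x * (f x * v x) =
  \sum_x mu x * (f x * v' x) + l * \sum_(x in [set x | 0 < v x]) mu x * f x.
  rewrite mulr_sumr [X in _ = _ + X]big_mkcond -big_split; apply: eq_bigr => x _.
  rewrite inE /v' /=; case: ifPn => [_|]; first ring.
  rewrite -leNgt => h; have -> : v x = 0 by apply/eqP; rewrite eq_le h v0.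
  ring.
have E3 : \sum_(x | l <= v x) mu x * f x = \sum_(x in [set x | 0 < v x]) mu x * f x.
  by apply: eq_bigl => x; rewrite -Hm inE.
rewrite E3 in Hl; rewrite E1 E2.
set m := meas _ in Hl *; set s := \sum_(x in _) _ in Hl *.
have m0 : 0 <= m by exact: meas_ge0.
have l0 : 0 < l := vi.
move=> IH'; nra.
Qed.

(** [layer_cake] without shift bounds the squared norm of [mx F f] by twice its pairing with [f],
    and the inequality of the means absorbs it. The 4 is the square of the constant 2 in Doob's
    inequality. *)
Lemma mx_L2 F f : laminar F -> (forall y, 0 <= f y) ->
  \sum_x mu x * mx F f x ^+ 2 <= 4 * \sum_x mu x * f x ^+ 2.
Proof.
move=> lF f0.
have := @layer_cake #|X| f (mx F f) 0 (mx_ge0 F f) (lexx 0) (max_card _).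
have H (l : R) : 0 < l -> (l + 0) * meas [set x | l <= mx F f x] <= \sum_(x | l <= mx F f x) mu x *
  f x.
  by rewrite addr0; exact: mx_weak.
move=> /(_ H); under eq_bigr do rewrite mulr0 mul0r addr0.
move=> /le_trans E.
suff : 2 * \sum_x mu x * (f x * mx F f x) <=
   2 * (\sum_x mu x * f x ^+ 2) + 2^-1 * (\sum_x mu x * mx F f x ^+ 2).
  move/E; lra.
rewrite !mulr_sumr -big_split; apply: ler_sum => x _ /=.
have := mu_ge0 x; have : 0 <= (2 * f x - mx F f x) ^+ 2 by apply: sqr_ge0.
nra.
Qed.

End laminar_maximal.

(** * Maximal functions on a product of three sets *)

Definition rect (X1 X2 X3 : finType) (A1 : {set X1}) (A2 : {set X2}) (A3 : {set X3}) :
  {set X1 * X2 * X3} := setX (setX A1 A2) A3.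

Lemma in_rect (X1 X2 X3 : finType) (A1 : {set X1}) (A2 : {set X2}) (A3 : {set X3}) x :
  (x \in rect A1 A2 A3) = [&& x.1.1 \in A1, x.1.2 \in A2 & x.2 \in A3].
Proof. by case: x => -[x1 x2] x3; rewrite !in_setX andbA. Qed.

Section strong_maximal.
Context (R : realFieldType) (X1 X2 X3 : finType).
Context (mu1 : X1 -> R) (mu2 : X2 -> R) (mu3 : X3 -> R).
Hypothesis mu1_ge0 : forall x, 0 <= mu1 x.
Hypothesis mu2_ge0 : forall x, 0 <= mu2 x.
Hypothesis mu3_ge0 : forall x, 0 <= mu3 x.
Notation X := (X1 * X2 * X3)%type.
Implicit Types (f : X -> R) (x : X).

Definition prodw x : R := mu1 x.1.1 * mu2 x.1.2 * mu3 x.2.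
Local Notation mu := prodw.

Lemma prodw_ge0 x : 0 <= mu x.
Proof. by rewrite !mulr_ge0. Qed.

Lemma sum_triple f : \sum_x f x = \sum_x1 \sum_x2 \sum_x3 f (x1, x2, x3).
Proof.
rewrite pair_bigA pair_bigA /=; apply: eq_bigr => -[[]] //.
Qed.

Lemma sum_rect A1 A2 A3 f : \sum_(x in rect A1 A2 A3) mu x * f x =
  \sum_(x3 in A3) mu3 x3 * \sum_(x2 in A2) mu2 x2 * \sum_(x1 in A1) mu1 x1 * f (x1, x2, x3).
Proof.
rewrite big_mkcond sum_triple exchange_big.
under eq_bigr do rewrite exchange_big.
rewrite exchange_big /=; symmetry; rewrite big_mkcond; apply: eq_bigr => x3 _.
case: ifPn => x3A; last first.
  by rewrite big1// => x2 _; rewrite big1// => x1 _; rewrite in_rect /= (negPf x3A) !andbF.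
rewrite mulr_sumr big_mkcond; apply: eq_bigr => x2 _.
case: ifPn => x2A; last first.
  by rewrite big1// => x1 _; rewrite in_rect /= (negPf x2A) !andbF.
rewrite !mulr_sumr big_mkcond; apply: eq_bigr => x1 _.
rewrite in_rect /= x2A x3A !andbT; case: ifPn => // _; rewrite /prodw/=; ring.
Qed.

Lemma meas_rect A1 A2 A3 :
  meas mu (rect A1 A2 A3) = meas mu1 A1 * meas mu2 A2 * meas mu3 A3.
Proof.
rewrite /meas (eq_bigr (fun x => mu x * 1)); last by move=> *; rewrite mulr1.
rewrite (sum_rect _ _ _ (fun=> 1)).
transitivity (\sum_(x3 in A3) mu3 x3 * (meas mu1 A1 * meas mu2 A2)).
  apply: eq_bigr => x3 _; congr (_ * _); rewrite mulrC mulr_suml; apply: eq_bigr => x2 _.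
  by congr (_ * _); apply: eq_bigr => x1 _; rewrite mulr1.
by rewrite -mulr_suml mulrC.
Qed.

Context (fam1 : {set {set X1}}) (fam2 : {set {set X2}}) (fam3 : {set {set X3}}).
Hypothesis lam1 : laminar fam1.
Hypothesis lam2 : laminar fam2.
Hypothesis lam3 : laminar fam3.

Definition mx1 f x : R := mx mu1 fam1 (fun y => f (y, x.1.2, x.2)) x.1.1.
Definition mx2 f x : R := mx mu2 fam2 (fun y => f (x.1.1, y, x.2)) x.1.2.
Definition mx3 f x : R := mx mu3 fam3 (fun y => f (x.1, y)) x.2.

Lemma mx1_L2 f : (forall x, 0 <= f x) ->
  \sum_x mu x * mx1 f x ^+ 2 <= 4 * \sum_x mu x * f x ^+ 2.
Proof.
move=> f0; rewrite !sum_triple [leLHS]exchange_big [X in 4 * X]exchange_big mulr_sumr.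
apply: ler_sum => x2 _; rewrite [leLHS]exchange_big [X in 4 * X]exchange_big mulr_sumr.
apply: ler_sum => x3 _.
have := mx_L2 mu1_ge0 lam1 (fun y => f0 (y, x2, x3)).
move=> /(ler_wpM2l (mulr_ge0 (mu2_ge0 x2) (mu3_ge0 x3))); rewrite mulrCA !mulr_sumr.
rewrite ?mulr_sumr; by congr (_ <= _); apply: eq_bigr => x1 _; rewrite /prodw /mx1 /mx2 /mx3 /=;
  ring.
Qed.

Lemma mx2_L2 f : (forall x, 0 <= f x) ->
  \sum_x mu x * mx2 f x ^+ 2 <= 4 * \sum_x mu x * f x ^+ 2.
Proof.
move=> f0; rewrite !sum_triple mulr_sumr.
apply: ler_sum => x1 _; rewrite [leLHS]exchange_big [X in 4 * X]exchange_big mulr_sumr.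
apply: ler_sum => x3 _.
have := mx_L2 mu2_ge0 lam2 (fun y => f0 (x1, y, x3)).
move=> /(ler_wpM2l (mulr_ge0 (mu1_ge0 x1) (mu3_ge0 x3))); rewrite mulrCA !mulr_sumr.
rewrite ?mulr_sumr; by congr (_ <= _); apply: eq_bigr => x2 _; rewrite /prodw /mx1 /mx2 /mx3 /=;
  ring.
Qed.

Lemma mx3_L2 f : (forall x, 0 <= f x) ->
  \sum_x mu x * mx3 f x ^+ 2 <= 4 * \sum_x mu x * f x ^+ 2.
Proof.
move=> f0; rewrite !sum_triple mulr_sumr.
apply: ler_sum => x1 _; rewrite mulr_sumr; apply: ler_sum => x2 _.
have := mx_L2 mu3_ge0 lam3 (fun y => f0 (x1, x2, y)).
move=> /(ler_wpM2l (mulr_ge0 (mu1_ge0 x1) (mu2_ge0 x2))); rewrite mulrCA !mulr_sumr.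
rewrite ?mulr_sumr; by congr (_ <= _); apply: eq_bigr => x3 _; rewrite /prodw /mx1 /mx2 /mx3 /=;
  ring.
Qed.

(** Iterated one-variable maximal functions dominate the averages over rectangles. The version
    without the first variable serves for averages over the last two coordinates at a fixed first
    one, as in [meas_sh_bad]. *)
Definition mx23 f := mx3 (mx2 f).
Definition mx123 f := mx23 (mx1 f).

Lemma mx23_L2 f : (forall x, 0 <= f x) ->
  \sum_x mu x * mx23 f x ^+ 2 <= 16 * \sum_x mu x * f x ^+ 2.
Proof.
move=> f0; have := mx2_L2 f0.
have := @mx3_L2 (mx2 f) (fun x => mx_ge0 _ _ _ _); rewrite /mx23; lra.
Qed.

Lemma mx123_L2 f : (forall x, 0 <= f x) ->
  \sum_x mu x * mx123 f x ^+ 2 <= 64 * \sum_x mu x * f x ^+ 2.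
Proof.
move=> f0; have := mx1_L2 f0.
have := @mx23_L2 (mx1 f) (fun x => mx_ge0 _ _ _ _); rewrite /mx123; lra.
Qed.

Lemma mx123_ge0 f x : 0 <= mx123 f x. Proof. exact: mx_ge0. Qed.

Lemma sum_le_mx23 f A2 A3 x : (forall x, 0 <= f x) -> A2 \in fam2 -> A3 \in fam3 ->
  x.1.2 \in A2 -> x.2 \in A3 ->
  \sum_(x3 in A3) mu3 x3 * \sum_(x2 in A2) mu2 x2 * f (x.1.1, x2, x3) <=
  meas mu2 A2 * meas mu3 A3 * mx23 f x.
Proof.
case: x => -[x1 x2] x3 /= f0 A2F A3F x2A x3A.
have := @sum_le_mx _ _ _ mu3_ge0 fam3 (fun y => mx2 f (x1, x2, y)) A3 x3
  (fun y => mx_ge0 _ _ _ _) A3F x3A.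
move=> /(ler_wpM2l (meas_ge0 mu2_ge0 A2)); rewrite mulrA; apply: le_trans.
rewrite mulr_sumr; apply: ler_sum => y3 _; rewrite mulrCA ler_wpM2l//.
exact: (@sum_le_mx _ _ _ mu2_ge0 fam2 (fun y => f (x1, y, y3))).
Qed.

Lemma sum_le_mx123 f A1 A2 A3 x : (forall x, 0 <= f x) ->
  A1 \in fam1 -> A2 \in fam2 -> A3 \in fam3 -> x \in rect A1 A2 A3 ->
  \sum_(y in rect A1 A2 A3) mu y * f y <= meas mu (rect A1 A2 A3) * mx123 f x.
Proof.
move=> f0 A1F A2F A3F; rewrite in_rect => /and3P[x1A x2A x3A].
have := @sum_le_mx23 (mx1 f) A2 A3 x (fun y => mx_ge0 _ _ _ _) A2F A3F x2A x3A.
move=> /(ler_wpM2l (meas_ge0 mu1_ge0 A1)); rewrite meas_rect !mulrA; apply: le_trans.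
rewrite sum_rect mulr_sumr; apply: ler_sum => y3 _; rewrite mulrCA ler_wpM2l//.
rewrite mulr_sumr; apply: ler_sum => y2 _; rewrite mulrCA ler_wpM2l//.
exact: (@sum_le_mx _ _ _ mu1_ge0 fam1 (fun y => f (y, y2, y3))).
Qed.

End strong_maximal.

Section generic.
Context (R : realFieldType) (X : finType) (mu : X -> R).
Hypothesis mu_ge0 : forall x, 0 <= mu x.
Implicit Types A B : {set X}.

Lemma meas_setI A B : meas mu (A :&: B) = \sum_(x in A) mu x * (x \in B)%:R.
Proof.
rewrite /meas big_mkcond [RHS]big_mkcond; apply: eq_bigr => x _.
by rewrite inE; case: (x \in A); case: (x \in B); rewrite ?mulr1 ?mulr0.
Qed.

Lemma meas_ind A : meas mu A = \sum_x mu x * (x \in A)%:R ^+ 2.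
Proof.
rewrite /meas big_mkcond; apply: eq_bigr => x _.
by case: (x \in A); rewrite ?expr1n ?expr0n ?mulr1 ?mulr0.
Qed.

Lemma meas_sub A B : A \subset B -> meas mu A <= meas mu B.
Proof.
move=> /subsetP AB; rewrite /meas [leLHS]big_mkcond [leRHS]big_mkcond.
apply: ler_sum => x _; case: ifPn => [/AB ->//|_]; case: ifP => //.
Qed.

Lemma chebyshev (g : X -> R) A (d : R) : 0 <= d -> (forall x, x \in A -> d <= g x) ->
  d ^+ 2 * meas mu A <= \sum_x mu x * g x ^+ 2.
Proof.
move=> d0 H; rewrite /meas mulr_sumr [leLHS]big_mkcond; apply: ler_sum => x _.
case: ifPn => [/H dg|_]; last by rewrite mulr_ge0// sqr_ge0.
by rewrite mulrC ler_wpM2l// ler_sqr ?nnegrE// (le_trans d0).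
Qed.

End generic.

(** * Carleson families *)

Section rectangle_families.
Context (R : realFieldType) (X1 X2 X3 : finType).
Context (mu1 : X1 -> R) (mu2 : X2 -> R) (mu3 : X3 -> R).
Hypothesis mu1_ge0 : forall x, 0 <= mu1 x.
Hypothesis mu2_ge0 : forall x, 0 <= mu2 x.
Hypothesis mu3_ge0 : forall x, 0 <= mu3 x.
Context (fam1 : {set {set X1}}) (fam2 : {set {set X2}}) (fam3 : {set {set X3}}).
Hypothesis lam1 : laminar fam1.
Hypothesis lam2 : laminar fam2.
Hypothesis lam3 : laminar fam3.
Notation X := (X1 * X2 * X3)%type.
Local Notation mu := (prodw mu1 mu2 mu3).
Local Notation Mx := (mx123 mu1 mu2 mu3 fam1 fam2 fam3).
Let mu_ge0 : forall x, 0 <= mu x := prodw_ge0 mu1_ge0 mu2_ge0 mu3_ge0.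

Context (K : finType) (A1 : K -> {set X1}) (A2 : K -> {set X2}) (A3 : K -> {set X3}).
Implicit Types (U S : {set K}) (I J : K) (W : K -> R).

Definition rct I : {set X} := rect (A1 I) (A2 I) (A3 I).
Definition vol I : R := meas mu (rct I).
Definition sh S : {set X} := \bigcup_(I in S) rct I.
Definition in_fam U := forall I, I \in U -> [/\ A1 I \in fam1, A2 I \in fam2 & A3 I \in fam3].

Definition carleson U W (L : R) := forall S, S \subset U ->
  \sum_(I in S) W I * vol I <= L * meas mu (sh S).

Lemma vol_ge0 I : 0 <= vol I.
Proof. exact: meas_ge0. Qed.

Lemma volE I : vol I = meas mu1 (A1 I) * meas mu2 (A2 I) * meas mu3 (A3 I).
Proof. exact: meas_rect. Qed.

Lemma subset_sh S S' : S \subset S' -> sh S \subset sh S'.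
Proof.
by move=> /subsetP SS'; apply/subsetP => x /bigcupP[I /SS' IS xI]; apply/bigcupP; exists I.
Qed.

(** [mx123 f] is at least [d] on the shadow, so Chebyshev's inequality and the L^2 bound 64 = 4^3
    apply. For an indicator [f] this does the work of a weak L^1 bound. *)
Lemma weak_type U (f : X -> R) (d : R) : in_fam U -> (forall x, 0 <= f x) -> 0 <= d ->
  (forall I, I \in U -> 0 < vol I) ->
  (forall I, I \in U -> d * vol I <= \sum_(x in rct I) mu x * f x) ->
  d ^+ 2 * meas mu (sh U) <= 64 * \sum_x mu x * f x ^+ 2.
Proof.
move=> fU f0 d0 pU dU.
apply: le_trans (mx123_L2 mu1_ge0 mu2_ge0 mu3_ge0 lam1 lam2 lam3 f0).
apply: (chebyshev mu_ge0) => // x /bigcupP[I IU xI].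
have [A1F A2F A3F] := fU _ IU.
have := sum_le_mx123 mu1_ge0 mu2_ge0 mu3_ge0 f0 A1F A2F A3F xI.
move=> /(le_trans (dU I IU)); rewrite mulrC ler_pM2l//; exact: pU.
Qed.

(** Another layer-cake induction: with [l] the least positive value of [v] and [S] its support in
    [U], [v] loses [l] on [S] and [V] loses [l] on [sh S], and the Carleson condition for [S]
    compares the two losses. *)
Lemma carleson_sup U W L n (v : K -> R) (V : X -> R) :
  0 <= L -> carleson U W L -> (forall I, 0 <= v I) -> (forall x, 0 <= V x) ->
  (forall I x, I \in U -> x \in rct I -> v I <= V x) ->
  (#|[set I in U | (0 < v I)%R]| <= n)%N ->
  \sum_(I in U) W I * vol I * v I <= L * \sum_x mu x * V x.
Proof.
move=> L0 cU; elim: n v V => [|n IH] v V v0 V0 vV vn.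
  rewrite big1; first by rewrite mulr_ge0// sumr_ge0// => x _; rewrite mulr_ge0.
  move=> I IU; move: vn; rewrite leqn0 cards_eq0 => /eqP/setP/(_ I).
  rewrite !inE IU/= => /negbT; rewrite -leNgt => h.
  by rewrite (_ : v I = 0) ?mulr0//; apply/eqP; rewrite eq_le h v0.
set S := [set I in U | (0 < v I)%R] in vn.
have [S0|[I0]] := set_0Vmem S; first by apply: IH => //; rewrite -/S S0 cards0.
rewrite inE => /andP[I0U vI0].
have := @arg_minP _ R K I0 (fun I => (I \in U) && (0 < v I)) v.
case; first by rewrite I0U.
move=> i /andP[iU vi] mini; pose l := v i.
have {}mini J : J \in U -> 0 < v J -> l <= v J by move=> JU vJ; apply: mini; rewrite JU.
pose v' I := if (0 < v I) && (I \in U) then v I - l else 0.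
pose V' x := if x \in sh S then V x - l else V x.
have v'0 I : 0 <= v' I.
  by rewrite /v'; case: ifPn => // /andP[vI IU]; rewrite subr_ge0 mini.
have V'0 x : 0 <= V' x.
  rewrite /V'; case: ifPn => // /bigcupP[I]; rewrite inE => /andP[IU vI] xI.
  by rewrite subr_ge0 (le_trans (mini I IU vI))// vV.
have v'V' I x : I \in U -> x \in rct I -> v' I <= V' x.
  move=> IU xI; rewrite /v' IU andbT; case: ifPn => // vI.
  rewrite /V' ifT; first by rewrite lerB// vV.
  by apply/bigcupP; exists I => //; rewrite inE IU.
have v'n : (#|[set I in U | (0 < v' I)%R]| <= n)%N.
  rewrite -ltnS; apply: leq_trans vn; apply: proper_card; apply/properP; split.
    apply/subsetP => I; rewrite !inE /v' => /andP[-> ] /=; rewrite andbT.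
    by case: ifP => //; rewrite ltxx.
  by exists i; rewrite !inE iU// /v' vi iU subrr ltxx.
have SU : S \subset U by apply/subsetP => I; rewrite inE => /andP[].
have := IH v' V' v'0 V'0 v'V' v'n.
have cS := cU S SU.
have -> : \sum_(I in U) W I * vol I * v I =
    \sum_(I in U) W I * vol I * v' I + l * \sum_(I in S) W I * vol I.
  rewrite mulr_sumr (big_mkcond (fun I => I \in S)) (big_mkcond (fun I => I \in U)).
  rewrite [X in _ = X + _]big_mkcond -big_split; apply: eq_bigr => I _ /=.
  rewrite inE /v'; case: (boolP (I \in U)) => IU /=; last by rewrite addr0.
  rewrite andbT; case: ifPn => [_|]; first ring.
  rewrite -leNgt => h; have -> : v I = 0 by apply/eqP; rewrite eq_le h v0.
  ring.
have -> : \sum_x mu x * V x = \sum_x mu x * V' x + l * meas mu (sh S).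
  rewrite /meas mulr_sumr [X in _ = _ + X]big_mkcond -big_split; apply: eq_bigr => x _ /=.
  by rewrite /V'; case: ifP => _; ring.
have l0 : 0 <= l by exact: ltW.
move=> H1; have := ler_wpM2l l0 cS; rewrite mulrCA => H2.
by rewrite mulrDr lerD.
Qed.

Definition ravg (f : X -> R) I : R := (\sum_(x in rct I) mu x * f x) / vol I.

Lemma carleson_embedding U W L (g : X -> R) : 0 <= L -> in_fam U -> (forall I, 0 <= W I) ->
  carleson U W L -> (forall x, 0 <= g x) ->
  \sum_(I in U) W I * vol I * ravg g I ^+ 2 <= 64 * L * \sum_x mu x * g x ^+ 2.
Proof.
move=> L0 fU W0 cU g0.
apply: (@le_trans _ _ (L * \sum_x mu x * Mx g x ^+ 2)); last first.
  rewrite (mulrC 64) -mulrA ler_wpM2l//; exact: mx123_L2.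
apply: (@carleson_sup U W L #|K| (fun I => ravg g I ^+ 2)) => //.
- by move=> I; exact: sqr_ge0.
- by move=> x; exact: sqr_ge0.
- move=> I x IU xI; have r0 : 0 <= ravg g I.
    by rewrite divr_ge0 ?vol_ge0// sumr_ge0// => y _; rewrite mulr_ge0.
  rewrite ler_sqr ?nnegrE ?mx123_ge0//.
  have [A1F A2F A3F] := fU _ IU.
  have := sum_le_mx123 mu1_ge0 mu2_ge0 mu3_ge0 g0 A1F A2F A3F xI; rewrite -/(vol I) => H.
  have [v0|v0] := eqVneq (vol I) 0; first by rewrite /ravg v0 invr0 mulr0 mx123_ge0.
  by rewrite /ravg ler_pdivrMr 1?mulrC// lt_neqAle eq_sym v0 vol_ge0.
- exact: max_card.
Qed.

(** The form is the squared L^2 norm of the function [g] which sums [phi I * W I] over the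
    rectangles through a point, and also a weighted pairing of [phi] with the averages of [g]. The
    embedding bounds these averages by the norm of [g], so the form controls itself. *)
Lemma carleson_form U W L (phi : K -> R) : 0 < L -> in_fam U -> (forall I, 0 <= W I) ->
  carleson U W L -> (forall I, 0 <= phi I) ->
  \sum_(I in U) \sum_(J in U) W I * W J * phi I * phi J * meas mu (rct I :&: rct J)
  <= 64 * L * \sum_(I in U) W I * vol I * phi I ^+ 2.
Proof.
move=> L0 fU W0 cU phi0.
pose g x := \sum_(I in U) phi I * W I * (x \in rct I)%:R.
have g0 x : 0 <= g x by apply: sumr_ge0 => I _; rewrite !mulr_ge0.
have E1 : \sum_(I in U) \sum_(J in U) W I * W J * phi I * phi J * meas mu (rct I :&: rct J) =
    \sum_(I in U) phi I * W I * (vol I * ravg g I).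
  apply: eq_bigr => I IU.
  have -> : vol I * ravg g I = \sum_(x in rct I) mu x * g x.
    rewrite /ravg; have [v0|v0] := eqVneq (vol I) 0; last by rewrite mulrC divfK.
    rewrite v0 mul0r big1// => y yI.
    by have /(_ y yI) -> := psumr_eq0P (fun y _ => mu_ge0 y) v0; rewrite mul0r.
  under [in RHS]eq_bigr do rewrite /g mulr_sumr.
  rewrite exchange_big /= mulr_sumr; apply: eq_bigr => J JU.
  rewrite meas_setI !mulr_sumr; apply: eq_bigr => x _; ring.
have E2 : \sum_x mu x * g x ^+ 2 = \sum_(I in U) phi I * W I * (vol I * ravg g I).
  rewrite -E1; transitivity (\sum_x \sum_(I in U) \sum_(J in U)
     W I * W J * phi I * phi J * (mu x * ((x \in rct I)%:R * (x \in rct J)%:R))).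
    apply: eq_bigr => x _; rewrite expr2 {1}/g mulr_suml mulr_sumr; apply: eq_bigr => I _.
    rewrite /g !mulr_sumr; apply: eq_bigr => J _; ring.
  rewrite exchange_big; apply: eq_bigr => I _; rewrite exchange_big; apply: eq_bigr => J _ /=.
  rewrite -mulr_sumr /meas; congr (_ * _); rewrite [RHS]big_mkcond; apply: eq_bigr => x _.
  by rewrite in_setI; case: (x \in rct I); case: (x \in rct J); rewrite /= ?(mulr1, mul0r, mulr0).
have E3 := carleson_embedding (ltW L0) fU W0 cU g0.
rewrite E1; set B := (X in X <= _); rewrite E2 -/B in E3.
(* The inequality of the means with parameter [64 * L]: by [E3] the second sum is then at most half
   of the left-hand side. *)
have : 2 * (64 * L) * B <= (64 * L) ^+ 2 * (\sum_(I in U) W I * vol I * phi I ^+ 2) +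
    \sum_(I in U) W I * vol I * ravg g I ^+ 2.
  rewrite /B !mulr_sumr -big_split; apply: ler_sum => I _ /=.
  have m0 : 0 <= W I * vol I by rewrite mulr_ge0 ?vol_ge0.
  have := mulr_ge0 m0 (sqr_ge0 (64 * L * phi I - ravg g I)).
  by rewrite -subr_ge0 => h; rewrite -subr_ge0; move: h; congr (_ <= _); ring.
move=> H; have : (64 * L) * B <= (64 * L) * (64 * L * \sum_(I in U) W I * vol I * phi I ^+ 2).
  by rewrite mulrA -expr2; lra.
by rewrite ler_pM2l// mulr_gt0.
Qed.
End rectangle_families.

(** * Chains of rectangles *)

Section chain_weight.
Context (R : realFieldType) (K Y : finType) (B : K -> {set Y}) (prec : rel K).
Context (U : {set K}) (W : K -> R) (c : R).
Hypothesis W_ge0 : forall I, 0 <= W I.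
Hypothesis c_ge0 : 0 <= c.
Hypothesis precB : forall I J, prec I J -> B I \proper B J.

(* [chw n J y] is the sum of the products of the [c * W I] over the [prec]-chains below [J]
   of length at most [n] whose members contain [y]. *)
Fixpoint chw n (J : K) (y : Y) : R :=
  if n is m.+1 then 1 + c * \sum_(I in U | prec I J && (y \in B I)) W I * chw m I y else 1.

(** The sets [B] shrink strictly along a chain and have at most [#|Y|] points, so at this depth the
    truncated recursion is exact. *)
Definition chain_weight := chw #|Y|.+1.

Lemma chw_stable n J y : (#|B J| < n)%N -> chw n J y = chw n.+1 J y.
Proof.
elim: n J => // n IH J; rewrite ltnS => BJ.
rewrite [LHS]/= [RHS]/=; congr (_ + _ * _); apply: eq_bigr => I /andP[_ /andP[IJ _]].
by congr (_ * _); apply: IH; apply: leq_trans BJ; apply: proper_card; exact: precB.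
Qed.

Lemma chain_weightE J y : chain_weight J y =
  1 + c * \sum_(I in U | prec I J && (y \in B I)) W I * chain_weight I y.
Proof. by rewrite /chain_weight chw_stable// ltnS max_card. Qed.

Lemma chain_weight_ge1 J y : 1 <= chain_weight J y.
Proof.
rewrite /chain_weight; elim: _.+1 J => //= n IH J.
rewrite lerDl mulr_ge0// sumr_ge0// => I _.
by rewrite mulr_ge0// (le_trans _ (IH I)).
Qed.

(** If the chain weight of [J] is less than [2 * a], this leaves less than 2 / c for the total
    weight of the predecessors in [S]: a dyadic level of the chain weight contains little weight. *)
Lemma chain_weight_sum_ge (S : {set K}) J y (a : R) : S \subset U -> 
  (forall I, I \in S -> [/\ prec I J, y \in B I & a <= chain_weight I y]) ->
  c * a * (\sum_(I in S) W I) <= chain_weight J y.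
Proof.
move=> /subsetP SU HS; rewrite chain_weightE -[leLHS]add0r lerD// -mulrA ler_wpM2l//.
rewrite mulr_sumr big_mkcond [leRHS]big_mkcond; apply: ler_sum => I _.
have F0 : 0 <= chain_weight I y by rewrite (le_trans _ (chain_weight_ge1 I y)).
case: (boolP (I \in S)) => [IS|_]; last by case: ifP => // _; rewrite mulr_ge0.
by have [IJ yI aI] := HS _ IS; rewrite SU// IJ yI mulrC ler_wpM2l.
Qed.

Context (nu : Y -> R) (rho : K -> R) (L : R).
Hypothesis nu_ge0 : forall y, 0 <= nu y.
Hypothesis rho_ge0 : forall J, 0 <= rho J.
Hypothesis cL : 64 * L * c <= 4^-1.
Hypothesis form_le : forall phi : K -> R, (forall I, 0 <= phi I) ->
  \sum_(J in U) \sum_(I in U | prec I J) W I * W J * phi I * phi J * (meas nu (B I) * rho J)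
  <= 64 * L * \sum_(J in U) W J * (meas nu (B J) * rho J) * phi J ^+ 2.

(** Let [u J] be the average of the chain weight over [B J], t the left-hand side, m the sum on the
    right and Q the same sum with the factors [u J ^+ 2]. Multiplying the averaged recursion by
    [u J] gives Q as t plus [c] times the form, so Q <= t + Q / 4. As 2 t <= Q + m by the inequality
    of the means, t is at most 2 m. *)
Lemma sum_chain_weight :
  \sum_(J in U) W J * rho J * (\sum_(y in B J) nu y * chain_weight J y) <=
  2 * \sum_(J in U) W J * (meas nu (B J) * rho J).
Proof.
pose s J := \sum_(y in B J) nu y * chain_weight J y.
pose u J := s J / meas nu (B J).
have s0 J : 0 <= s J.
  by apply: sumr_ge0 => y _; rewrite mulr_ge0// (le_trans _ (chain_weight_ge1 J y)).
have u0 J : 0 <= u J by rewrite divr_ge0// meas_ge0.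
have su J : s J = meas nu (B J) * u J.
  rewrite /u; have [m0|m0] := eqVneq (meas nu (B J)) 0; last by rewrite mulrC divfK.
  rewrite m0 mul0r /s big1// => y yJ.
  by have /(_ y yJ) -> := psumr_eq0P (fun y _ => nu_ge0 y) m0; rewrite mul0r.
have sE J : s J = meas nu (B J) + c * \sum_(I in U | prec I J) W I * s I.
  rewrite {1}/s /meas; under eq_bigr do rewrite chain_weightE mulrDr mulr1.
  rewrite big_split /=; congr (_ + _).
  under eq_bigr do rewrite mulrCA mulr_sumr.
  rewrite -mulr_sumr; congr (_ * _).
  rewrite (exchange_big_dep (fun I => (I \in U) && prec I J)) /=; last first.
    by move=> y I _ /andP[-> /andP[->]].
  apply: eq_bigr => I /andP[IU IJ]; rewrite /s mulr_sumr.
  have /properP[/subsetP BIJ _] := precB IJ.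
  apply: eq_big => [y|y _]; last by ring.
  by rewrite IU IJ /=; case: (boolP (y \in B I)) => [/BIJ ->|]; rewrite ?andbF.
have Q0 : forall J, 0 <= W J * (meas nu (B J) * rho J) by move=> J; rewrite !mulr_ge0// meas_ge0.
set Q := \sum_(J in U) W J * (meas nu (B J) * rho J) * u J ^+ 2.
set m := \sum_(J in U) W J * (meas nu (B J) * rho J).
pose t := \sum_(J in U) W J * (meas nu (B J) * rho J) * u J.
have -> : \sum_(J in U) W J * rho J * (\sum_(y in B J) nu y * chain_weight J y) = t.
  by apply: eq_bigr => J _; rewrite -/(s J) su; ring.
have E : Q = t + c * \sum_(J in U) \sum_(I in U | prec I J) W I * W J * u I * u J * (meas nu (B I)
  * rho J).
  rewrite mulr_sumr -big_split; apply: eq_bigr => J _ /=.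
  transitivity (W J * rho J * u J * s J); first by rewrite su; ring.
  rewrite sE mulrDr; congr (_ + _); first ring.
  rewrite !mulr_sumr; apply: eq_bigr => I _; rewrite su; ring.
have := form_le u0; rewrite -/Q => H.
have Qge0 : 0 <= Q by apply: sumr_ge0 => J _; rewrite mulr_ge0// sqr_ge0.
have H1 : Q <= t + 4^-1 * Q.
  rewrite {1}E lerD2l; apply: (le_trans (ler_wpM2l c_ge0 H)).
  by rewrite mulrA (mulrC c) ler_wpM2r.
have : 2 * t <= Q + m.
  rewrite /t /Q /m mulr_sumr -big_split; apply: ler_sum => J _ /=.
  by have := mulr_ge0 (Q0 J) (sqr_ge0 (u J - 1)); nra.
have m0 : 0 <= m by apply: sumr_ge0.
lra.
Qed.

End chain_weight.

Lemma dyadic_level (R : realFieldType) n (a : R) : 1 <= a -> a < 2 ^+ n ->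
  exists k : 'I_n, 2 ^+ k <= a < 2 ^+ k.+1.
Proof.
elim: n => [|n IH] a1 an; first by move: an; rewrite expr0 ltNge a1.
have [h|h] := ltP a (2 ^+ n); last by exists ord_max; rewrite h.
by have [k ?] := IH a1 h; exists (widen_ord (leqnSn n) k).
Qed.

Section chain_integrals.
Context (R : realFieldType) (X1 X2 X3 : finType).
Context (mu1 : X1 -> R) (mu2 : X2 -> R) (mu3 : X3 -> R).
Hypothesis mu1_ge0 : forall x, 0 <= mu1 x.
Hypothesis mu2_ge0 : forall x, 0 <= mu2 x.
Hypothesis mu3_ge0 : forall x, 0 <= mu3 x.
Context (fam1 : {set {set X1}}) (fam2 : {set {set X2}}) (fam3 : {set {set X3}}).
Hypothesis lam1 : laminar fam1.
Hypothesis lam2 : laminar fam2.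
Hypothesis lam3 : laminar fam3.
Notation X := (X1 * X2 * X3)%type.
Local Notation mu := (prodw mu1 mu2 mu3).
Context (K : finType) (A1 : K -> {set X1}) (A2 : K -> {set X2}) (A3 : K -> {set X3}).
Local Notation rct := (rct A1 A2 A3).
Local Notation vol := (vol mu1 mu2 mu3 A1 A2 A3).
Local Notation sh := (sh A1 A2 A3).
Context (U : {set K}) (W : K -> R) (c L : R).
Hypothesis W01 : forall I, 0 <= W I <= 1.
Hypothesis c_gt0 : 0 < c.
Hypothesis L_gt0 : 0 < L.
Hypothesis cL : 64 * L * c <= 4^-1.
Hypothesis fU : in_fam fam1 fam2 fam3 A1 A2 A3 U.
Hypothesis carU : carleson mu1 mu2 mu3 A1 A2 A3 U W L.

Definition chain_family := forall I J x, I \in U -> J \in U -> I != J ->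
  x \in rct I -> x \in rct J ->
  (A1 I \proper A1 J /\ A2 J \proper A2 I) \/ (A1 J \proper A1 I /\ A2 I \proper A2 J).

(** The reversed order of the other two sides has two consequences: the intersection of I and J is
    the product of [A1 I], [A2 J] and [A3 J], so that its measure factors as [form_le] requires; and
    a point of J with first coordinate in [A1 I] belongs to I, so that [cw1 J] is controlled by
    [height1] at the points of J. *)
Definition prec1 I J := [&& A1 I \proper A1 J, A2 J \subset A2 I & A3 J \subset A3 I].
Definition prec2 I J := [&& A2 I \proper A2 J, A1 J \subset A1 I & A3 J \subset A3 I].

Lemma prec1B I J : prec1 I J -> A1 I \proper A1 J. Proof. by case/and3P. Qed.
Lemma prec2B I J : prec2 I J -> A2 I \proper A2 J. Proof. by case/and3P. Qed.

Definition cw1 := chain_weight A1 prec1 U W c.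
Definition cw2 := chain_weight A2 prec2 U W c.

Definition height1 (x : X) := \sum_(J in U | x \in rct J) W J * cw1 J x.1.1.
Definition height2 (x : X) := \sum_(J in U | x \in rct J) W J * cw2 J x.1.2.
Definition hgt (x : X) := \sum_(J in U | x \in rct J) W J.

Let W_ge0 I : 0 <= W I. Proof. by case/andP: (W01 I). Qed.
Let W_le1 I : W I <= 1. Proof. by case/andP: (W01 I). Qed.

Let cw1_ge1 J y : 1 <= cw1 J y.
Proof. by apply: chain_weight_ge1 => //; exact: ltW. Qed.
Let cw2_ge1 J y : 1 <= cw2 J y.
Proof. by apply: chain_weight_ge1 => //; exact: ltW. Qed.

Lemma hgt_ge0 x : 0 <= hgt x.
Proof. exact: sumr_ge0. Qed.

Lemma hgt_le_height1 x : hgt x <= height1 x.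
Proof. by apply: ler_sum => J _; rewrite ler_peMr. Qed.

Lemma hgt_le_height2 x : hgt x <= height2 x.
Proof. by apply: ler_sum => J _; rewrite ler_peMr. Qed.

Lemma prec_form_le (P : rel K) phi (h : K -> K -> R) : (forall I, 0 <= phi I) ->
  (forall I J, P I J -> h I J = meas mu (rct I :&: rct J)) ->
  \sum_(J in U) \sum_(I in U | P I J) W I * W J * phi I * phi J * h I J
  <= 64 * L * \sum_(J in U) W J * vol J * phi J ^+ 2.
Proof.
move=> phi0 hP; apply: le_trans
  (carleson_form mu1_ge0 mu2_ge0 mu3_ge0 lam1 lam2 lam3 L_gt0 fU W_ge0 carU phi0).
apply: ler_sum => J _; rewrite big_mkcond [leRHS]big_mkcond; apply: ler_sum => I _.
case: (I \in U) => //=; case: ifPn => [/hP ->|_].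
  by rewrite setIC le_eqVlt; apply/orP; left; apply/eqP; ring.
by rewrite !mulr_ge0// meas_ge0// => x; exact: prodw_ge0.
Qed.

Lemma sum_height1 : \sum_x mu x * height1 x <= 2 * L * meas mu (sh U).
Proof.
have -> : \sum_x mu x * height1 x =
  \sum_(J in U) W J * (meas mu2 (A2 J) * meas mu3 (A3 J)) * (\sum_(y in A1 J) mu1 y * cw1 J y).
  under eq_bigr do rewrite mulr_sumr.
  rewrite (exchange_big_dep (fun J => J \in U)) /=; last by move=> x J _ /andP[].
  apply: eq_bigr => J JU; transitivity (W J * \sum_(x in rct J) mu x * cw1 J x.1.1).
    by rewrite mulr_sumr; apply: eq_big => [x|x _]; [rewrite JU|ring].
  rewrite sum_rect -mulrA; congr (_ * _).
  rewrite mulrAC mulrC mulr_suml; apply: eq_bigr => x3 _; congr (_ * _).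
  by rewrite /meas mulr_suml.
have volJ J : meas mu1 (A1 J) * (meas mu2 (A2 J) * meas mu3 (A3 J)) = vol J.
  by rewrite volE mulrA.
apply: (@le_trans _ _ (2 * \sum_(J in U) W J * vol J)).
  under [in leRHS]eq_bigr do rewrite -volJ.
  apply: (sum_chain_weight W_ge0 (ltW c_gt0) prec1B mu1_ge0 _ cL).
    by move=> J; rewrite mulr_ge0// meas_ge0.
  move=> phi phi0; under [in leRHS]eq_bigr do rewrite volJ.
  apply: (prec_form_le (h := fun I J => meas mu1 (A1 I) * (meas mu2 (A2 J) * meas mu3 (A3 J)))) =>
    //.
  move=> I J /and3P[/properP[sA1 _] sA2 sA3]; rewrite mulrA -meas_rect; congr meas.
  apply/setP => x; rewrite in_setI !in_rect.
  apply/and3P/andP => [[x1 x2 x3]|[/and3P[x1 _ _] /and3P[_ x2 x3]]]; last by split.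
  by rewrite x1 x2 x3 (subsetP sA1)// (subsetP sA2)// (subsetP sA3).
by rewrite -mulrA ler_wpM2l// carU.
Qed.

Lemma sum_height2 : \sum_x mu x * height2 x <= 2 * L * meas mu (sh U).
Proof.
have -> : \sum_x mu x * height2 x =
  \sum_(J in U) W J * (meas mu1 (A1 J) * meas mu3 (A3 J)) * (\sum_(y in A2 J) mu2 y * cw2 J y).
  under eq_bigr do rewrite mulr_sumr.
  rewrite (exchange_big_dep (fun J => J \in U)) /=; last by move=> x J _ /andP[].
  apply: eq_bigr => J JU; transitivity (W J * \sum_(x in rct J) mu x * cw2 J x.1.2).
    by rewrite mulr_sumr; apply: eq_big => [x|x _]; [rewrite JU|ring].
  rewrite sum_rect -mulrA; congr (_ * _).
  rewrite mulrAC mulrC mulr_suml; apply: eq_bigr => x3 _; congr (_ * _).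
  rewrite mulr_sumr; apply: eq_bigr => x2 _; rewrite mulrCA /meas mulr_suml.
  by congr (_ * _).
have volJ J : meas mu2 (A2 J) * (meas mu1 (A1 J) * meas mu3 (A3 J)) = vol J.
  by rewrite volE; ring.
apply: (@le_trans _ _ (2 * \sum_(J in U) W J * vol J)).
  under [in leRHS]eq_bigr do rewrite -volJ.
  apply: (sum_chain_weight W_ge0 (ltW c_gt0) prec2B mu2_ge0 _ cL).
    by move=> J; rewrite mulr_ge0// meas_ge0.
  move=> phi phi0; under [in leRHS]eq_bigr do rewrite volJ.
  apply: (prec_form_le (h := fun I J => meas mu2 (A2 I) * (meas mu1 (A1 J) * meas mu3 (A3 J)))) =>
    //.
  move=> I J /and3P[/properP[sA2 _] sA1 sA3].
  rewrite mulrCA mulrA -meas_rect; congr meas.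
  apply/setP => x; rewrite in_setI !in_rect.
  apply/and3P/andP => [[x1 x2 x3]|[/and3P[_ x2 _] /and3P[x1 _ x3]]]; last by split.
  by rewrite x1 x2 x3 (subsetP sA1)// (subsetP sA2)// (subsetP sA3).
by rewrite -mulrA ler_wpM2l// carU.
Qed.

Lemma cw1_le_height1 J x : J \in U -> x \in rct J -> cw1 J x.1.1 <= 1 + c * height1 x.
Proof.
move=> JU; rewrite in_rect => /and3P[x1 x2 x3].
rewrite /cw1 (chain_weightE _ _ _ prec1B) lerD2l ler_pM2l// big_mkcond [leRHS]big_mkcond.
apply: ler_sum => I _; case: (I \in U) => //=.
have W0 : 0 <= W I * cw1 I x.1.1 by rewrite mulr_ge0// (le_trans _ (cw1_ge1 I _)).
case: ifPn => [/andP[/and3P[_ sA2 sA3] xI]|_]; last by case: ifP.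
by rewrite in_rect xI (subsetP sA2)// (subsetP sA3).
Qed.

Lemma cw2_le_height2 J x : J \in U -> x \in rct J -> cw2 J x.1.2 <= 1 + c * height2 x.
Proof.
move=> JU; rewrite in_rect => /and3P[x1 x2 x3].
rewrite /cw2 (chain_weightE _ _ _ prec2B) lerD2l ler_pM2l// big_mkcond [leRHS]big_mkcond.
apply: ler_sum => I _; case: (I \in U) => //=.
have W0 : 0 <= W I * cw2 I x.1.2 by rewrite mulr_ge0// (le_trans _ (cw2_ge1 I _)).
case: ifPn => [/andP[/and3P[_ sA1 sA3] xI]|_]; last by case: ifP.
by rewrite in_rect xI (subsetP sA1)// (subsetP sA3).
Qed.

Hypothesis chU : chain_family.

Let level1 (S : {set K}) J y k : S \subset U -> cw1 J y < 2 ^+ k.+1 ->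
  (forall I, I \in S -> [/\ prec1 I J, y \in A1 I & 2 ^+ k <= cw1 I y]) ->
  \sum_(I in S) W I <= 2 / c.
Proof.
move=> SU Jk HS; have := @chain_weight_sum_ge _ _ _ A1 prec1 U W c W_ge0 (ltW c_gt0) prec1B S J y
  (2 ^+ k) SU HS.
move=> /le_lt_trans/(_ Jk)/ltW; rewrite exprS ler_pdivlMr// => h.
rewrite -(@ler_pM2l _ (2 ^+ k)) ?exprn_gt0//; apply: le_trans (le_trans h _).
  by rewrite le_eqVlt; apply/orP; left; apply/eqP; ring.
by rewrite mulrC.
Qed.

Let level2 (S : {set K}) J y k : S \subset U -> cw2 J y < 2 ^+ k.+1 ->
  (forall I, I \in S -> [/\ prec2 I J, y \in A2 I & 2 ^+ k <= cw2 I y]) ->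
  \sum_(I in S) W I <= 2 / c.
Proof.
move=> SU Jk HS; have := @chain_weight_sum_ge _ _ _ A2 prec2 U W c W_ge0 (ltW c_gt0) prec2B S J y
  (2 ^+ k) SU HS.
move=> /le_lt_trans/(_ Jk)/ltW; rewrite exprS ler_pdivlMr// => h.
rewrite -(@ler_pM2l _ (2 ^+ k)) ?exprn_gt0//; apply: le_trans (le_trans h _).
  by rewrite le_eqVlt; apply/orP; left; apply/eqP; ring.
by rewrite mulrC.
Qed.

(* Among the members of a cell, all the others precede the one with the smallest third side. *)
Let cell_le x k l (S : {set K}) : S \subset U ->
  (forall I, I \in S -> [/\ x \in rct I, 2 ^+ k <= cw1 I x.1.1 < 2 ^+ k.+1 &
                           2 ^+ l <= cw2 I x.1.2 < 2 ^+ l.+1]) ->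
  \sum_(I in S) W I <= 4 / c + 1.
Proof.
move=> SU HS; have [->|[J0 J0S]] := set_0Vmem S.
  by rewrite big_set0 addr_ge0// divr_ge0// ltW.
case: (@arg_minnP _ J0 (fun J => J \in S) (fun J => #|A3 J|) J0S) => J JS minJ.
have SUP I : I \in S -> I \in U by exact: (subsetP SU).
have [xJ /andP[_ J1] /andP[_ J2]] := HS _ JS.
have P12 I : I \in S -> I != J -> prec1 I J || prec2 I J.
  move=> IS IJ; have [xI _ _] := HS _ IS.
  have A3JI : A3 J \subset A3 I.
    have [_ _ fI] := fU (SUP _ IS); have [_ _ fJ] := fU (SUP _ JS).
    case: (lam3 fI fJ) => // [sIJ|].
      by have /eqP -> : A3 I == A3 J by rewrite eqEcard sIJ minJ.
    move: xI xJ; rewrite !in_rect => /and3P[_ _ xI] /and3P[_ _ xJ].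
    by move=> /disjointFr/(_ xI); rewrite xJ.
  rewrite /prec1 /prec2 A3JI !andbT.
  case: (chU (SUP _ IS) (SUP _ JS) IJ xI xJ) => -[p q].
    by rewrite p (proper_sub q).
  by rewrite q (proper_sub p) orbT.
pose S1 := [set I in S | prec1 I J]; pose S2 := [set I in S | prec2 I J].
have HS1 : \sum_(I in S1) W I <= 2 / c.
  apply: (level1 (J := J) (y := x.1.1) (k := k)) => //.
    by apply/subsetP => I; rewrite inE => /andP[/SUP].
  move=> I; rewrite inE => /andP[IS ->]; have [xI /andP[-> _] _] := HS _ IS.
  by move: xI; rewrite in_rect => /and3P[->].
have HS2 : \sum_(I in S2) W I <= 2 / c.
  apply: (level2 (J := J) (y := x.1.2) (k := l)) => //.
    by apply/subsetP => I; rewrite inE => /andP[/SUP].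
  move=> I; rewrite inE => /andP[IS ->]; have [xI _ /andP[-> _]] := HS _ IS.
  by move: xI; rewrite in_rect => /and3P[_ ->].
have : \sum_(I in S) W I <= \sum_(I in S1) W I + \sum_(I in S2) W I + W J.
  rewrite (bigD1 J)//= addrC lerD2r big_mkcond (big_mkcond (fun I => I \in S1)).
  rewrite (big_mkcond (fun I => I \in S2)) -big_split; apply: ler_sum => I _ /=.
  rewrite !inE; case: (boolP (I \in S)) => //= IS; last by rewrite addr0.
  case: (boolP (I != J)) => IJ; last by rewrite addr_ge0//; case: ifP.
  by case/orP: (P12 _ IS IJ) => ->; [rewrite lerDl|rewrite lerDr]; case: ifP.
have : 4 / c = 2 / c + 2 / c by ring.
have := W_le1 J; lra.
Qed.

Lemma hgt_cells2 n x : 1 + c * height1 x < 2 ^+ n -> 1 + c * height2 x < 2 ^+ n ->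
  hgt x <= n%:R ^+ 2 * (4 / c + 1).
Proof.
move=> h1 h2.
pose cell (k l : nat) J := [&& J \in U, x \in rct J, 2 ^+ k <= cw1 J x.1.1 < 2 ^+ k.+1 &
                           2 ^+ l <= cw2 J x.1.2 < 2 ^+ l.+1].
apply: (@le_trans _ _ (\sum_(k < n) \sum_(l < n) \sum_(J | cell k l J) W J)).
  rewrite (eq_bigr (fun k : 'I_n => \sum_J \sum_(l < n) if cell k l J then W J else 0)); last first.
    by move=> k _; rewrite exchange_big; apply: eq_bigr => l _; rewrite big_mkcond.
  rewrite exchange_big /hgt big_mkcond; apply: ler_sum => J _.
  have p0 (k l : 'I_n) : 0 <= if cell k l J then W J else 0 by case: ifP.
  case: ifPn => [/andP[JU xJ]|_]; last by apply: sumr_ge0 => k _; apply: sumr_ge0.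
  have [k hk] := dyadic_level (cw1_ge1 J x.1.1) (le_lt_trans (cw1_le_height1 JU xJ) h1).
  have [l hl] := dyadic_level (cw2_ge1 J x.1.2) (le_lt_trans (cw2_le_height2 JU xJ) h2).
  rewrite (bigD1 k)//= (bigD1 l)//= {1}/cell JU xJ hk hl /= -addrA lerDl.
  by rewrite addr_ge0// sumr_ge0// => *; rewrite sumr_ge0.
have -> : n%:R ^+ 2 * (4 / c + 1) = \sum_(k < n) \sum_(l < n) (4 / c + 1).
  by rewrite !sumr_const card_ord -mulrnA -[RHS]mulr_natl natrM expr2.
apply: ler_sum => k _; apply: ler_sum => l _.
rewrite (eq_bigl (fun J => J \in [set J | cell k l J])); last by move=> J; rewrite inE.
apply: (@cell_le x k l); first by apply/subsetP => J; rewrite inE => /and4P[].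
by move=> J; rewrite inE => /and4P[_ ? ? ?].
Qed.

Hypothesis A3_cst : forall I J, A3 I = A3 J.

(** When the third sides coincide, the members through [x] are totally ordered by [prec1], and all
    the others precede the one with the largest first side. *)
Let cell1_le x k (S : {set K}) : S \subset U ->
  (forall I, I \in S -> x \in rct I /\ 2 ^+ k <= cw1 I x.1.1 < 2 ^+ k.+1) ->
  \sum_(I in S) W I <= 2 / c + 1.
Proof.
move=> SU HS; have [->|[J0 J0S]] := set_0Vmem S.
  by rewrite big_set0 addr_ge0// divr_ge0// ltW.
case: (@arg_maxnP _ J0 (fun J => J \in S) (fun J => #|A1 J|) J0S) => J JS maxJ.
have SUP I : I \in S -> I \in U by exact: (subsetP SU).
have [xJ /andP[_ J1]] := HS _ JS.
have P1 I : I \in S -> I != J -> prec1 I J.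
  move=> IS IJ; have [xI _] := HS _ IS.
  rewrite /prec1 (A3_cst I J) subxx andbT.
  case: (chU (SUP _ IS) (SUP _ JS) IJ xI xJ) => -[pA1 pA2].
    by rewrite pA1 (proper_sub pA2).
  by have : (#|A1 I| <= #|A1 J|)%N := maxJ _ IS; rewrite leqNgt (proper_card pA1).
have HS1 : \sum_(I in S :\ J) W I <= 2 / c.
  apply: (level1 (J := J) (y := x.1.1) (k := k)) => //.
    by apply/subsetP => I; rewrite !inE => /andP[_ /SUP].
  move=> I; rewrite !inE => /andP[IJ IS]; have [xI /andP[-> _]] := HS _ IS.
  by rewrite P1//; move: xI; rewrite in_rect => /and3P[->].
rewrite (big_setD1 J)//=; have := W_le1 J; lra.
Qed.

Lemma hgt_cells1 n x : 1 + c * height1 x < 2 ^+ n -> hgt x <= n%:R * (2 / c + 1).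
Proof.
move=> h1.
pose cell (k : nat) J := [&& J \in U, x \in rct J & 2 ^+ k <= cw1 J x.1.1 < 2 ^+ k.+1].
apply: (@le_trans _ _ (\sum_(k < n) \sum_(J | cell k J) W J)).
  rewrite (eq_bigr (fun k : 'I_n => \sum_J if cell k J then W J else 0)); last first.
    by move=> k _; rewrite big_mkcond.
  rewrite exchange_big /hgt big_mkcond; apply: ler_sum => J _.
  have p0 (k : 'I_n) : 0 <= if cell k J then W J else 0 by case: ifP.
  case: ifPn => [/andP[JU xJ]|_]; last by apply: sumr_ge0.
  have [k hk] := dyadic_level (cw1_ge1 J x.1.1) (le_lt_trans (cw1_le_height1 JU xJ) h1).
  by rewrite (bigD1 k)//= {1}/cell JU xJ hk /= lerDl sumr_ge0.
have -> : n%:R * (2 / c + 1) = \sum_(k < n) (2 / c + 1).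
  by rewrite !sumr_const card_ord -[RHS]mulr_natl.
apply: ler_sum => k _.
rewrite (eq_bigl (fun J => J \in [set J | cell k J])); last by move=> J; rewrite inE.
apply: (@cell1_le x k); first by apply/subsetP => J; rewrite inE => /and3P[].
by move=> J; rewrite inE => /and3P[_ ? ?].
Qed.

End chain_integrals.

(** * The Carleson condition for the weights of an admissible pair *)

Section diagonal.
Context (R : realFieldType) (K : finType) (w : nat -> nat -> R).
Hypothesis w_ge0 : forall a b, 0 <= w a b.
Hypothesis w_nincl : forall a a' b, (a <= a')%N -> w a' b <= w a b.
Hypothesis w_nincr : forall a b b', (b <= b')%N -> w a b' <= w a b.
Hypothesis w_diag : forall N, \sum_(i < N.+1) w i (N - i)%N <= 1.

Lemma card_window (D : {set K}) (s : K -> nat) m n : {in D &, injective s} ->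
  (forall I, I \in D -> (m < s I <= m + n)%N) -> (#|D| <= n)%N.
Proof.
move=> sinj H; rewrite cardE -(size_map s) -(size_iota m.+1 n).
apply: uniq_leq_size.
  by rewrite map_inj_in_uniq ?enum_uniq// => I J; rewrite !mem_enum; exact: sinj.
move=> i /mapP[I]; rewrite mem_enum => /H + ->.
by rewrite mem_iota addSn ltnS.
Qed.

(** Order [S] by [s], which is the reverse of the order by [t]. The values of [s] at the members to
    the right of J are distinct and lie in a window of length [a J], so there are at most [a J] of
    them, and likewise at most [b J] to the left. With N + 1 members in all, the monotone [w] is at
    most its value at a point of antidiagonal N, and different J get different points. *)
Lemma sum_staircase (S : {set K}) (s t a b : K -> nat) :
  (forall I J, I \in S -> J \in S -> I != J ->
    (s I < s J)%N && (t J < t I)%N || (s J < s I)%N && (t I < t J)%N) ->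
  (forall I J, I \in S -> J \in S -> (s I < s J)%N -> (s J <= s I + a I)%N) ->
  (forall I J, I \in S -> J \in S -> (t I < t J)%N -> (t J <= t I + b I)%N) ->
  \sum_(J in S) w (a J) (b J) <= 1.
Proof.
move=> st ha hb; case N0 : #|S| => [|N].
  by rewrite (cards0_eq N0) big_set0.
have sinj : {in S &, injective s}.
  move=> I J IS JS sIJ; apply/eqP; apply: contraT => IJ.
  by have := st _ _ IS JS IJ; rewrite sIJ ltnn.
have tinj : {in S &, injective t}.
  move=> I J IS JS sIJ; apply/eqP; apply: contraT => IJ.
  by have := st _ _ IS JS IJ; rewrite sIJ ltnn !andbF.
pose lft J := [set I in S | (s I < s J)%N].
pose rgt J := [set I in S | (s J < s I)%N].
have lftE J : J \in S -> lft J = [set I in S | (t J < t I)%N].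
  move=> JS; apply/setP => I; rewrite !inE; case: (boolP (I \in S)) => //= IS.
  have [->|IJ] := eqVneq I J; first by rewrite !ltnn.
  case/orP: (st _ _ IS JS IJ) => /andP[h1 h2]; first by rewrite h1 h2.
  by rewrite (ltnNge (s I)) (ltnNge (t J)) (ltnW h1) (ltnW h2).
have cb J : J \in S -> (#|lft J| <= b J)%N.
  move=> JS; rewrite lftE//; apply: (@card_window _ t (t J)).
    by move=> I I'; rewrite !inE => /andP[IS _] /andP[IS' _]; exact: tinj.
  by move=> I; rewrite inE => /andP[IS tJI]; rewrite tJI hb.
have ca J : J \in S -> (#|rgt J| <= a J)%N.
  move=> JS; apply: (@card_window _ s (s J)).
    by move=> I I'; rewrite !inE => /andP[IS _] /andP[IS' _]; exact: sinj.
  by move=> I; rewrite inE => /andP[IS tJI]; rewrite tJI ha.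
have clr J : J \in S -> (#|lft J| + #|rgt J| = N)%N.
  move=> JS; have : (#|S :\ J| = N)%N by move: (cardsD1 J S); rewrite JS N0 => -[].
  move=> <-; rewrite -cardsUI [X in (_ + X)%N](_ : _ = 0%N) ?addn0.
    apply: eq_card => I; rewrite !inE; case: (boolP (I \in S)) => /= IS; last by rewrite andbF.
    have [->|IJ] := eqVneq I J; first by rewrite !ltnn.
    by case/orP: (st _ _ IS JS IJ) => /andP[-> _]; rewrite ?orbT.
  apply/eqP; rewrite cards_eq0; apply/eqP/setP => I; rewrite !inE;
    apply/negP => /andP[/andP[_ h] /andP[_ /ltnW]].
  by rewrite leqNgt h.
pose o J : 'I_N.+1 := inord #|lft J|.
have oE J : J \in S -> o J = #|lft J| :> nat.
  by move=> JS; rewrite inordK// ltnS -(clr J JS) leq_addr.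
have llt I J : I \in S -> J \in S -> (s I < s J)%N -> (#|lft I| < #|lft J|)%N.
  move=> IS JS sIJ; apply: proper_card; apply/properP; split.
    by apply/subsetP => I'; rewrite !inE => /andP[-> h]; exact: ltn_trans sIJ.
  by exists I; rewrite !inE IS ?ltnn.
have oinj : {in S &, injective o}.
  move=> I J IS JS /(congr1 (@nat_of_ord _)); rewrite !oE// => e.
  apply/eqP; apply: contraT => IJ.
  by case/orP: (st _ _ IS JS IJ) => /andP[/llt + _] => /(_ _ _); rewrite e ltnn; apply.
apply: le_trans (w_diag N).
(* [o J] counts the members to the left, which bounds the second argument of [w]; hence the
   antidiagonal is read backwards. *)
rewrite (reindex_inj rev_ord_inj)/=.
apply: (@le_trans _ _ (\sum_(J in S) w (N - o J)%N (o J))).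
  apply: ler_sum => J JS; rewrite oE//.
  apply: (le_trans (w_nincl _ _)); last by apply: w_nincr; exact: cb.
  by rewrite -(clr J JS) addKn; exact: ca.
have -> : \sum_(J in S) w (N - o J)%N (o J) = \sum_(i in o @: S) w (N - i)%N i.
  by rewrite big_imset.
rewrite big_mkcond; apply: ler_sum => i _; case: ifP => _; last exact: w_ge0.
by rewrite subSS subKn// -ltnS.
Qed.

End diagonal.

(** * Good points and bad rectangles *)

Section weighted_carleson.
Context (R : realFieldType) (X1 X2 X3 : finType).
Context (mu1 : X1 -> R) (mu2 : X2 -> R) (mu3 : X3 -> R).
Hypothesis mu1_ge0 : forall x, 0 <= mu1 x.
Hypothesis mu2_ge0 : forall x, 0 <= mu2 x.
Hypothesis mu3_ge0 : forall x, 0 <= mu3 x.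
Context (fam1 : {set {set X1}}) (fam2 : {set {set X2}}) (fam3 : {set {set X3}}).
Hypothesis lam1 : laminar fam1.
Hypothesis lam2 : laminar fam2.
Hypothesis lam3 : laminar fam3.
Notation X := (X1 * X2 * X3)%type.
Local Notation mu := (prodw mu1 mu2 mu3).
Let mu_ge0 : forall x, 0 <= mu x := prodw_ge0 mu1_ge0 mu2_ge0 mu3_ge0.
Context (K : finType) (A1 : K -> {set X1}) (A2 : K -> {set X2}) (A3 : K -> {set X3}).
Context (Q : K -> {set X1}) (C : K -> {set X2}).
Local Notation rct := (rct A1 A2 A3).
Local Notation vol := (vol mu1 mu2 mu3 A1 A2 A3).
Local Notation sh := (sh A1 A2 A3).
Context (w : nat -> nat -> R).
Hypothesis w_ge0 : forall a b, 0 <= w a b.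
Hypothesis w_nincl : forall a a' b, (a <= a')%N -> w a' b <= w a b.
Hypothesis w_nincr : forall a b b', (b <= b')%N -> w a b' <= w a b.
Hypothesis w_diag : forall N, \sum_(i < N.+1) w i (N - i)%N <= 1.
Context (U : {set K}) (s t a b : K -> nat).
Hypothesis fU : in_fam fam1 fam2 fam3 A1 A2 A3 U.
Hypothesis fQ : forall J, J \in U -> Q J \in fam1.
Hypothesis vol_gt0 : forall J, J \in U -> 0 < vol J.
Hypothesis A1Q : forall J, J \in U -> A1 J \subset Q J.
Hypothesis A2C : forall J, J \in U -> A2 J \subset C J.
Hypothesis densQ : forall J, J \in U ->
  2 * meas mu (rect (Q J) (A2 J) (A3 J) :&: sh U) <= meas mu (rect (Q J) (A2 J) (A3 J)).
Hypothesis densC : forall J, J \in U ->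
  2 * meas mu (rect (A1 J) (C J) (A3 J) :&: sh U) <= meas mu (rect (A1 J) (C J) (A3 J)).
Hypothesis st : forall I J x, I \in U -> J \in U -> I != J -> x \in rct I -> x \in rct J ->
  (s I < s J)%N && (t J < t I)%N || (s J < s I)%N && (t I < t J)%N.
Hypothesis ha : forall I J x, I \in U -> J \in U -> x \in rct I -> x \in rct J ->
  (s I < s J)%N -> (s J <= s I + a I)%N \/ Q I \subset A1 J.
Hypothesis hb : forall I J x, I \in U -> J \in U -> x \in rct I -> x \in rct J ->
  (t I < t J)%N -> (t J <= t I + b I)%N \/ C I \subset A2 J.

Definition full1 (S : {set K}) J (y2 : X2) (y3 : X3) := [forall y1 in Q J, (y1, y2, y3) \in sh S].
Definition full2 (S : {set K}) J (y1 : X1) (y3 : X3) := [forall y2 in C J, (y1, y2, y3) \in sh S].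
Definition good (S : {set K}) J : {set X} :=
  [set x in rct J | ~~ full1 S J x.1.2 x.2 && ~~ full2 S J x.1.1 x.2].

Lemma in_good (S : {set K}) J x : (x \in good S J) =
  [&& x \in rct J, ~~ full1 S J x.1.2 x.2 & ~~ full2 S J x.1.1 x.2].
Proof. by rewrite in_set. Qed.

(** If [s J] exceeded [s I + a I], the first side of J would contain [Q I], so that the line through
    [x] over [Q I] would lie in J and [full1 S I] would hold, against [x] being good for I. With the
    same argument for [t] and [C], the hypotheses of [sum_staircase] hold among the rectangles for
    which [x] is good. *)
Lemma sum_good_le1 (S : {set K}) x : S \subset U ->
  \sum_(J in S | x \in good S J) w (a J) (b J) <= 1.
Proof.
move=> /subsetP SU; pose Sx := [set J in S | x \in good S J].
have inSx J : J \in Sx ->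
    [/\ J \in S, x \in rct J, ~~ full1 S J x.1.2 x.2 & ~~ full2 S J x.1.1 x.2].
  by rewrite in_set in_good => /and4P[].
have memsh J y : J \in S -> y \in rct J -> y \in sh S by move=> JS yJ; apply/bigcupP; exists J.
rewrite (eq_bigl (fun J => J \in Sx)); last by move=> J; rewrite [RHS]in_set.
apply: (sum_staircase w_ge0 w_nincl w_nincr w_diag (s := s) (t := t)).
- move=> I J /inSx[IS xI _ _] /inSx[JS xJ _ _] IJ.
  exact: (st (SU _ IS) (SU _ JS) IJ xI xJ).
- move=> I J /inSx[IS xI nI _] /inSx[JS xJ _ _] sIJ.
  case: (ha (SU _ IS) (SU _ JS) xI xJ sIJ) => // /subsetP QA.
  case/negP: nI; apply/forall_inP => y1 /QA y1J; apply: (memsh J) => //.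
  by move: xJ; rewrite !in_rect y1J /= => /and3P[_ -> ->].
- move=> I J /inSx[IS xI _ nI] /inSx[JS xJ _ _] sIJ.
  case: (hb (SU _ IS) (SU _ JS) xI xJ sIJ) => // /subsetP QA.
  case/negP: nI; apply/forall_inP => y1 /QA y1J; apply: (memsh J) => //.
  by move: xJ; rewrite !in_rect y1J /= => /and3P[-> _ ->].
Qed.

Lemma sum_good (S : {set K}) : S \subset U ->
  \sum_(J in S) w (a J) (b J) * meas mu (good S J) <= meas mu (sh S).
Proof.
move=> SU; rewrite /meas; under eq_bigr do rewrite mulr_sumr.
rewrite (exchange_big_dep (fun x => x \in sh S)) /=; last first.
  by move=> J x JS; rewrite in_good => /and3P[xJ _ _]; apply/bigcupP; exists J.
apply: ler_sum => x xS; rewrite -mulr_suml -[leRHS]mul1r ler_wpM2r//.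
exact: sum_good_le1.
Qed.

Definition sum23 (B2 : {set X2}) (B3 : {set X3}) (f : X2 -> X3 -> R) : R :=
  \sum_(x3 in B3) mu3 x3 * \sum_(x2 in B2) mu2 x2 * f x2 x3.

Lemma sum23_le (B2 : {set X2}) (B3 : {set X3}) (f g : X2 -> X3 ->
  R) : (forall x2 x3, x2 \in B2 -> x3 \in B3 -> f x2 x3 <= g x2 x3) ->
  sum23 B2 B3 f <= sum23 B2 B3 g.
Proof.
move=> fg; apply: ler_sum => x3 x3B; rewrite ler_wpM2l//; apply: ler_sum => x2 x2B.
by rewrite ler_wpM2l// fg.
Qed.

Lemma eq_sum23 (B2 : {set X2}) (B3 : {set X3}) (f g : X2 -> X3 -> R) : f =2 g ->
  sum23 B2 B3 f = sum23 B2 B3 g.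
Proof.
by move=> fg; apply: eq_bigr => x3 _; congr (_ * _); apply: eq_bigr => x2 _; rewrite fg.
Qed.

Lemma sum23D (B2 : {set X2}) (B3 : {set X3}) (f g : X2 -> X3 ->
  R) : sum23 B2 B3 (fun x2 x3 => f x2 x3 + g x2 x3) = sum23 B2 B3 f + sum23 B2 B3 g.
Proof.
rewrite -big_split; apply: eq_bigr => x3 _ /=; rewrite -mulrDr -big_split; congr (_ * _).
by apply: eq_bigr => x2 _ /=; rewrite mulrDr.
Qed.

Lemma sum23Z (B2 : {set X2}) (B3 : {set X3}) k (f : X2 -> X3 ->
  R) : sum23 B2 B3 (fun x2 x3 => k * f x2 x3) = k * sum23 B2 B3 f.
Proof.
rewrite /sum23 mulr_sumr; apply: eq_bigr => x3 _; rewrite mulrCA; congr (_ * _).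
by rewrite mulr_sumr; apply: eq_bigr => x2 _; rewrite mulrCA.
Qed.

Lemma sum23_cst (B2 : {set X2}) (B3 : {set X3}) : sum23 B2 B3 (fun _ _ => 1) = meas mu2 B2 * meas
  mu3 B3.
Proof.
rewrite /sum23 mulrC /meas mulr_suml; apply: eq_bigr => x3 _; congr (_ * _).
by apply: eq_bigr => x2 _; rewrite mulr1.
Qed.

Lemma sum_rectsum23 (B1 : {set X1}) (B2 : {set X2}) (B3 : {set X3}) (f : X ->
  R) : \sum_(x in rect B1 B2 B3) mu x * f x =
  sum23 B2 B3 (fun x2 x3 => \sum_(x1 in B1) mu1 x1 * f (x1, x2, x3)).
Proof. exact: sum_rect. Qed.

Context (kap : R).
Hypothesis kap_gt0 : 0 < kap.
Hypothesis kap_small : 32 * 32 * 162 * kap <= 1.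

Section bad.
Context (S : {set K}).
Hypothesis SU : S \subset U.
Local Notation Om := (sh S).

Definition bad : {set K} := [set J in S | meas mu (good S J) < kap ^+ 2 * vol J].

Definition row J (x2 : X2) (x3 : X3) : R := \sum_(y1 in Q J) mu1 y1 * ((y1, x2, x3) \in Om)%:R.
Definition low J x2 x3 := row J x2 x3 <= kap * meas mu1 (Q J).
Definition box J : {set X} := rect (Q J) (A2 J) (A3 J).

Lemma row_ge0 J x2 x3 : 0 <= row J x2 x3.
Proof. by apply: sumr_ge0 => y _; rewrite mulr_ge0. Qed.

Lemma row_full J x2 x3 : full1 S J x2 x3 -> row J x2 x3 = meas mu1 (Q J).
Proof.
by move=> /forall_inP h; apply: eq_bigr => y yQ; rewrite h// mulr1.
Qed.

(** As [Om] fills at most half of the second extension, full lines in that direction cover at most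
    half of J. A bad J has few good points, so full lines in the first direction cover nearly
    another half. In [box J] these use up nearly all the mass which [densQ] allows, and little is
    left for the other rows, which are therefore [low] up to a proportion of order [kap]. Badness is
    defined with [kap ^+ 2] because the leftover mass gets divided by the row threshold [kap]. *)
Lemma bad_density J : J \in bad ->
  [/\ 0 < meas mu1 (Q J), 0 < meas mu2 (A2 J) * meas mu3 (A3 J),
   3^-1 * meas mu (box J) <= \sum_(x in box J) mu x * (x \in Om)%:R &
   3^-1 * (meas mu2 (A2 J) * meas mu3 (A3 J)) <= sum23 (A2 J) (A3 J) (fun x2 x3 => (low J x2
     x3)%:R)].
Proof.
rewrite in_set => /andP[JS]; have JU := subsetP SU _ JS.
have := vol_gt0 JU; rewrite volE => v0 Jbad.
set m1 := meas mu1 (A1 J) in v0 Jbad; set m2 := meas mu2 (A2 J) in v0 Jbad *.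
set m3 := meas mu3 (A3 J) in v0 Jbad *.
have m10 : 0 <= m1 by exact: meas_ge0.
have m20 : 0 <= m2 by exact: meas_ge0.
have m30 : 0 <= m3 by exact: meas_ge0.
have m1p : 0 < m1 by rewrite lt_neqAle m10 andbT; apply: contraTneq v0 => <-; rewrite !mul0r ltxx.
have m2p : 0 < m2 by rewrite lt_neqAle m20 andbT; apply: contraTneq v0 => <-;
  rewrite mulr0 mul0r ltxx.
have m3p : 0 < m3 by rewrite lt_neqAle m30 andbT; apply: contraTneq v0 => <-; rewrite mulr0 ltxx.
set q := meas mu1 (Q J).
have qp : 0 < q by apply: (lt_le_trans m1p); apply: meas_sub => //; exact: A1Q.
have cp : 0 < meas mu2 (C J) by apply: (lt_le_trans m2p); apply: meas_sub => //; exact: A2C.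
pose N := sum23 (A2 J) (A3 J) (row J).
pose v := sum23 (A2 J) (A3 J) (fun x2 x3 => (full1 S J x2 x3)%:R).
have NE : \sum_(x in box J) mu x * (x \in Om)%:R = N by exact: sum_rectsum23.
have boxE : meas mu (box J) = q * (m2 * m3) by rewrite meas_rect mulrA.
have shSU : Om \subset sh U by exact: subset_sh.
have hN : 2 * N <= q * (m2 * m3).
  have := densQ JU; rewrite -/(box J) boxE; apply: le_trans; rewrite ler_wpM2l// -NE -meas_setI.
  by apply: meas_sub => //; exact: setIS.
pose N' := \sum_(x in rect (A1 J) (C J) (A3 J)) mu x * (x \in Om)%:R.
pose v' := \sum_(x3 in A3 J) mu3 x3 * \sum_(x1 in A1 J) mu1 x1 * (full2 S J x1 x3)%:R.
have hN' : 2 * N' <= meas mu2 (C J) * (m1 * m3).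
  have -> : meas mu2 (C J) * (m1 * m3) = meas mu (rect (A1 J) (C J) (A3 J)).
    by rewrite meas_rect -/m1 -/m3; ring.
  apply: le_trans (densC JU).
  by rewrite ler_wpM2l// /N' -meas_setI; apply: meas_sub => //; exact: setIS.
have hv' : meas mu2 (C J) * v' <= N'.
  rewrite /N' sum_rect /v' mulr_sumr; apply: ler_sum => x3 _; rewrite mulrCA ler_wpM2l//.
  under [leRHS]eq_bigr do rewrite mulr_sumr.
  rewrite exchange_big mulr_sumr; apply: ler_sum => x1 _.
  case: (boolP (full2 _ _ _ _)) => [/forall_inP h|_]; last first.
    by rewrite mulr0 mulr0 sumr_ge0// => x2 _; rewrite !mulr_ge0.
  rewrite mulr1 /meas mulr_suml; apply: ler_sum => x2 x2C.
  by rewrite h// mulr1.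
have hv : q * v <= N.
  rewrite -sum23Z; apply: sum23_le => x2 x3 _ _.
  by case: (boolP (full1 _ _ _ _)) => [/row_full ->|_]; rewrite ?mulr1 ?mulr0 ?row_ge0.
have hgood : m1 * m2 * m3 <= meas mu (good S J) + m1 * v + m2 * v'.
  have -> : m1 * m2 * m3 = \sum_(x in rct J) mu x * 1.
    by rewrite -volE; apply: eq_bigr => x _; rewrite mulr1.
  have -> : meas mu (good S J) = \sum_(x in rct J) mu x * (x \in good S J)%:R.
    rewrite -meas_setI; congr meas; apply/esym/setIidPr/subsetP => x.
    by rewrite in_good => /and3P[].
  have -> : m1 * v = \sum_(x in rct J) mu x * (full1 S J x.1.2 x.2)%:R.
    rewrite sum_rectsum23 -sum23Z; apply: eq_sum23 => x2 x3 /=.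
    by rewrite /m1 /meas mulr_suml.
  have -> : m2 * v' = \sum_(x in rct J) mu x * (full2 S J x.1.1 x.2)%:R.
    rewrite sum_rect mulr_sumr; apply: eq_bigr => x3 _; rewrite mulrCA; congr (_ * _).
    rewrite /m2 /meas mulr_suml; apply: eq_bigr => x2 _; by congr (_ * _).
  rewrite -!big_split; apply: ler_sum => x xJ /=; rewrite -!mulrDr ler_wpM2l// in_good xJ /=.
  by case: (full1 _ _ _ _); case: (full2 _ _ _ _) => /=; lra.
have vlow : (2^-1 - kap ^+ 2) * (m2 * m3) <= v.
  have h1 : v' <= 2^-1 * (m1 * m3).
    rewrite -(ler_pM2l cp); nra.
  have h2 : m2 * v' <= m2 * (2^-1 * (m1 * m3)) by rewrite ler_wpM2l.
  rewrite -(ler_pM2l m1p); lra.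
have k12 : kap * 12 <= 1 by have := kap_gt0; have := kap_small; lra.
have kk : kap ^+ 2 <= 12^-1 by have := kap_gt0; rewrite expr2; nra.
have mp : 0 < m2 * m3 by rewrite mulr_gt0.
split=> //.
  rewrite NE boxE; apply: le_trans hv; rewrite mulrCA ler_pM2l//.
  by apply: le_trans vlow; rewrite ler_pM2r//; lra.
set h := sum23 _ _ _.
(* A row is full, or low, or has mass above [kap * q]; rows of the last kind are paid for by the
   mass [N - q * v] outside the full rows. *)
have : kap * q * (m2 * m3) <= kap * q * v + kap * q * h + (N - q * v).
  rewrite -sum23_cst -!sum23Z -mulN1r -!sum23Z -!sum23D; apply: sum23_le => x2 x3 _ _.
  have kq : 0 <= kap * q by rewrite mulr_ge0// ltW.
  have l0 : 0 <= (low J x2 x3)%:R :> R := ler0n _ _.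
  case: (boolP (full1 _ _ _ _)) => [/row_full ->|_].
    by rewrite !mulr1 -/q mulN1r subrr addr0 lerDl mulr_ge0.
  rewrite mulr1 !mulr0 add0r addr0 /low; case: (leP (row J x2 x3) _) => h'.
    by rewrite mulr1 lerDl row_ge0.
  by rewrite mulr0 add0r ltW.
have : q * v >= q * ((2^-1 - kap ^+ 2) * (m2 * m3)) by rewrite ler_pM2l.
move=> e1 e2; have kqp : 0 < kap * q by rewrite mulr_gt0.
have v2 : v <= 2^-1 * (m2 * m3).
  rewrite -(ler_pM2l qp); lra.
rewrite -(ler_pM2l kqp).
have : kap * q * v <= kap * q * (2^-1 * (m2 * m3)) by rewrite ler_pM2l.
have : kap ^+ 2 * (q * (m2 * m3)) <= 12^-1 * (kap * (q * (m2 * m3))).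
  have h12 : 0 <= 12^-1 - kap by lra.
  have := mulr_ge0 h12 (ltW (mulr_gt0 kap_gt0 (mulr_gt0 qp mp))).
  by rewrite -subr_ge0 => h0; rewrite -subr_ge0; move: h0; congr (_ <= _); ring.
lra.
Qed.

(* A bad rectangle has, in the last two coordinates, a large proportion of rows on which [Om] is
   sparse, while all these rows together fill only a small part of [Om]. *)
Definition sparse_rows : {set X} :=
  [set x in Om | [exists J in bad, (x \in box J) && low J x.1.2 x.2]].

Lemma in_sparse_rows x : (x \in sparse_rows) =
  (x \in Om) && [exists J in bad, (x \in box J) && low J x.1.2 x.2].
Proof. by rewrite in_set. Qed.

(** For fixed last two coordinates, the sides [Q J] of the low rows are a laminar family. On each of
    them [Om] has density at most [kap], hence also on their union. *)
Lemma meas_sparse_rows :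
  meas mu sparse_rows <= kap * meas mu (\bigcup_(J in bad) box J).
Proof.
set BB := \bigcup_(J in bad) box J.
rewrite -subr_ge0 /meas mulr_sumr [X in _ - X]big_mkcond [X in X - _]big_mkcond -sumrB /=.
rewrite sum_triple exchange_big sumr_ge0// => x2 _; rewrite exchange_big sumr_ge0// => x3 _.
pose F := [set Q J | J in [set J in bad | [&& x2 \in A2 J, x3 \in A3 J & low J x2 x3]]].
have lF : laminar F.
  apply: laminar_sub lam1; apply/subsetP => _ /imsetP[J + ->].
  by rewrite in_set => /andP[]; rewrite in_set => /andP[/(subsetP SU)/fQ].
have := @laminar_cover_ge0 R X1 F
  (fun y => mu1 y * (kap - ((y, x2, x3) \in Om)%:R)) lF.
have covF y : y \in cover F -> exists2 J, J \in bad & (y, x2, x3) \in box J /\ low J x2 x3.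
  move=> /bigcupP[_ /imsetP[J + ->] yQ]; rewrite in_set => /andP[Jb /and3P[x2J x3J lJ]].
  by exists J => //; split => //; rewrite in_rect yQ x2J x3J.
move=> H; have {H} : 0 <= \sum_(y in cover F) mu1 y * (kap - ((y, x2, x3) \in Om)%:R).
  apply: H => _ /imsetP[J + ->]; rewrite in_set => /andP[Jb /and3P[x2J x3J lJ]].
  have -> : \sum_(y in Q J) mu1 y * (kap - ((y, x2, x3) \in Om)%:R) =
      kap * meas mu1 (Q J) - row J x2 x3.
    by rewrite /meas mulr_sumr -sumrB; apply: eq_bigr => y _; ring.
  by rewrite subr_ge0.
move=> /(mulr_ge0 (mulr_ge0 (mu2_ge0 x2) (mu3_ge0 x3))) /le_trans; apply.
rewrite mulr_sumr big_mkcond; apply: ler_sum => y _ /=.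
have m0 : 0 <= mu (y, x2, x3) by exact: mu_ge0.
have mE : mu (y, x2, x3) = mu2 x2 * mu3 x3 * mu1 y by rewrite /prodw/=; ring.
case: (boolP (y \in cover F)) => [/covF[J Jb [yJ lJ]]|yF].
  have -> : (y, x2, x3) \in BB by apply/bigcupP; exists J.
  rewrite in_sparse_rows; case: (boolP (_ \in Om)) => _ /=.
    rewrite mulrBr mulrBr mulr1 -mE (mulrC (mu1 y)) mulrCA -mE.
    by case: ifP => _; lra.
  by rewrite !subr0 mulrA -mE mulrC.
rewrite [X in _ - X]ifN; last first.
  rewrite in_sparse_rows; apply: contra yF => /andP[_ /exists_inP[J Jb /andP[yJ lJ]]].
  apply/bigcupP; exists (Q J); last by move: yJ; rewrite in_rect => /and3P[].
  apply/imsetP; exists J => //; rewrite in_set Jb /=.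
  by move: yJ; rewrite in_rect => /and3P[_ -> ->].
by rewrite subr0; case: ifP => // _; rewrite mulr_ge0// ltW.
Qed.

(** [Om] has density at least 1/3 in the boxes of the bad rectangles, so their union has at most 9 *
    64 times the measure of [Om]. The set [sparse_rows] has at most [kap] times the measure of this
    union. Over each first coordinate in [A1 J], at least 1/3 of the slice of a bad J lies in
    [sparse_rows], so [mx23] bounds the shadow by 9 * 16 times the measure of [sparse_rows]. The
    constant in [kap_small] is 2 * (9 * 64) * (9 * 16) = 32 * 32 * 162. *)
Lemma meas_sh_bad : 2 * meas mu (sh bad) <= meas mu Om.
Proof.
have badU J : J \in bad -> J \in U by rewrite in_set => /andP[/(subsetP SU)].
have h1 : 3^-1 ^+ 2 * meas mu (\bigcup_(J in bad) box J) <= 64 * meas mu Om.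
  rewrite [X in _ <= 64 * X]meas_ind.
  apply: (weak_type mu1_ge0 mu2_ge0 mu3_ge0 lam1 lam2 lam3
    (A1 := Q) (A2 := A2) (A3 := A3) (U := bad) (f := fun x => (x \in Om)%:R)) => //.
  - by move=> J Jb; have [_ ? ?] := fU (badU _ Jb); split => //; exact/fQ/badU.
  - by rewrite invr_ge0.
  - by move=> J Jb; have [q0 r0 _ _] := bad_density Jb; rewrite volE -mulrA mulr_gt0.
  - by move=> J Jb; have [] := bad_density Jb.
have h2 : 3^-1 ^+ 2 * meas mu (sh bad) <= 16 * meas mu sparse_rows.
  rewrite [X in _ <= 16 * X]meas_ind.
  apply: le_trans (mx23_L2 mu1_ge0 mu2_ge0 mu3_ge0 lam2 lam3 (f :=
    fun x => (x \in sparse_rows)%:R) _) => //.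
  apply: (chebyshev mu_ge0) => [|x /bigcupP[J Jb xJ]]; first by rewrite invr_ge0.
  have [_ r0 _ hJ] := bad_density Jb.
  have [_ A2F A3F] := fU (badU _ Jb).
  move: (xJ); rewrite in_rect => /and3P[x1 x2 x3].
  rewrite -(ler_pM2l r0) mulrC; apply: (le_trans hJ).
  apply: le_trans (sum_le_mx23 mu2_ge0 mu3_ge0 (f :=
    fun x => (x \in sparse_rows)%:R) _ A2F A3F x2 x3) => //.
  apply: sum23_le => y2 y3 y2J y3J; rewrite ler_nat.
  case: (boolP (low J y2 y3)) => //= lJ; rewrite lt0b in_sparse_rows.
  have JS : J \in S by move: Jb; rewrite in_set => /andP[].
  apply/andP; split.
    by apply/bigcupP; exists J => //; rewrite in_rect x1 y2J y3J.
  apply/exists_inP; exists J => //; rewrite lJ andbT in_rect /= y2J y3J.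
  by rewrite (subsetP (A1Q (badU _ Jb))).
have h3 := meas_sparse_rows.
have Om0 : 0 <= meas mu Om by exact: meas_ge0.
have : 32 * 32 * 162 * kap * meas mu Om <= meas mu Om.
  by rewrite -[leRHS]mul1r ler_wpM2r.
have : kap * (3^-1 ^+ 2 * meas mu (\bigcup_(J in bad) box J)) <= kap * (64 * meas mu Om).
  by rewrite ler_pM2l.
lra.
Qed.
End bad.
(** A member that is not bad has volume at most [(kap ^+ 2)^-1] times its good part, so [sum_good]
    accounts for half of the constant. The induction hypothesis for the bad ones, whose shadow is at
    most half as large, accounts for the other half. *)
Lemma weighted_carleson : carleson mu1 mu2 mu3 A1 A2 A3 U (fun J => w (a J) (b J)) (2 / kap ^+ 2).
Proof.
move=> S; have [n] := ubnP #|S|; elim: n S => // n IH S; rewrite ltnS => Sn SU.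
have [->|S0] := eqVneq S set0.
  by rewrite big_set0 mulr_ge0 ?meas_ge0// divr_ge0// sqr_ge0.
pose B := bad S.
have BS : B \subset S by apply/subsetP => J; rewrite in_set => /andP[].
(* If all members were bad, [sh S] would be a null set, against [vol_gt0]. *)
have pB : B \proper S.
  rewrite properEneq BS andbT; apply/negP => /eqP BSE.
  have := meas_sh_bad SU; rewrite -/B BSE => h.
  have sh0 : meas mu (sh S) = 0.
    by apply/eqP; rewrite eq_le meas_ge0// andbT; have := meas_ge0 mu_ge0 (sh S); lra.
  have /set0Pn[J JS] := S0; have := vol_gt0 (subsetP SU _ JS).
  rewrite ltNge -sh0 => /negP; apply; apply: meas_sub => //.
  by apply/subsetP => x xJ; apply/bigcupP; exists J.
have k2 : 0 < kap ^+ 2 by rewrite exprn_gt0.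
have := IH B (leq_trans (proper_card pB) Sn) (subset_trans BS SU).
have := meas_sh_bad SU; rewrite -/B => h1 h2.
have h3 : \sum_(J in S :\: B) w (a J) (b J) * vol J <= (kap ^+ 2)^-1 * meas mu (sh S).
  apply: le_trans (_ : _ <= (kap ^+ 2)^-1 * \sum_(J in S) w (a J) (b J) * meas mu (good S J)) _.
    rewrite mulr_sumr big_mkcond [leRHS]big_mkcond; apply: ler_sum => J _.
    rewrite in_setD; case: (boolP (J \in S)) => JS; last by rewrite andbF.
    rewrite andbT in_set JS /= -leNgt; case: ifPn => [hJ|_]; last first.
      by rewrite !mulr_ge0 ?meas_ge0// invr_ge0 ltW.
    by rewrite mulrCA ler_wpM2l// ler_pdivlMl.
  by rewrite ler_wpM2l ?invr_ge0 ?(ltW k2)//; exact: sum_good.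
rewrite (big_setID B)/= (setIidPr BS).
have : 2 / kap ^+ 2 * meas mu (sh B) <= (kap ^+ 2)^-1 * meas mu (sh S).
  by rewrite mulrAC mulrC ler_wpM2l// invr_ge0 ltW.
have -> : 2 / kap ^+ 2 * meas mu (sh S) =
  (kap ^+ 2)^-1 * meas mu (sh S) + (kap ^+ 2)^-1 * meas mu (sh S) by ring.
move: h2 h3; set y := 2 / kap ^+ 2 * meas mu (sh B); lra.
Qed.

End weighted_carleson.

(** * Sparse selection *)

Section sparse_selection.
Context (R : realFieldType) (X1 X2 X3 : finType).
Context (mu1 : X1 -> R) (mu2 : X2 -> R) (mu3 : X3 -> R).
Hypothesis mu1_ge0 : forall x, 0 <= mu1 x.
Hypothesis mu2_ge0 : forall x, 0 <= mu2 x.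
Hypothesis mu3_ge0 : forall x, 0 <= mu3 x.
Context (fam1 : {set {set X1}}) (fam2 : {set {set X2}}) (fam3 : {set {set X3}}).
Hypothesis lam1 : laminar fam1.
Hypothesis lam2 : laminar fam2.
Hypothesis lam3 : laminar fam3.
Notation X := (X1 * X2 * X3)%type.
Local Notation mu := (prodw mu1 mu2 mu3).
Let mu_ge0 : forall x, 0 <= mu x := prodw_ge0 mu1_ge0 mu2_ge0 mu3_ge0.
Context (K : finType) (A1 : K -> {set X1}) (A2 : K -> {set X2}) (A3 : K -> {set X3}).
Local Notation rct := (rct A1 A2 A3).
Local Notation vol := (vol mu1 mu2 mu3 A1 A2 A3).
Local Notation sh := (sh A1 A2 A3).

Lemma measD (A B : {set X}) : meas mu A = meas mu (A :&: B) + meas mu (A :\: B).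
Proof. by rewrite /meas (big_setID B). Qed.

Definition sparse_on (G : {set K}) (E : K -> {set X}) :=
  [/\ forall I, I \in G -> E I \subset rct I,
      forall I, I \in G -> vol I <= 8 * meas mu (E I) &
      forall I J, I \in G -> J \in G -> I != J -> [disjoint E I & E J]].

Lemma carleson_sparse (G : {set K}) E : sparse_on G E ->
  carleson mu1 mu2 mu3 A1 A2 A3 G (fun=> 1) 8.
Proof.
move=> [Erct Evol Edis] S /subsetP SG.
apply: (@le_trans _ _ (8 * \sum_(I in S) meas mu (E I))).
  by rewrite mulr_sumr; apply: ler_sum => I /SG IG; rewrite mul1r Evol.
rewrite ler_wpM2l// /meas.
rewrite (exchange_big_dep (fun x => x \in sh S)) /=; last first.
  by move=> I x IS /(subsetP (Erct _ (SG _ IS))) xI; apply/bigcupP; exists I.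
apply: ler_sum => x _; rewrite big_mkcondr /=.
have [/existsP[I /andP[IS xI]]|/existsPn nI] := boolP [exists I, (I \in S) && (x \in E I)].
  rewrite (bigD1 I)//= xI big1 ?addr0// => J /andP[JS JI].
  rewrite ifN//; apply/negP => xJ.
  by have := Edis _ _ (SG _ JS) (SG _ IS) JI => /disjointFr/(_ xJ); rewrite xI.
by rewrite big1// => I IS; rewrite ifN//; have := nI I; rewrite IS.
Qed.

(** A rectangle is selected if more than 1/8 of it lies outside the shadow of the previous
    selection, and this part is its [E I]. That the earlier sets E lie in that shadow makes the new
    one disjoint from them. In the end at least 7/8 of every member lies in the shadow of [G], and
    [weak_type] gives the constant 64 * (8 / 7)^2 < 84. *)
Lemma sparse_selection (U : {set K}) : in_fam fam1 fam2 fam3 A1 A2 A3 U ->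
  (forall I, I \in U -> 0 < vol I) ->
  exists (G : {set K}) (E : K -> {set X}), [/\ G \subset U, sparse_on G E & meas mu (sh U) <= 84 *
    meas mu (sh G)].
Proof.
move=> fU pU.
suff [G [E [GU spG _ dG]]] : exists (G : {set K}) (E : K ->
  {set X}), [/\ G \subset U, sparse_on G E,
    forall I, I \in G -> E I \subset sh G &
    forall I, I \in U -> (7 / 8) * vol I <= meas mu (rct I :&: sh G)].
  exists G, E; split => //.
  have := weak_type mu1_ge0 mu2_ge0 mu3_ge0 lam1 lam2 lam3 (f := fun x => (x \in sh G)%:R)
    (d := 7 / 8) fU _ _ pU; rewrite -meas_ind => H.
  have {H} : (7 / 8) ^+ 2 * meas mu (sh U) <= 64 * meas mu (sh G).
    by apply: H => // [|I IU]; [lra|rewrite -meas_setI; exact: dG].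
  have : 0 <= meas mu (sh U) by exact: meas_ge0.
  lra.
have [n] := ubnP #|U|; elim: n U fU pU => // n IH U fU pU; rewrite ltnS => Un.
have [->|/set0Pn[I IU]] := eqVneq U set0.
  by exists set0, (fun=> set0); split => //; [split|..] => I; rewrite inE.
have sU : U :\ I \subset U by exact: subsetDl.
have := IH (U :\ I); case.
- by move=> J /(subsetP sU); exact: fU.
- by move=> J /(subsetP sU); exact: pU.
- by apply: leq_trans Un; rewrite [in leqRHS](cardsD1 I) IU.
move=> G [E [GU [Erct Evol Edis] EG dG]].
have IG : I \notin G by apply: contraTN isT => /(subsetP GU); rewrite !inE eqxx.
have [h|h] := leP (7 / 8 * vol I) (meas mu (rct I :&: sh G)).
  exists G, E; split => //; first exact: subset_trans sU.
  by move=> J JU; have [->//|JI] := eqVneq J I; apply: dG; rewrite !inE JI.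
pose E' J := if J == I then rct I :\: sh G else E J.
have E'G J : J \in G -> E' J = E J.
  by move=> JG; rewrite /E' ifN//; apply: contraNN IG => /eqP <-.
have E'I : E' I = rct I :\: sh G by rewrite /E' eqxx.
have shI : sh (I |: G) = rct I :|: sh G by rewrite /sh bigcup_setU big_set1.
exists (I |: G), E'; split => //.
- by rewrite subUset sub1set IU (subset_trans GU).
- split.
  + move=> J; rewrite in_setU1 => /orP[/eqP ->|JG]; last by rewrite E'G ?Erct.
    by rewrite E'I subsetDl.
  + move=> J; rewrite in_setU1 => /orP[/eqP ->|JG]; last by rewrite E'G ?Evol.
    by rewrite E'I; have := measD (rct I) (sh G); rewrite -/(vol I); lra.
  + have dI J : J \in G -> [disjoint E J & rct I :\: sh G].
      move=> JG; rewrite disjoints_subset; apply/subsetP => x /(subsetP (EG _ JG)) xG.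
      by rewrite in_setC in_setD xG.
    move=> J J'; rewrite !in_setU1 => /orP[/eqP ->|JG] /orP[/eqP ->|J'G] JJ'.
    * by rewrite eqxx in JJ'.
    * by rewrite E'I E'G// disjoint_sym dI.
    * by rewrite E'I E'G// dI.
    * by rewrite !E'G// Edis.
- move=> J; rewrite in_setU1 => /orP[/eqP ->|JG]; rewrite shI.
    by rewrite E'I; apply: (subset_trans (subsetDl _ _)); exact: subsetUl.
  by rewrite E'G//; apply: (subset_trans (EG _ JG)); exact: subsetUr.
- move=> J JU; rewrite shI; have [->|JI] := eqVneq J I.
    rewrite setIUr setIid (setUidPl (subsetIl _ _)) -/(vol I).
    by have := vol_ge0 mu1_ge0 mu2_ge0 mu3_ge0 A1 A2 A3 I; lra.
  apply: (le_trans (dG J _)); first by rewrite !inE JI.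
  by apply: meas_sub => //; apply: setIS; exact: subsetUr.
Qed.

End sparse_selection.

From mathcomp Require Import all_classical all_reals all_analysis.
From mathcomp Require Import measurable_realfun.
Import numFieldNormedType.Exports.
Local Open Scope classical_set_scope.
Local Open Scope ring_scope.

(** * Exponential integrability *)

Section exponential_inequalities.
Context (R : realType).
Implicit Types (t x y : R).

Definition cosh1 y : R := 2^-1 * (expR y + expR (- y)) - 1.

Lemma expR_half_le2 : expR (2^-1) <= 2 :> R.
Proof.
have h := @expR_ge1Dx R (- 2^-1); have e0 := expR_gt0 (2^-1 : R).
have e1 : expR (- 2^-1) * expR (2^-1) = 1 :> R by rewrite -expRD addNr expR0.
nra.
Qed.

Lemma expR_le_exp2 n y : y <= n%:R / 2 -> expR y <= 2 ^+ n.
Proof.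
move=> yn; apply: (@le_trans _ _ (expR (2^-1) ^+ n)).
  by rewrite -expRM_natl ler_expR.
by rewrite lerXn2r ?nnegrE ?expR_ge0// expR_half_le2.
Qed.

Lemma expR_convex t y : 0 <= t <= 1 -> expR (t * y) - 1 <= t * (expR y - 1).
Proof.
move=> /andP[t0 t1].
(* The tangent of the exponential at [t * y], evaluated at [y] and at 0; these are then averaged
   with weights [t] and [1 - t]. *)
have h1 := @expR_ge1Dx R (y - t * y); have h2 := @expR_ge1Dx R (- (t * y)).
have e0 := expR_gt0 (t * y).
have e1 : expR y = expR (t * y) * expR (y - t * y) by rewrite -expRD addrCA subrr addr0.
have e2 : 1 = expR (t * y) * expR (- (t * y)) by rewrite -expRD subrr expR0.
have h3 : t * expR (t * y) * (1 + (y - t * y)) <= t * expR y.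
  by rewrite e1 mulrA ler_wpM2l// mulr_ge0// ltW.
have h4 : (1 - t) * expR (t * y) * (1 + - (t * y)) <= 1 - t.
  rewrite -[leRHS]mulr1 [X in _ <= _ * X]e2 mulrA ler_wpM2l// mulr_ge0 ?subr_ge0// ltW//.
lra.
Qed.

Lemma cosh1_ge0 y : 0 <= cosh1 y.
Proof.
have h1 := @expR_ge1Dx R y; have h2 := @expR_ge1Dx R (- y).
rewrite /cosh1; lra.
Qed.

Lemma cosh1_gt0 y : 0 < y -> 0 < cosh1 y.
Proof.
move=> y0; have h1 := @expR_gt1Dx R y; have h2 := @expR_ge1Dx R (- y).
have /h1 : y != 0 by rewrite gt_eqF.
rewrite /cosh1; lra.
Qed.

Lemma cosh1_convex t y : 0 <= t <= 1 -> cosh1 (t * y) <= t * cosh1 y.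
Proof.
move=> t01; have := expR_convex y t01; have := expR_convex (- y) t01.
rewrite /cosh1 mulrN; lra.
Qed.

Lemma cosh1_le_expR y : 0 <= y -> cosh1 y <= expR y - 1.
Proof.
move=> y0; have : expR (- y) <= expR y by rewrite ler_expR (le_trans _ y0)// oppr_le0.
rewrite /cosh1; lra.
Qed.

Lemma expR_small y : 0 <= y <= 2^-1 -> expR y <= 1 + y + 2 * y ^+ 2.
Proof.
move=> /andP[y0 y1]; have h := @expR_ge1Dx R (- y); have e0 := expR_gt0 y.
have e1 : expR (- y) * expR y = 1 by rewrite -expRD addNr expR0.
have h1 : (1 - y) * expR y <= 1 by rewrite -[leRHS]e1 ler_wpM2r// ltW.
have h2 : 1 <= (1 - y) * (1 + y + 2 * y ^+ 2).
  have : 0 <= y ^+ 2 * (1 - 2 * y) by rewrite mulr_ge0 ?sqr_ge0//; lra.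
  rewrite !expr2; nra.
have y2 : 0 < 1 - y by lra.
by rewrite -(ler_pM2l y2); exact: le_trans h2.
Qed.

Lemma expRN_small y : 0 <= y -> expR (- y) <= 1 - y + y ^+ 2.
Proof.
move=> y0; have h := @expR_ge1Dx R y; have e0 := expR_gt0 (- y).
have e1 : expR (- y) * expR y = 1 by rewrite -expRD addNr expR0.
have h1 : (1 + y) * expR (- y) <= 1 by rewrite -[leRHS]e1 mulrC ler_wpM2l// ltW.
have h2 : 1 <= (1 + y) * (1 - y + y ^+ 2).
  have : 0 <= y ^+ 2 * y by rewrite mulr_ge0 ?sqr_ge0//.
  rewrite !expr2; nra.
have y2 : 0 < 1 + y by lra.
by rewrite -(ler_pM2l y2); exact: le_trans h2.
Qed.

Lemma exp2_bound x : 1 <= x -> exists n : nat, 2 ^+ n <= x < 2 ^+ n.+1.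
Proof.
move=> x1.
have [n hn] : exists n : nat, x < 2 ^+ n.
  exists (Num.Def.truncn x).+1; apply: (lt_le_trans (truncnS_gt x)).
  by rewrite -natrX ler_nat ltnW// ltn_expl.
by have [k hk] := dyadic_level x1 hn; exists k.
Qed.

(* [h] plays the role of the height at a point, bounded by the number of dyadic cells. *)
Lemma expR_of_cells (c h B : R) : 0 < c <= 1 -> 0 <= h -> c * h <= B ->
  (forall n, 1 + B < 2 ^+ n -> h <= n%:R * (2 / c + 1)) ->
  expR (c / 20 * h) - 1 <= 4 * B.
Proof.
move=> /andP[c0 c1] h0 hB hn; have B0 : 0 <= B by apply: le_trans hB; rewrite mulr_ge0// ltW.
(* The exponent is at most [n.+1%:R / 2], so the exponential is at most [2 ^+ n.+1], hence at most 2
   * (1 + B). This suffices if [n] is positive. For [n = 0], where [B] may be close to 0, the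
   second-order bound [expR_small] is used. *)
have [n /andP[nB Bn]] : exists n : nat, 2 ^+ n <= 1 + B < 2 ^+ n.+1 by apply: exp2_bound; lra.
have hy : c / 20 * h <= n.+1%:R / 2.
  apply: (@le_trans _ _ (c / 20 * (n.+1%:R * (2 / c + 1)))).
    by rewrite ler_wpM2l ?hn// divr_ge0// ltW.
  have -> : c / 20 * (n.+1%:R * (2 / c + 1)) = n.+1%:R * ((2 + c) / 20) by field; rewrite gt_eqF.
  rewrite ler_wpM2l//; lra.
case: n nB Bn hy => [|n] nB Bn hy.
  have y0 : 0 <= c / 20 * h by rewrite mulr_ge0// divr_ge0// ltW.
  have := @expR_small (c / 20 * h); rewrite y0 => /(_ _).
  have hy' : c / 20 * h <= 2^-1 by move: hy; rewrite mul1r.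
  rewrite hy' => /(_ isT).
  have : (c / 20 * h) ^+ 2 <= c / 20 * h by rewrite expr2; nra.
  have : c / 20 * h = c * h / 20 by ring.
  lra.
have := expR_le_exp2 hy; rewrite exprS.
have : 2 <= 1 + B by apply: le_trans nB; rewrite exprS ler_peMr// exprn_ege1// ler1n.
lra.
Qed.

(** The square root turns the bound by n^2 cells into one of order n for the argument. For small [h]
    the linear terms of the two exponentials cancel, so that [cosh1] is of the order of the square
    of its argument, which is linear in [h]. *)
Lemma cosh1_of_cells (c h B : R) : 0 < c <= 1 -> 0 <= h -> c * h <= B ->
  (forall n, 1 + B < 2 ^+ n -> h <= n%:R ^+ 2 * (4 / c + 1)) ->
  cosh1 (c / 20 * Num.sqrt h) <= 4 * B.
Proof.
move=> /andP[c0 c1] h0 hB hn; have B0 : 0 <= B by apply: le_trans hB; rewrite mulr_ge0// ltW.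
have [n /andP[nB Bn]] : exists n : nat, 2 ^+ n <= 1 + B < 2 ^+ n.+1 by apply: exp2_bound; lra.
set y := c / 20 * Num.sqrt h.
have y0 : 0 <= y by rewrite mulr_ge0 ?sqrtr_ge0// divr_ge0// ltW.
have y2 : y ^+ 2 = (c / 20) ^+ 2 * h by rewrite exprMn sqr_sqrtr.
have hy : y <= n.+1%:R / 2.
  rewrite -ler_sqr ?nnegrE// ?divr_ge0// y2.
  apply: (@le_trans _ _ ((c / 20) ^+ 2 * (n.+1%:R ^+ 2 * (4 / c + 1)))).
    by rewrite ler_wpM2l ?hn ?sqr_ge0.
  have -> : (c / 20) ^+ 2 * (n.+1%:R ^+ 2 * (4 / c + 1)) =
     n.+1%:R ^+ 2 * ((4 * c + c ^+ 2) / 20 ^+ 2) by field; rewrite gt_eqF.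
  rewrite exprMn ler_wpM2l ?sqr_ge0//.
  have : c ^+ 2 <= c by rewrite expr2; nra.
  by rewrite !expr2; lra.
case: n nB Bn hy => [|n] nB Bn hy.
  have hy' : y <= 2^-1 by move: hy; rewrite mul1r.
  have := @expR_small y; rewrite y0 hy' => /(_ isT).
  have := expRN_small y0.
  have : y ^+ 2 <= B.
    rewrite y2; apply: le_trans hB; rewrite ler_wpM2r// expr2; nra.
  rewrite /cosh1; lra.
have := cosh1_le_expR y0.
have := expR_le_exp2 hy; rewrite exprS.
have : 2 <= 1 + B by apply: le_trans nB; rewrite exprS ler_peMr// exprn_ege1// ler1n.
lra.
Qed.

End exponential_inequalities.

Section exponential_integrability.
Context (R : realType) (X1 X2 X3 : finType).
Context (mu1 : X1 -> R) (mu2 : X2 -> R) (mu3 : X3 -> R).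
Hypothesis mu1_ge0 : forall x, 0 <= mu1 x.
Hypothesis mu2_ge0 : forall x, 0 <= mu2 x.
Hypothesis mu3_ge0 : forall x, 0 <= mu3 x.
Context (fam1 : {set {set X1}}) (fam2 : {set {set X2}}) (fam3 : {set {set X3}}).
Hypothesis lam1 : laminar fam1.
Hypothesis lam2 : laminar fam2.
Hypothesis lam3 : laminar fam3.
Notation X := (X1 * X2 * X3)%type.
Local Notation mu := (prodw mu1 mu2 mu3).
Let mu_ge0 : forall x, 0 <= mu x := prodw_ge0 mu1_ge0 mu2_ge0 mu3_ge0.
Context (K : finType) (A1 : K -> {set X1}) (A2 : K -> {set X2}) (A3 : K -> {set X3}).
Local Notation rct := (rct A1 A2 A3).
Local Notation sh := (sh A1 A2 A3).
Context (U : {set K}) (W : K -> R) (L : R).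
Hypothesis W01 : forall I, 0 <= W I <= 1.
Hypothesis L_ge1 : 1 <= L.
Hypothesis fU : in_fam fam1 fam2 fam3 A1 A2 A3 U.
Hypothesis carU : carleson mu1 mu2 mu3 A1 A2 A3 U W L.
Hypothesis chU : chain_family A1 A2 A3 U.
Local Notation hgt := (hgt A1 A2 A3 U W).

(** The largest value for which [64 * L * c <= 4^-1], as needed to absorb the form in
    [sum_chain_weight]. *)
Let c : R := (256 * L)^-1.
Let L_gt0 : 0 < L. Proof. exact: lt_le_trans L_ge1. Qed.
Let c_gt0 : 0 < c. Proof. by rewrite invr_gt0 mulr_gt0. Qed.
Let cLE : c * L = 256^-1.
Proof. by rewrite /c invfM -mulrA mulVf ?mulr1// gt_eqF. Qed.
Let c01 : 0 < c <= 1.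
Proof.
rewrite c_gt0; have : c * 1 <= c * L by rewrite ler_pM2l.
rewrite cLE; lra.
Qed.
Let cL : 64 * L * c <= 4^-1.
Proof. have := cLE; lra. Qed.

Lemma cosh1_integral (t : R) : 0 <= t <= 1 ->
  \sum_x mu x * cosh1 (t * (c / 20) * Num.sqrt (hgt x)) <= t * meas mu (sh U).
Proof.
move=> t01; have /andP[t0 t1] := t01.
pose h1 := height1 A1 A2 A3 U W c; pose h2 := height2 A1 A2 A3 U W c.
have s1 := sum_height1 mu1_ge0 mu2_ge0 mu3_ge0 lam1 lam2 lam3 W01 c_gt0 L_gt0 cL fU carU.
have s2 := sum_height2 mu1_ge0 mu2_ge0 mu3_ge0 lam1 lam2 lam3 W01 c_gt0 L_gt0 cL fU carU.
have W0 I : 0 <= W I by case/andP: (W01 I).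
have h0 x : 0 <= hgt x by apply: (hgt_ge0 _ _ _ _ W01).
have hh1 x : hgt x <= h1 x by apply: hgt_le_height1 W01 c_gt0 _.
have hh2 x : hgt x <= h2 x by apply: hgt_le_height2 W01 c_gt0 _.
apply: (@le_trans _ _ (t * (4 * c * (\sum_x mu x * h1 x + \sum_x mu x * h2 x)))).
  rewrite -big_split !mulr_sumr; apply: ler_sum => x _ /=.
  have -> : t * (4 * c * (mu x * h1 x + mu x * h2 x)) = mu x * (t * (4 * (c * (h1 x + h2 x)))) by
    ring.
  rewrite ler_wpM2l// -[X in cosh1 X]mulrA.
  apply: (le_trans (cosh1_convex _ t01)); rewrite ler_wpM2l//.
  apply: cosh1_of_cells => //.
    by rewrite ler_pM2l// (le_trans (hh1 x))// lerDl (le_trans (h0 x)).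
  move=> n hn; apply: (hgt_cells2 lam3 W01 c_gt0 fU chU); apply: le_lt_trans hn.
    by rewrite lerD2l ler_pM2l// lerDl (le_trans (h0 x)).
  by rewrite lerD2l ler_pM2l// lerDr (le_trans (h0 x)).
rewrite ler_wpM2l//.
have m0 : 0 <= meas mu (sh U) by exact: meas_ge0.
apply: (@le_trans _ _ (4 * c * (2 * L * meas mu (sh U) + 2 * L * meas mu (sh U)))).
  by rewrite ler_wpM2l ?lerD// mulr_ge0// ltW.
have -> : 4 * c * (2 * L * meas mu (sh U) + 2 * L * meas mu (sh U)) =
  16 * (c * L) * meas mu (sh U) by ring.
rewrite cLE; lra.
Qed.

Lemma expR_integral (t : R) : 0 <= t <= 1 -> (forall I J, A3 I = A3 J) ->
  \sum_x mu x * (expR (t * (c / 20) * hgt x) - 1) <= t * meas mu (sh U).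
Proof.
move=> t01 A3c; have /andP[t0 t1] := t01.
pose h1 := height1 A1 A2 A3 U W c.
have s1 := sum_height1 mu1_ge0 mu2_ge0 mu3_ge0 lam1 lam2 lam3 W01 c_gt0 L_gt0 cL fU carU.
have h0 x : 0 <= hgt x by apply: (hgt_ge0 _ _ _ _ W01).
have hh1 x : hgt x <= h1 x by apply: hgt_le_height1 W01 c_gt0 _.
apply: (@le_trans _ _ (t * (4 * c * (\sum_x mu x * h1 x)))).
  rewrite !mulr_sumr; apply: ler_sum => x _ /=.
  have -> : t * (4 * c * (mu x * h1 x)) = mu x * (t * (4 * (c * h1 x))) by ring.
  rewrite ler_wpM2l// -[X in expR X]mulrA.
  apply: (le_trans (expR_convex _ t01)); rewrite ler_wpM2l//.
  apply: expR_of_cells => //; first by rewrite ler_pM2l.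
  by move=> n hn; apply: (hgt_cells1 W01 c_gt0 chU).
rewrite ler_wpM2l//.
have m0 : 0 <= meas mu (sh U) by exact: meas_ge0.
apply: (@le_trans _ _ (4 * c * (2 * L * meas mu (sh U)))).
  by rewrite ler_wpM2l// mulr_ge0// ltW.
have -> : 4 * c * (2 * L * meas mu (sh U)) = 8 * (c * L) * meas mu (sh U) by ring.
rewrite cLE; lra.
Qed.

End exponential_integrability.

(** * Passage to atoms *)

Local Open Scope classical_set_scope.
Local Open Scope ring_scope.

Section atoms.
Context (R : realType) d (V : measurableType d) (m : {measure set V -> \bar R}).
Context (K : finType) (S : K -> set V).
Hypothesis mS : forall k, measurable (S k).
Hypothesis fS : forall k, (m (S k) < +oo)%E.

Definition pattern (v : V) : {set K} := [set k | `[< S k v >]]%SET.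

(* Only the patterns realized by a point are kept, so that inclusions and disjointness of the
   sets [S k] can be read off their atoms. *)
Definition atom := {A : {set K} | `[< exists v, pattern v = A >]}.

Definition atom_of (v : V) : atom := exist _ (pattern v) (asboolT (ex_intro _ v erefl)).

(** The empty pattern is the complement of all the sets and may have infinite measure. No rectangle
    contains it, so it can be given weight 0. *)
Definition atom_weight (a : atom) : R :=
  if val a == finset.set0 then 0 else fine (m (atom_of @^-1` [set a])).

Definition atoms_in (k : K) : {set atom} := [set a : atom | k \in val a]%SET.

Lemma mem_atoms_in v k : (atom_of v \in atoms_in k) = `[< S k v >].
Proof. by rewrite inE /= inE. Qed.

Lemma atom_of_surj (a : atom) : exists v, atom_of v = a.
Proof.
case: a => A hA; have /asboolP[v vA] := hA; exists v; exact: val_inj.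
Qed.

Lemma measurable_atom a : measurable (atom_of @^-1` [set a]).
Proof.
rewrite (_ : _ @^-1` _ = \bigcap_(k in [set: K]) (if k \in val a then S k else ~` S k)).
  by apply: fin_bigcap_measurable => // k _; case: ifP => _ //; exact: measurableC.
apply/seteqP; split => v /=.
  by move=> <- k _ /=; rewrite inE; case: asboolP.
move=> h; apply/val_inj/setP => k /=; rewrite inE; have := h k Logic.I.
by case: ifP => _ hk; apply/asboolP.
Qed.

Lemma atom_fin a : val a != finset.set0 -> (m (atom_of @^-1` [set a]) < +oo)%E.
Proof.
move=> /set0Pn[k ka]; apply: le_lt_trans (fS k); apply: le_measure; rewrite ?inE//.
  exact: measurable_atom.
by move=> v /= va; move: ka; rewrite -va /= inE => /asboolP.
Qed.

Lemma atom_weight_ge0 a : 0 <= atom_weight a.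
Proof. by rewrite /atom_weight; case: ifP => // _; exact: fine_ge0. Qed.

Lemma atoms_in_subset k l : (atoms_in k \subset atoms_in l) <-> (S k `<=` S l).
Proof.
split => [/fintype.subsetP h v Sv|h].
  by have := h (atom_of v); rewrite !mem_atoms_in => /(_ (asboolT Sv))/asboolP.
apply/fintype.subsetP => a; have [v <-] := atom_of_surj a.
by rewrite !mem_atoms_in => /asboolP/h/asboolP.
Qed.

Lemma atoms_in_proper k l : S k `<` S l -> atoms_in k \proper atoms_in l.
Proof.
move=> [kl lk]; rewrite properE; apply/andP; split; first exact/atoms_in_subset.
by apply/negP => /atoms_in_subset.
Qed.

Lemma eq_atoms_in k l : S k = S l -> atoms_in k = atoms_in l.
Proof.
by move=> kl; apply/setP => v; have [x <-] := atom_of_surj v; rewrite !mem_atoms_in kl.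
Qed.

Hypothesis lamS : forall k l, S k `&` S l !=set0 -> S k `<=` S l \/ S l `<=` S k.

Lemma laminar_atoms : laminar [set atoms_in k | k in K]%SET.
Proof.
move=> _ _ /imsetP[k _ ->] /imsetP[l _ ->].
have [/lamS[]/atoms_in_subset h|h] := pselect (S k `&` S l !=set0).
- by constructor 1.
- by constructor 2.
constructor 3; rewrite finset.disjoints_subset; apply/fintype.subsetP => a; have [v <-] :=
  atom_of_surj a.
rewrite finset.in_setC !mem_atoms_in => /asboolP Sk; apply/asboolP => Sl.
by apply: h; exists v.
Qed.

End atoms.

(** * Cells of a space with three coordinate maps *)

Section discretization.
Context (R : realType) d (T : measurableType d) (mu : {measure set T -> \bar R}).
Context d1 (V1 : measurableType d1) (m1 : {measure set V1 -> \bar R}).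
Context d2 (V2 : measurableType d2) (m2 : {measure set V2 -> \bar R}).
Context d3 (V3 : measurableType d3) (m3 : {measure set V3 -> \bar R}).
Context (p1 : T -> V1) (p2 : T -> V2) (p3 : T -> V3).

(** [T] is an arbitrary space with three maps rather than a product, so that its sigma-algebra may
    be the completed one and the third coordinate may be constant. *)
Definition boxset (B1 : set V1) (B2 : set V2) (B3 : set V3) : set T :=
  [set x | [/\ B1 (p1 x), B2 (p2 x) & B3 (p3 x)]].

Hypothesis mbox : forall B1 B2 B3, measurable B1 -> measurable B2 -> measurable B3 ->
  measurable (boxset B1 B2 B3).
Hypothesis boxE : forall B1 B2 B3, measurable B1 -> measurable B2 -> measurable B3 ->
  (m1 B1 < +oo -> m2 B2 < +oo -> m3 B3 < +oo ->
   mu (boxset B1 B2 B3) = m1 B1 * m2 B2 * m3 B3)%E.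

Context (K : finType) (S1 : K -> set V1) (S2 : K -> set V2) (S3 : K -> set V3).
Hypothesis mS1 : forall k, measurable (S1 k).
Hypothesis mS2 : forall k, measurable (S2 k).
Hypothesis mS3 : forall k, measurable (S3 k).
Hypothesis fS1 : forall k, (m1 (S1 k) < +oo)%E.
Hypothesis fS2 : forall k, (m2 (S2 k) < +oo)%E.
Hypothesis fS3 : forall k, (m3 (S3 k) < +oo)%E.

Local Notation Y1 := (atom S1).
Local Notation Y2 := (atom S2).
Local Notation Y3 := (atom S3).
Local Notation Y := (Y1 * Y2 * Y3)%type.
Local Notation w1 := (atom_weight m1 (S := S1)).
Local Notation w2 := (atom_weight m2 (S := S2)).
Local Notation w3 := (atom_weight m3 (S := S3)).
Local Notation nu := (prodw w1 w2 w3).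

Definition cell_of (x : T) : Y := (atom_of S1 (p1 x), atom_of S2 (p2 x), atom_of S3 (p3 x)).

Definition inner (a : Y) : bool :=
  [&& val a.1.1 != finset.set0, val a.1.2 != finset.set0 & val a.2 != finset.set0].

Lemma cell_preimage a : cell_of @^-1` [set a] =
  boxset (atom_of S1 @^-1` [set a.1.1]) (atom_of S2 @^-1` [set a.1.2]) (atom_of S3 @^-1` [set a.2]).
Proof.
case: a => -[a1 a2] a3; apply/seteqP; split => x /=; first by move=> [<- <- <-].
by rewrite /cell_of => -[-> -> ->].
Qed.

Lemma measurable_cell a : measurable (cell_of @^-1` [set a]).
Proof. by rewrite cell_preimage; apply: mbox; exact: measurable_atom. Qed.

Lemma mu_cell a : inner a -> mu (cell_of @^-1` [set a]) = (nu a)%:E.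
Proof.
move=> /and3P[a1 a2 a3]; rewrite cell_preimage boxE ?atom_fin//; try exact: measurable_atom.
rewrite /prodw /atom_weight (negPf a1) (negPf a2) (negPf a3) !EFinM !fineK//.
- by rewrite ge0_fin_numE// atom_fin.
- by rewrite ge0_fin_numE// atom_fin.
- by rewrite ge0_fin_numE// atom_fin.
Qed.

Lemma nu_ge0 a : 0 <= nu a.
Proof. by apply: prodw_ge0 => ?; exact: atom_weight_ge0. Qed.

Lemma integral_cells (f : Y -> R) : (forall a, 0 <= f a) -> (forall a, ~~ inner a -> f a = 0) ->
  (\int[mu]_x (f (cell_of x))%:E = (\sum_a nu a * f a)%:E)%E.
Proof.
move=> f0 fout.
transitivity (\int[mu]_x (\sum_a (f a * \1_(cell_of @^-1` [set a]) x)%:E))%E.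
  apply: eq_integral => x _; rewrite sumEFin; congr EFin.
  rewrite (bigD1 (cell_of x))//= indicE mem_set// mulr1 big1 ?addr0// => a ax.
  by rewrite indicE memNset ?mulr0// => xa; case/eqP: ax.
rewrite ge0_integral_sum//; last first.
- move=> a x _; rewrite lee_fin mulr_ge0//.
- move=> a; apply/measurable_EFinP; apply: measurable_funM => //.
  by apply: measurable_indic; exact: measurable_cell.
rewrite -sumEFin; apply: eq_bigr => a _.
under eq_integral do rewrite EFinM.
rewrite (integralZl_indic _ (fun=> cell_of @^-1` [set a]))//; last 2 first.
- by move=> h; have := f0 a; rewrite leNgt h.
- exact: measurable_cell.
rewrite integral_indic ?setIT//; last exact: measurable_cell.
have [ia|na] := boolP (inner a); first by rewrite mu_cell// -EFinM mulrC.
by rewrite fout// mul0e mulr0.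
Qed.

Lemma measurable_cells (E : {set Y}) : measurable (cell_of @^-1` [set` E]).
Proof.
rewrite (_ : _ @^-1` _ = \bigcup_(a in [set` E]) (cell_of @^-1` [set a])).
  by apply: fin_bigcup_measurable => // a _; exact: measurable_cell.
by apply/seteqP; split => x /=; [move=> xE; exists (cell_of x)|move=> [a /= aE ->]].
Qed.

Lemma mu_cells (E : {set Y}) : (forall a, a \in E -> inner a) ->
  mu (cell_of @^-1` [set` E]) = (meas nu E)%:E.
Proof.
move=> iE; have := @integral_cells (fun a => (a \in E)%:R) (fun a => ler0n _ _).
rewrite (_ : (\sum_a nu a * (a \in E)%:R)%R = meas nu E); last first.
  rewrite /meas [RHS]big_mkcond; apply: eq_bigr => a _.
  by case: ifP => _; rewrite ?mulr1 ?mulr0.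
move=> <-; last by move=> a; apply: contraNeq; rewrite pnatr_eq0 eqb0 negbK; exact: iE.
rewrite -[X in mu X]setIT -integral_indic//; last exact: measurable_cells.
apply: eq_integral => x _; rewrite indicE; congr ((nat_of_bool _)%:R%:E).
by apply/idP/idP => [/set_mem//|xE]; apply/mem_set.
Qed.

Local Notation A1 := (atoms_in S1).
Local Notation A2 := (atoms_in S2).
Local Notation A3 := (atoms_in S3).
Local Notation drct := (rct A1 A2 A3).

Lemma mem_drct x k : (cell_of x \in drct k) = `[< boxset (S1 k) (S2 k) (S3 k) x >].
Proof.
rewrite in_rect !mem_atoms_in; apply/idP/asboolP.
  by move=> /and3P[/asboolP ? /asboolP ? /asboolP ?].
by move=> [h1 h2 h3]; apply/and3P; split; apply/asboolP.
Qed.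

Lemma inner_drct a k : a \in drct k -> inner a.
Proof.
rewrite in_rect => /and3P[]; rewrite !inE => h1 h2 h3.
by apply/and3P; split; apply/set0Pn; exists k.
Qed.

Lemma vol_drct k : mu (boxset (S1 k) (S2 k) (S3 k)) = (meas nu (drct k))%:E.
Proof.
rewrite -mu_cells; last by move=> a; exact: inner_drct.
congr (mu _); apply/seteqP; split => x /=; rewrite mem_drct => /asboolP //.
Qed.

End discretization.

Section constants.
Context (R : realType).

(* The threshold of [weighted_carleson], the Carleson constant which results from it, and the
   exponent which [cosh1_integral] and [expR_integral] allow for that constant. *)
Definition kappa : R := (2 ^+ 18)^-1.
Definition Lambda : R := 2 / kappa ^+ 2.
Definition gamma : R := (256 * Lambda)^-1 / 20.

Lemma kappa_gt0 : 0 < kappa. Proof. by rewrite invr_gt0 exprn_gt0. Qed.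

Lemma kappa_small : 32 * 32 * 162 * kappa <= 1.
Proof.
rewrite /kappa ler_pdivrMr ?exprn_gt0// mul1r.
have -> : (2 : R) ^+ 18 = 32 * 32 * 256 by ring.
by rewrite ler_wpM2l// ?mulr_ge0// ler_nat.
Qed.

(** A 1/8-sparse family is Carleson with constant 8, so the one exponent [gamma] serves for the
    weighted heights and for the sparse ones. *)
Lemma Lambda_ge8 : 8 <= Lambda.
Proof.
have k0 := kappa_gt0; have k1 := kappa_small.
rewrite /Lambda ler_pdivlMr ?exprn_gt0// expr2; nra.
Qed.

Lemma gamma_gt0 : 0 < gamma.
Proof.
have := Lambda_ge8 => L8; rewrite divr_gt0// invr_gt0 mulr_gt0//; lra.
Qed.

(* The Zygmund setting for [th = true], the bi-parameter one for [th = false]. *)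
Definition psi (th : bool) (g h : R) : R :=
  if th then cosh1 (g * Num.sqrt h) else expR (g * h) - 1.

Lemma psi0 th g : psi th g 0 = 0.
Proof.
rewrite /psi; case: th; rewrite ?sqrtr0 mulr0 ?expR0 ?subrr//.
by rewrite /cosh1 oppr0 expR0; lra.
Qed.

Lemma psi_ge0 th g h : 0 <= g -> 0 <= h -> 0 <= psi th g h.
Proof.
move=> g0 h0; rewrite /psi; case: th; first exact: cosh1_ge0.
by rewrite subr_ge0 -expR0 ler_expR mulr_ge0.
Qed.

End constants.

(** * Estimates for finitely many boxes, brought back from the cells *)

Section finite_family.
Context (R : realType) d (T : measurableType d) (mu : {measure set T -> \bar R}).
Context d1 (V1 : measurableType d1) (m1 : {measure set V1 -> \bar R}).
Context d2 (V2 : measurableType d2) (m2 : {measure set V2 -> \bar R}).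
Context d3 (V3 : measurableType d3) (m3 : {measure set V3 -> \bar R}).
Context (p1 : T -> V1) (p2 : T -> V2) (p3 : T -> V3).
Local Notation boxset := (boxset p1 p2 p3).
Hypothesis mbox : forall B1 B2 B3, measurable B1 -> measurable B2 -> measurable B3 ->
  measurable (boxset B1 B2 B3).
Hypothesis boxE : forall B1 B2 B3, measurable B1 -> measurable B2 -> measurable B3 ->
  (m1 B1 < +oo -> m2 B2 < +oo -> m3 B3 < +oo ->
   mu (boxset B1 B2 B3) = m1 B1 * m2 B2 * m3 B3)%E.
Context (K : finType) (S1 : K -> set V1) (S2 : K -> set V2) (S3 : K -> set V3).
Hypothesis mS1 : forall k, measurable (S1 k).
Hypothesis mS2 : forall k, measurable (S2 k).
Hypothesis mS3 : forall k, measurable (S3 k).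
Hypothesis fS1 : forall k, (m1 (S1 k) < +oo)%E.
Hypothesis fS2 : forall k, (m2 (S2 k) < +oo)%E.
Hypothesis fS3 : forall k, (m3 (S3 k) < +oo)%E.
Hypothesis lS1 : forall k l, S1 k `&` S1 l !=set0 -> S1 k `<=` S1 l \/ S1 l `<=` S1 k.
Hypothesis lS2 : forall k l, S2 k `&` S2 l !=set0 -> S2 k `<=` S2 l \/ S2 l `<=` S2 k.
Hypothesis lS3 : forall k l, S3 k `&` S3 l !=set0 -> S3 k `<=` S3 l \/ S3 l `<=` S3 k.
Local Notation rs k := (boxset (S1 k) (S2 k) (S3 k)).
Hypothesis rs_gt0 : forall k, (0 < mu (rs k))%E.

Local Notation A1 := (atoms_in S1).
Local Notation A2 := (atoms_in S2).
Local Notation A3 := (atoms_in S3).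
Local Notation w1 := (atom_weight m1 (S := S1)).
Local Notation w2 := (atom_weight m2 (S := S2)).
Local Notation w3 := (atom_weight m3 (S := S3)).
Local Notation nu := (prodw w1 w2 w3).
Local Notation Y := (atom S1 * atom S2 * atom S3)%type.
Local Notation drct := (rct A1 A2 A3).
Local Notation dsh := (sh A1 A2 A3).
Local Notation dvol := (vol w1 w2 w3 A1 A2 A3).
Local Notation fam1 := [set A1 k | k in K]%SET.
Local Notation fam2 := [set A2 k | k in K]%SET.
Local Notation fam3 := [set A3 k | k in K]%SET.
Local Notation cell := (cell_of p1 p2 p3 S1 S2 S3).

Let w10 : forall a, 0 <= w1 a := @atom_weight_ge0 _ _ _ _ _ _.
Let w20 : forall a, 0 <= w2 a := @atom_weight_ge0 _ _ _ _ _ _.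
Let w30 : forall a, 0 <= w3 a := @atom_weight_ge0 _ _ _ _ _ _.
Let lam1 : laminar fam1 := laminar_atoms lS1.
Let lam2 : laminar fam2 := laminar_atoms lS2.
Let lam3 : laminar fam3 := laminar_atoms lS3.
Let nuge0 : forall a, 0 <= nu a := prodw_ge0 w10 w20 w30.

Definition shadowK (U : {set K}) : set T := \bigcup_(k in [set` U]) rs k.

Let mrs k : measurable (rs k). Proof. exact: mbox. Qed.

Lemma measurable_shadowK U : measurable (shadowK U).
Proof. by apply: fin_bigcup_measurable. Qed.

Let in_famU (U : {set K}) : in_fam fam1 fam2 fam3 A1 A2 A3 U.
Proof. by move=> k _; split; apply/imsetP; exists k. Qed.

Let dvolE k : mu (rs k) = (dvol k)%:E.
Proof. exact: vol_drct. Qed.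

Let dvol_gt0 k : 0 < dvol k.
Proof. by rewrite -lte_fin -dvolE. Qed.

Let mem_cell x k : (cell x \in drct k) = `[< rs k x >].
Proof. exact: mem_drct. Qed.

Let mem_cell_sh x (U : {set K}) : (cell x \in dsh U) = `[< shadowK U x >].
Proof.
apply/finset.bigcupP/asboolP => [[k kU]|[k kU xk]].
  by rewrite mem_cell => /asboolP xk; exists k.
by exists k => //; rewrite mem_cell; apply/asboolP.
Qed.

Let inner_sh a (U : {set K}) : a \in dsh U -> inner a.
Proof. by move=> /finset.bigcupP[k _]; exact: inner_drct. Qed.

Let mu_preim (E : {set Y}) (B : set T) (U : {set K}) : E \subset dsh U ->
  (forall x, (cell x \in E) = `[< B x >]) -> mu B = (meas nu E)%:E.
Proof.
move=> /fintype.subsetP EU EB.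
rewrite -(mu_cells mbox boxE mS1 mS2 mS3 fS1 fS2 fS3); last by move=> a /EU/inner_sh.
by congr (mu _); apply/seteqP; split => x /=; rewrite EB => /asboolP.
Qed.

Lemma shadowK_fin U : mu (shadowK U) = (meas nu (dsh U))%:E.
Proof. by apply: (mu_preim (U := U)) => // x; exact: mem_cell_sh. Qed.

(** [Om] need not be a union of cells. It is replaced by its conditional expectation [f] on the
    cells of the shadow. As [f] has values in [0, 1], the sum of [f ^+ 2] is at most that of [f],
    which is the measure of [Om] in the shadow. Density 1/2 turns 64 into 64 * 4 = 256. *)
Lemma weak_type_shadow (Om : set T) : measurable Om -> (mu Om < +oo)%E ->
  (forall k, mu (rs k) <= 2%:E * mu (rs k `&` Om))%E ->
  (mu (shadowK [set: K]) <= 256%:E * mu Om)%E.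
Proof.
move=> mOm fOm dens.
pose g (a : Y) := fine (mu (Om `&` cell @^-1` [set a])).
pose D := dsh [set: K]%SET.
pose f (a : Y) := if a \in D then g a / nu a else 0.
have mc a : measurable (cell @^-1` [set a]) by exact: (measurable_cell mbox).
have gfin (B : set T) : measurable B -> mu (Om `&` B) \is a fin_num.
  move=> mB; rewrite ge0_fin_numE//; apply: le_lt_trans fOm.
  by apply: le_measure; rewrite ?inE//; exact: measurableI.
have g0 a : 0 <= g a by exact: fine_ge0.
have gnu a : inner a -> g a <= nu a.
  move=> ia; rewrite -lee_fin fineK ?gfin// -(mu_cell boxE mS1 mS2 mS3 fS1 fS2 fS3)//.
  by apply: le_measure; rewrite ?inE//; exact: measurableI.
have f01 a : 0 <= f a <= 1.
  rewrite /f; case: ifPn => [/inner_sh ia|_]; last by rewrite lexx ler01.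
  rewrite divr_ge0//=; have [n0|n0] := eqVneq (nu a) 0; first by rewrite n0 invr0 mulr0.
  by rewrite ler_pdivrMr ?mul1r ?gnu// lt_neqAle eq_sym n0 nuge0.
have nuf a : a \in D -> nu a * f a = g a.
  move=> aD; have ia := inner_sh aD; rewrite /f aD; have [n0|n0] := eqVneq (nu a) 0;
    last by rewrite mulrC divfK.
  by rewrite n0 mul0r; apply/eqP; rewrite eq_sym eq_le g0 andbT -n0 gnu.
have sumg (E : {set Y}) (B : set T) : E \subset D ->
    (forall x, (cell x \in E) = `[< B x >]) ->
    (mu (B `&` Om) = (\sum_(a in E) nu a * f a)%:E)%E.
  move=> EU EB.
  transitivity (\int[mu]_x (\sum_(a <- enum E) (\1_(Om `&` cell @^-1` [set a]) x)%:E))%E;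
    last first.
    rewrite ge0_integral_sum//; last first.
      by move=> a; apply/measurable_EFinP; apply: measurable_indic; exact: measurableI.
    rewrite big_enum -sumEFin; apply: eq_bigr => a aE.
    rewrite integral_indic ?setIT ?nuf ?fineK ?gfin//; last exact: measurableI.
    exact: (fintype.subsetP EU).
  have mB : measurable B.
    rewrite (_ : B = cell @^-1` [set` E]); first exact: (measurable_cells mbox).
    by apply/seteqP; split => x /=; rewrite EB => /asboolP.
  rewrite -[X in mu X]setIT -integral_indic//; last exact: measurableI.
  apply: eq_integral => x _; rewrite sumEFin; congr EFin; rewrite big_enum.
  have [[Bx Ox]|nB] := pselect ((B `&` Om) x).
    rewrite indicE mem_set// (bigD1 (cell x))/=; last by rewrite EB; apply/asboolP.
    rewrite indicE mem_set// big1 ?addr0// => a /andP[_ ax].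
    by rewrite indicE memNset// => -[_ /= xa]; case/eqP: ax.
  rewrite indicE memNset// big1// => a aE; rewrite indicE memNset// => -[Ox /= xa].
  by apply: nB; split => //; apply/asboolP; rewrite -EB xa.
have wt := weak_type w10 w20 w30 lam1 lam2 lam3 (@in_famU [set: K]%SET) (f := f) (d := 2^-1).
have f0 a : 0 <= f a by case/andP: (f01 a).
have sumgU : mu (shadowK [set: K]%SET `&` Om) = (\sum_(a in D) nu a * f a)%:E.
  by apply: sumg => // x; exact: mem_cell_sh.
have key : (2^-1 : R) ^+ 2 * meas nu D <= 64 * \sum_a nu a * f a ^+ 2.
  apply: wt => //.
  - move=> k _; rewrite -lee_fin EFinM -dvolE -(sumg _ (rs k)).
    + by rewrite lee_pdivrMl// dens.
    + by apply/fintype.subsetP => a ak; apply/finset.bigcupP; exists k.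
    + by move=> x; exact: mem_cell.
have le1 : \sum_a nu a * f a ^+ 2 <= \sum_(a in D) nu a * f a.
  rewrite [leRHS]big_mkcond; apply: ler_sum => a _.
  have /andP[fa0 fa1] := f01 a.
  case: ifPn => [_|aU]; first by rewrite ler_wpM2l// expr2 ler_piMr.
  by rewrite /f (negPf aU) expr0n mulr0.
rewrite shadowK_fin; apply: (@le_trans _ _ (256%:E * mu (shadowK [set: K]%SET `&` Om)))%E.
  by rewrite sumgU -EFinM lee_fin; lra.
rewrite lee_pmul2l//; apply: le_measure; rewrite ?inE//.
by apply: measurableI => //; exact: measurable_shadowK.
Qed.

Definition chainK (U : {set K}) := forall k l, k \in U -> l \in U -> k != l ->
  S1 k `&` S1 l !=set0 -> S2 k `&` S2 l !=set0 -> S3 k `&` S3 l !=set0 ->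
  (S1 k `<` S1 l /\ S2 l `<` S2 k) \/ (S1 l `<` S1 k /\ S2 k `<` S2 l).

Lemma in_drct2 a k l : a \in drct k -> a \in drct l ->
  [/\ S1 k `&` S1 l !=set0, S2 k `&` S2 l !=set0 & S3 k `&` S3 l !=set0].
Proof.
case: a => -[a1 a2] a3; rewrite !in_rect /=.
have [v1 <-] := atom_of_surj a1; have [v2 <-] := atom_of_surj a2.
have [v3 <-] := atom_of_surj a3; rewrite !mem_atoms_in.
move=> /and3P[/asboolP x1 /asboolP x2 /asboolP x3].
by move=> /and3P[/asboolP y1 /asboolP y2 /asboolP y3]; split; [exists v1|exists v2|exists v3].
Qed.

Lemma chain_family_atoms U : chainK U -> chain_family A1 A2 A3 U.
Proof.
move=> ch k l a kU lU kl ak al; have [h1 h2 h3] := in_drct2 ak al.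
by case: (ch k l kU lU kl h1 h2 h3) => -[/atoms_in_proper ? /atoms_in_proper ?]; [left|right].
Qed.

Definition carlesonK (U : {set K}) (W : K -> R) := carleson w1 w2 w3 A1 A2 A3 U W (Lambda R).

Lemma psi_integral th (U : {set K}) (W : K -> R) (t : R) : (forall k, 0 <= W k <= 1) ->
  carlesonK U W -> chainK U -> (~~ th -> forall k l, S3 k = S3 l) -> 0 <= t <= 1 ->
  (\int[mu]_x (psi th (t * gamma R) (\sum_(k in U) W k * \1_(rs k) x))%:E <=
   t%:E * mu (shadowK U))%E.
Proof.
move=> W01 car ch S3c t01; have /andP[t0 t1] := t01.
have g0 : 0 <= t * gamma R by rewrite mulr_ge0// ltW// gamma_gt0.
have L1 : 1 <= Lambda R by have := Lambda_ge8 R; lra.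
have W0 k : 0 <= W k by case/andP: (W01 k).
pose f a := psi th (t * gamma R) (hgt A1 A2 A3 U W a).
have hE x : \sum_(k in U) W k * \1_(rs k) x = hgt A1 A2 A3 U W (cell x).
  rewrite /hgt big_mkcondr; apply: eq_bigr => k _; rewrite indicE.
  have -> : (x \in rs k) = (cell x \in drct k) by rewrite mem_cell; apply/idP/asboolP; rewrite inE.
  by case: ifP => _; rewrite ?mulr1 ?mulr0.
rewrite (eq_integral (fun x => (f (cell x))%:E)); last by move=> x _; rewrite hE.
rewrite (integral_cells mbox boxE mS1 mS2 mS3 fS1 fS2 fS3); last 2 first.
- by move=> a; apply: psi_ge0 => //; apply: sumr_ge0.
- move=> a na; rewrite /f (_ : hgt _ _ _ _ _ _ = 0) ?psi0//.
  rewrite /hgt big1// => k /andP[kU ak]; case/negP: na; exact: inner_drct ak.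
rewrite shadowK_fin -EFinM lee_fin /f /psi /gamma.
case: th S3c {hE f} => S3c.
  exact: (cosh1_integral w10 w20 w30 lam1 lam2 lam3 W01 L1 (@in_famU U) car (chain_family_atoms
    ch)).
apply: (expR_integral w10 w20 w30 lam1 lam2 lam3 W01 L1 (@in_famU U) car (chain_family_atoms ch)
  t01).
by move=> k l; apply: eq_atoms_in; exact: S3c.
Qed.

Lemma sparse_shadow : exists (G : {set K}) (E : K -> set T),
  [/\ forall k, k \in G -> measurable (E k), forall k, k \in G -> E k `<=` rs k,
      forall k l, k \in G -> l \in G -> E k `&` E l !=set0 -> k = l,
      forall k, k \in G -> ((8^-1)%:E * mu (rs k) <= mu (E k))%E &
      (mu (shadowK [set: K]) <= 84%:E * mu (shadowK G))%E /\ carlesonK G (fun=> 1)].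
Proof.
have [G [E [_ spG vG]]] := sparse_selection w10 w20 w30 lam1 lam2 lam3 (@in_famU [set: K]%SET)
  (fun k _ => dvol_gt0 k).
have [Erct Evol Edis] := spG.
have Ein k : k \in G -> forall a, a \in E k -> inner a.
  by move=> kG a /(fintype.subsetP (Erct _ kG)); exact: inner_drct.
exists G, (fun k => cell @^-1` [set` E k]); split.
- by move=> k kG; exact: (measurable_cells mbox).
- by move=> k kG x /= /(fintype.subsetP (Erct _ kG)); rewrite mem_cell => /asboolP.
- move=> k l kG lG [x [/= xk xl]]; apply/eqP; apply: contraT => kl.
  by have /disjointFr/(_ xk) := Edis _ _ kG lG kl; rewrite xl.
- move=> k kG; rewrite (mu_cells mbox boxE mS1 mS2 mS3 fS1 fS2 fS3)//; last exact: Ein.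
  by rewrite dvolE -EFinM lee_fin ler_pdivrMl// Evol.
split; first by rewrite !shadowK_fin -EFinM lee_fin.
move=> S SG; apply: le_trans (carleson_sparse w10 w20 w30 spG SG) _.
by rewrite ler_wpM2r ?meas_ge0// Lambda_ge8.
Qed.

Section weights.
Context (w : nat -> nat -> R).
Hypothesis w_ge0 : forall a b, 0 <= w a b.
Hypothesis w_nincl : forall a a' b, (a <= a')%N -> w a' b <= w a b.
Hypothesis w_nincr : forall a b b', (b <= b')%N -> w a b' <= w a b.
Hypothesis w_diag : forall N, \sum_(i < N.+1) w i (N - i)%N <= 1.
Context (U : {set K}) (q c : K -> K) (s t a b : K -> nat).
Hypothesis q1 : forall k, S1 k `<=` S1 (q k).
Hypothesis q2 : forall k, S2 (q k) = S2 k.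
Hypothesis q3 : forall k, S3 (q k) = S3 k.
Hypothesis c1 : forall k, S1 (c k) = S1 k.
Hypothesis c2 : forall k, S2 k `<=` S2 (c k).
Hypothesis c3 : forall k, S3 (c k) = S3 k.
Hypothesis densq : forall k, k \in U -> (2%:E * mu (rs (q k) `&` shadowK U) <= mu (rs (q k)))%E.
Hypothesis densc : forall k, k \in U -> (2%:E * mu (rs (c k) `&` shadowK U) <= mu (rs (c k)))%E.
Hypothesis ch : chainK U.
Hypothesis s_mono : forall k l, S1 k `<` S1 l -> (s k < s l)%N.
Hypothesis t_mono : forall k l, S2 k `<` S2 l -> (t k < t l)%N.
Hypothesis ha : forall k l, k \in U -> l \in U -> S1 k `&` S1 l !=set0 ->
  (s k + a k < s l)%N -> S1 (q k) `<=` S1 l.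
Hypothesis hb : forall k l, k \in U -> l \in U -> S2 k `&` S2 l !=set0 ->
  (t k + b k < t l)%N -> S2 (c k) `<=` S2 l.

Let dens_atoms k : (2%:E * mu (rs k `&` shadowK U) <= mu (rs k))%E ->
  2 * meas nu (drct k :&: dsh U) <= meas nu (drct k).
Proof.
rewrite (@mu_preim (drct k :&: dsh U)%SET (rs k `&` shadowK U) U); last 2 first.
- by apply/fintype.subsetP => y; rewrite finset.in_setI => /andP[].
- move=> x; rewrite finset.in_setI mem_cell mem_cell_sh; apply/andP/asboolP.
    by move=> [/asboolP ? /asboolP ?].
  by move=> [? ?]; split; apply/asboolP.
by rewrite dvolE -EFinM lee_fin.
Qed.

(** The index set [K] contains the extensions of the members of [U] as well, reached through [q] and
    [c], so that the atoms resolve them too. *)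
Lemma weighted_carlesonK : carlesonK U (fun k => w (a k) (b k)).
Proof.
apply: (@weighted_carleson R _ _ _ w1 w2 w3 w10 w20 w30 fam1 fam2 fam3 lam1 lam2 lam3 K A1 A2 A3
  (fun k => A1 (q k)) (fun k => A2 (c k)) w w_ge0 w_nincl w_nincr w_diag U s t a b (@in_famU U)
  _ _ _ _ _ _ _ _ _ (kappa R) (kappa_gt0 R) (kappa_small R)).
- by move=> k _; apply/imsetP; exists (q k).
- by move=> k _; exact: dvol_gt0.
- by move=> k _; exact/atoms_in_subset.
- by move=> k _; exact/atoms_in_subset.
- move=> k kU; have := dens_atoms (densq kU).
  by rewrite /rct (eq_atoms_in (q2 k)) (eq_atoms_in (q3 k)).
- move=> k kU; have := dens_atoms (densc kU).
  by rewrite /rct (eq_atoms_in (c1 k)) (eq_atoms_in (c3 k)).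
- move=> k l x kU lU kl xk xl; have [h1 h2 h3] := in_drct2 xk xl.
  by case: (ch kU lU kl h1 h2 h3) => -[/s_mono -> /t_mono ->]; rewrite ?orbT.
- move=> k l x kU lU xk xl _; have [h1 h2 h3] := in_drct2 xk xl.
  have [h|h] := leqP (s l) (s k + a k); [by left|right].
  by apply/atoms_in_subset; exact: ha.
- move=> k l x kU lU xk xl _; have [h1 h2 h3] := in_drct2 xk xl.
  have [h|h] := leqP (t l) (t k + b k); [by left|right].
  by apply/atoms_in_subset; exact: hb.
Qed.

End weights.

End finite_family.

(** * Countable families *)

Section exhaustion.
Context (T : choiceType) (U : set T).

Lemma countable_exhaustion : countable U -> exists s : nat -> seq T,
  [/\ forall n, uniq (s n), forall n x, x \in s n -> U x,
      forall n m, (n <= m)%N -> {subset s n <= s m} &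
      forall x, U x -> exists n, x \in s n].
Proof.
move=> /countable_injP[f finj].
have [h hP] : exists h : nat -> option T, forall n x, h n = Some x <-> (U x /\ f x = n).
  pose P n (o : option T) := forall x, o = Some x <-> (U x /\ f x = n).
  suff /choice[h hP] : forall n, exists o, P n o by exists h.
  move=> n; have [[x [Ux fx]]|nx] := pselect (exists x, U x /\ f x = n).
    exists (Some x) => y; split; first by move=> [<-].
    by move=> [Uy fy]; congr Some; apply: finj; rewrite ?inE// fy.
  by exists None => x; split => // Ux; exfalso; apply: nx; exists x.
exists (fun n => pmap h (iota 0 n)); split.
- move=> n; apply: (@pmap_uniq _ _ h f); last exact: iota_uniq.
  by move=> k /=; case hk : (h k) => [x|]//=; have [] := (hP k x).1 hk.
- by move=> n x; rewrite mem_pmap => /mapP[k _ /esym/hP[]].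
- move=> n m nm x; rewrite !mem_pmap => /mapP[k]; rewrite mem_iota => /andP[_ kn] ->.
  by apply/mapP; exists k => //; rewrite mem_iota/= (leq_trans kn).
- move=> x Ux; exists (f x).+1; rewrite mem_pmap; apply/mapP; exists (f x).
    by rewrite mem_iota/= add0n.
  by apply/esym/hP.
Qed.

Context (s : nat -> seq T).
Hypothesis s_uniq : forall n, uniq (s n).
Hypothesis s_sub : forall n x, x \in s n -> U x.
Hypothesis s_homo : forall n m, (n <= m)%N -> {subset s n <= s m}.
Hypothesis s_cover : forall x, U x -> exists n, x \in s n.

Lemma exhaustion_finite (A : set T) : finite_set A -> A `<=` U ->
  exists n, forall x, A x -> x \in s n.
Proof.
move=> /finite_seqP[r ->]; elim: r => [|x r IH] rU; first by exists 0%N.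
have [n hn] := IH (fun y yr => rU y (mem_behead (s := x :: r) yr)).
have [m hm] := s_cover (rU x (mem_head _ _)).
exists (maxn n m) => y /=; rewrite in_cons => /orP[/eqP ->|yr].
  by apply: s_homo hm; exact: leq_maxr.
by apply: (s_homo (leq_maxl n m)); exact: hn.
Qed.

Lemma sum_exhaustion_homo (R : realType) (a : T -> R) : (forall x, 0 <= a x) ->
  {homo (fun n => \sum_(x <- s n) a x) : n m / (n <= m)%N >-> n <= m}.
Proof.
move=> a0 n m nm /=; rewrite [leRHS](perm_big (s n ++ [seq x <- s m | x \notin s n]))/=.
  by rewrite big_cat/= lerDl sumr_ge0.
apply: uniq_perm; first exact: s_uniq.
  rewrite cat_uniq s_uniq filter_uniq ?s_uniq// andbT /=.
  by apply/hasPn => x; rewrite mem_filter => /andP[].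
move=> x; rewrite mem_cat mem_filter; case: (boolP (x \in s n)) => //= xn.
exact: (s_homo nm).
Qed.

Lemma esum_exhaustion (R : realType) (a : T -> R) : (forall x, 0 <= a x) ->
  (\esum_(x in U) (a x)%:E)%E = ereal_sup (range (fun n => (\sum_(x <- s n) a x)%:E)).
Proof.
move=> a0; apply/eqP; rewrite eq_le; apply/andP; split.
  apply: ge_ereal_sup => _ [A [fA AU] <-].
  have [n hn] := exhaustion_finite fA AU.
  apply: (@le_trans _ _ (\sum_(x <- s n) a x)%:E); last by apply: ereal_sup_ubound; exists n.
  rewrite fsbig_finite//= sumEFin lee_fin.
  pose r : seq T := finmap.enum_fset (fset_set A).
  have rA x : (x \in r) = (x \in A) by rewrite -in_fset_set.
  rewrite -/r [leRHS](perm_big (r ++ [seq x <- s n | x \notin r])).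
    by rewrite big_cat/= lerDl sumr_ge0.
  apply: uniq_perm; first exact: s_uniq.
    rewrite cat_uniq filter_uniq ?s_uniq// finmap.fset_uniq andbT /=.
    by apply/hasPn => x; rewrite mem_filter => /andP[].
  move=> x; rewrite mem_cat mem_filter.
  by case: (boolP (x \in r)) => //=; rewrite rA => /set_mem/hn ->.
apply: ge_ereal_sup => _ [n _ <-]; apply: ereal_sup_ubound.
exists [set` s n]; first by split; [exact: finite_seq|move=> x /= /s_sub].
by rewrite -sumEFin [RHS]fsbig_seq ?s_uniq.
Qed.

Lemma esumZl_exhaustion (R : realType) (a : T -> R) (r : R) : (forall x, 0 <= a x) -> 0 <= r ->
  (\esum_(x in U) (r * a x)%:E = r%:E * \esum_(x in U) (a x)%:E)%E.
Proof.
move=> a0 r0; rewrite !esum_exhaustion//; last by move=> x; exact: mulr_ge0.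
rewrite -ereal_supZl//; last first.
  by apply/set0P; exists (\sum_(x <- s 0%N) a x)%:E; exists 0%N.
congr ereal_sup; rewrite image_comp; apply: eq_imagel => n _ /=.
by rewrite -EFinM mulr_sumr.
Qed.

Lemma bigcup_exhaustion X (F : T -> set X) :
  \bigcup_(x in U) F x = \bigcup_n (\bigcup_(x in [set` s n]) F x).
Proof.
apply/seteqP; split => y.
  by move=> [x Ux Fy]; have [n xn] := s_cover Ux; exists n => //; exists x.
by move=> [n _ [x /= /s_sub Ux Fy]]; exists x.
Qed.

Lemma measure_exhaustion_cvg (R : realType) d (X : measurableType d)
    (mu : {measure set X -> \bar R}) (F : T -> set X) :
  (forall x, U x -> measurable (F x)) ->
  (fun n => mu (\bigcup_(x in [set` s n]) F x)) @ \oo --> mu (\bigcup_(x in U) F x).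
Proof.
move=> mF; have mFn n : measurable (\bigcup_(x in [set` s n]) F x).
  by apply: fin_bigcup_measurable => // x /= /s_sub; exact: mF.
rewrite bigcup_exhaustion; apply: nondecreasing_cvg_mu => //.
  exact: bigcup_measurable.
move=> n m nm; apply/subsetPset => y [x /= xn Fy]; exists x => //=.
exact: s_homo nm _ xn.
Qed.

End exhaustion.

(** * The two profiles on the extended reals *)

Section extended_profile.
Context (R : realType).

Lemma cosh1_le (y z : R) : 0 <= y <= z -> cosh1 y <= cosh1 z.
Proof.
move=> /andP[y0 yz]; rewrite /cosh1 lerD2r ler_pM2l ?invr_gt0//.
have e0 := expR_gt0 y; have f0 := expR_gt0 z.
have h1 : expR y <= expR z by rewrite ler_expR.
have h2 : expR (- y - z) <= 1 by rewrite -expR0 ler_expR; lra.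
have e1 : expR (- y) = expR z * expR (- y - z) by rewrite -expRD; congr expR; ring.
have e2 : expR (- z) = expR y * expR (- y - z) by rewrite -expRD; congr expR; ring.
rewrite e1 e2 -subr_ge0.
have -> : expR z + expR y * expR (- y - z) - (expR y + expR z * expR (- y - z)) =
  (expR z - expR y) * (1 - expR (- y - z)) by ring.
by rewrite mulr_ge0// subr_ge0.
Qed.

Lemma psi_le th (g h k : R) : 0 <= g -> 0 <= h <= k -> psi th g h <= psi th g k.
Proof.
move=> g0 /andP[h0 hk]; rewrite /psi; case: th.
  by apply: cosh1_le; rewrite mulr_ge0 ?sqrtr_ge0//= ler_wpM2l// ler_sqrt// (le_trans h0).
by rewrite lerD2r ler_expR ler_wpM2l.
Qed.

Lemma cosh1_le_psi th (g h : R) : 0 <= g -> 1 <= h -> cosh1 g <= psi th g h.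
Proof.
move=> g0 h1; apply: (@le_trans _ _ (psi th g 1)); last by apply: psi_le; rewrite ?ler01.
by rewrite /psi; case: th; rewrite ?sqrtr1 mulr1// cosh1_le_expR.
Qed.

Lemma psi_unbounded th (g M : R) : 0 < g -> exists2 h, 0 <= h & M <= psi th g h.
Proof.
move=> g0; pose y := 2 * `|M| + 2.
have y0 : 0 <= y by rewrite addr_ge0// mulr_ge0.
have My : 2 * M + 2 <= y by rewrite lerD2r ler_pM2l// ler_norm.
exists (if th then (y / g) ^+ 2 else y / g).
  by case: th; rewrite ?sqr_ge0// divr_ge0// ltW.
rewrite /psi; case: th.
  rewrite sqrtr_sqr ger0_norm ?divr_ge0 ?(ltW g0)// mulrC divfK ?gt_eqF//.
  have := @expR_ge1Dx R y; have := expR_ge0 (- y); rewrite /cosh1; lra.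
rewrite mulrC divfK ?gt_eqF//; have := @expR_ge1Dx R y.
have := ler_norm M; have := normr_ge0 M; rewrite {1}/y; lra.
Qed.

Lemma psi_continuous th (g : R) : continuous (psi th g).
Proof.
move=> h; rewrite /psi; case: th.
  have c : {for h, continuous (fun h => g * Num.sqrt h)}.
    by apply: cvgM; [exact: cvg_cst|exact: sqrt_continuous].
  rewrite /cosh1; apply: cvgB; last exact: cvg_cst.
  apply: cvgM; first exact: cvg_cst.
  apply: cvgD; first by apply: continuous_cvg => //; exact: continuous_expR.
  by apply: continuous_cvg; [exact: continuous_expR|exact: cvgN].
apply: cvgB; last exact: cvg_cst.
by apply: continuous_cvg; [exact: continuous_expR|apply: cvgM; [exact: cvg_cst|exact: cvg_id]].
Qed.

Definition psie th (g : R) (h : \bar R) : \bar R :=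
  (if th then coshe (g%:E * sqrte h) - 1 else expeR (g%:E * h) - 1)%E.

Lemma psie_fin th (g h : R) : psie th g h%:E = (psi th g h)%:E.
Proof. by rewrite /psie /psi; case: th. Qed.

Lemma psie_pinfty th (g : R) : 0 < g -> psie th g +oo%E = +oo%E.
Proof.
by move=> g0; rewrite /psie; case: th; rewrite /= gt0_muley ?lte_fin// /coshe/= gt0_muley// lte_fin
  invr_gt0.
Qed.

(** The weighted height may a priori be infinite at some points. There the limit is found from
    [psi_unbounded], elsewhere from continuity; monotone convergence can then be applied. *)
Lemma psie_limit th (g : R) (H : nat -> R) : 0 < g -> (forall n, 0 <= H n) ->
  {homo H : n m / (n <= m)%N >-> n <= m} ->
  limn (fun n => (psi th g (H n))%:E) = psie th g (ereal_sup (range (fun n => (H n)%:E))).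
Proof.
move=> g0 H0 ndH; apply/cvg_lim => //.
have He : (fun n => (H n)%:E) @ \oo --> ereal_sup (range (fun n => (H n)%:E)).
  by apply: ereal_nondecreasing_cvgn => n m nm; rewrite lee_fin ndH.
move: He; set h := ereal_sup _ => He.
have h0 : (0 <= h)%E.
  by apply: (@le_trans _ _ (H 0%N)%:E); [rewrite lee_fin|apply: ereal_sup_ubound; exists 0%N].
case: h h0 He => [r _ He|_ He|//].
  rewrite psie_fin; apply: cvg_EFin; first exact: nearW.
  apply: (@continuous_cvg _ _ _ _ _ H (psi th g)); first exact: psi_continuous.
  exact: (fine_cvg He).
rewrite psie_pinfty//; apply/cvgeyPge => M.
have [k k0 Mk] := psi_unbounded th M g0.
move/cvgeyPge: He => /(_ k); apply: filterS => n; rewrite !lee_fin => kH.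
by apply: (le_trans Mk); apply: psi_le; rewrite ?(ltW g0) ?k0.
Qed.

End extended_profile.

(** * Systems of rectangles *)

Section rectangle_system.
Context (R : realType) d (T : measurableType d) (mu : {measure set T -> \bar R}).
Context d1 (V1 : measurableType d1) (m1 : {measure set V1 -> \bar R}).
Context d2 (V2 : measurableType d2) (m2 : {measure set V2 -> \bar R}).
Context d3 (V3 : measurableType d3) (m3 : {measure set V3 -> \bar R}).
Context (p1 : T -> V1) (p2 : T -> V2) (p3 : T -> V3).
Local Notation boxset := (boxset p1 p2 p3).
Hypothesis mbox : forall B1 B2 B3, measurable B1 -> measurable B2 -> measurable B3 ->
  measurable (boxset B1 B2 B3).
Hypothesis boxE : forall B1 B2 B3, measurable B1 -> measurable B2 -> measurable B3 ->
  (m1 B1 < +oo -> m2 B2 < +oo -> m3 B3 < +oo ->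
   mu (boxset B1 B2 B3) = m1 B1 * m2 B2 * m3 B3)%E.
Context (Rc : choiceType) (rset : Rc -> set T).
Context (S1 : Rc -> set V1) (S2 : Rc -> set V2) (S3 : Rc -> set V3).
Hypothesis rsetE : forall I, rset I = boxset (S1 I) (S2 I) (S3 I).
Context (F : set Rc).
Hypothesis mS1 : forall I, F I -> measurable (S1 I).
Hypothesis mS2 : forall I, F I -> measurable (S2 I).
Hypothesis mS3 : forall I, F I -> measurable (S3 I).
Hypothesis fS1 : forall I, F I -> (m1 (S1 I) < +oo)%E.
Hypothesis fS2 : forall I, F I -> (m2 (S2 I) < +oo)%E.
Hypothesis fS3 : forall I, F I -> (m3 (S3 I) < +oo)%E.
Hypothesis lS1 : forall I J, F I -> F J -> S1 I `&` S1 J !=set0 -> S1 I `<=` S1 J \/ S1 J `<=` S1 I.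
Hypothesis lS2 : forall I J, F I -> F J -> S2 I `&` S2 J !=set0 -> S2 I `<=` S2 J \/ S2 J `<=` S2 I.
Hypothesis lS3 : forall I J, F I -> F J -> S3 I `&` S3 J !=set0 -> S3 I `<=` S3 J \/ S3 J `<=` S3 I.
Hypothesis rset_gt0 : forall I, F I -> (0 < mu (rset I))%E.
Hypothesis countF : countable F.

Lemma measurable_rset I : F I -> measurable (rset I).
Proof. by move=> FI; rewrite rsetE; apply: mbox; [exact: mS1|exact: mS2|exact: mS3]. Qed.

Lemma rset_fin I : F I -> (mu (rset I) < +oo)%E.
Proof.
move=> FI; have h1 := fS1 FI; have h2 := fS2 FI; have h3 := fS3 FI.
rewrite rsetE boxE//; [|exact: mS1|exact: mS2|exact: mS3].
by rewrite -ge0_fin_numE ?mule_ge0// !fin_numM// ge0_fin_numE.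
Qed.

Lemma weak_type_seq (s : seq Rc) (Om : set T) : measurable Om -> (mu Om < +oo)%E ->
  (forall I, I \in s -> F I /\ (mu (rset I) <= 2%:E * mu (rset I `&` Om))%E) ->
  (mu (\bigcup_(I in [set` s]) rset I) <= 256%:E * mu Om)%E.
Proof.
move=> mOm fOm hs; pose e := tnth (in_tuple s).
have Fe k : F (e k) by apply: (hs _ _).1; exact: mem_tnth.
have := @weak_type_shadow _ _ _ mu _ _ m1 _ _ m2 _ _ m3 p1 p2 p3 mbox boxE 'I_(size s)
  (S1 \o e) (S2 \o e) (S3 \o e) _ _ _ _ _ _ _ _ _ _ Om mOm fOm _.
have -> : shadowK p1 p2 p3 (S1 \o e) (S2 \o e) (S3 \o e) [set: 'I_(size s)] =
    \bigcup_(I in [set` s]) rset I.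
  apply/seteqP; split => x.
    by move=> [k _ xk]; exists (e k); [exact: mem_tnth|rewrite rsetE].
  by move=> [_ /= /(tnthP (in_tuple s))[k ->]]; rewrite rsetE => xk; exists k => //=; rewrite inE.
apply => k /=.
- exact/mS1/Fe.
- exact/mS2/Fe.
- exact/mS3/Fe.
- exact/fS1/Fe.
- exact/fS2/Fe.
- exact/fS3/Fe.
- by move=> l; apply: lS1; exact: Fe.
- by move=> l; apply: lS2; exact: Fe.
- by move=> l; apply: lS3; exact: Fe.
- by rewrite -rsetE rset_gt0.
- by rewrite -rsetE; apply: (hs _ _).2; exact: mem_tnth.
Qed.

Lemma measurable_weighted_sum (W : Rc -> R) (s : seq Rc) : (forall I, I \in s -> F I) ->
  measurable_fun setT (fun x => \sum_(I <- s) W I * \1_(rset I) x).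
Proof.
move=> sF; under eq_fun do rewrite big_tnth; apply: measurable_sum => k.
apply: measurable_funM => //; apply: measurable_indic; apply: measurable_rset.
by apply: sF; exact: mem_tnth.
Qed.

Section enlarged.
Context (B : set Rc) (Om : set T).
Hypothesis BF : B `<=` F.
Hypothesis mOm : measurable Om.
Hypothesis fOm : (mu Om < +oo)%E.

Lemma average_indicE I : F I ->
  (\int[mu]_(y in rset I) `|(\1_Om y)%:E| = mu (rset I `&` Om))%E.
Proof.
move=> FI; rewrite setIC -integral_indic//; last exact: measurable_rset.
by apply: eq_integral => x _; rewrite abse_EFin ger0_norm.
Qed.

Let ratio I : F I -> exists r n : R, [/\ 0 < r, mu (rset I) = r%:E,
  mu (rset I `&` Om) = n%:E &
  ((\int[mu]_(y in rset I) `|(\1_Om y)%:E|) / mu (rset I) = (n / r)%:E)%E].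
Proof.
move=> FI; have r0 := rset_gt0 FI; have rf := rset_fin FI.
have rE : mu (rset I) = (fine (mu (rset I)))%:E by rewrite fineK// ge0_fin_numE.
have nE : mu (rset I `&` Om) = (fine (mu (rset I `&` Om)))%:E.
  rewrite fineK// ge0_fin_numE//; apply: le_lt_trans rf; apply: le_measure; rewrite ?inE//.
    by apply: measurableI => //; exact: measurable_rset.
  exact: measurable_rset.
have r0' : 0 < fine (mu (rset I)) by rewrite -lte_fin -rE.
exists (fine (mu (rset I))), (fine (mu (rset I `&` Om))); split => //.
by rewrite average_indicE// rE nE inver gt_eqF// EFinM.
Qed.

Local Notation Om' := (enlargement mu rset B Om).

(** At a point of I outside the enlargement, the maximal function bounds the average over I by 1/2.
    Applied to the first extensions that leave the enlargement, this gives the hypotheses [densQ]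
    and [densC] of the Carleson condition. *)
Lemma density_of_not_enlarged I : B I -> ~ (rset I `<=` Om') ->
  (2%:E * mu (rset I `&` Om) <= mu (rset I))%E.
Proof.
move=> BI nI; have [r [n [r0 rE nE avE]]] := ratio (BF BI).
have [x [Ix nx]] : exists x, rset I x /\ ~ Om' x.
  by apply: contra_notP nI => h x Ix; apply: contrapT => nx; apply: h; exists x.
have : ((n / r)%:E <= (2^-1)%:E)%E.
  apply: (@le_trans _ _ (maximal mu rset B \1_Om x)); last by rewrite leNgt; exact/negP.
  by rewrite -avE; apply: ereal_sup_ubound; exists I.
by rewrite lee_fin ler_pdivrMr// nE rE -EFinM lee_fin; lra.
Qed.

Lemma enlarged_dense x : Om' x -> exists I, [/\ B I, rset I x &
  (mu (rset I) <= 2%:E * mu (rset I `&` Om))%E].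
Proof.
move=> /ereal_sup_gt[_ [I [BI Ix] <-]]; have [r [n [r0 rE nE ->]]] := ratio (BF BI).
rewrite lte_fin ltr_pdivlMr// => h; exists I; split => //.
by rewrite rE nE -EFinM lee_fin; lra.
Qed.

Lemma sub_enlarged I : B I -> rset I `<=` Om -> rset I `<=` Om'.
Proof.
move=> BI IOm x Ix; have [r [n [r0 rE nE avE]]] := ratio (BF BI).
rewrite /enlargement/=; apply: (@lt_le_trans _ _ (n / r)%:E).
  have -> : n = r by apply: EFin_inj; rewrite -nE -rE (setIidl IOm).
  by rewrite divff ?gt_eqF// lte_fin invf_lt1// ltr1n.
by rewrite -avE; apply: ereal_sup_ubound; exists I.
Qed.

(** The enlargement is covered by the countably many members of [B] in which [Om] has density at
    least 1/2. The weak-type bound for finite parts of this family passes to its union. *)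
Lemma enlarged_bound I : B I -> rset I `<=` Om' -> (mu (rset I) <= 256%:E * mu Om)%E.
Proof.
move=> BI IOm; pose D := [set J | B J /\ (mu (rset J) <= 2%:E * mu (rset J `&` Om))%E].
have DF : D `<=` F by move=> J [/BF].
have cD : countable D by apply: sub_countable countF; exact: subset_card_le.
have [s [su sD sh sc]] := countable_exhaustion cD.
have mD J : D J -> measurable (rset J) by move=> /DF; exact: measurable_rset.
have cvgD := @measure_exhaustion_cvg _ _ s sD sh sc _ _ _ mu rset mD.
have bD : (mu (\bigcup_(J in D) rset J) <= 256%:E * mu Om)%E.
  rewrite -(cvg_lim _ cvgD)//; apply: lime_le; first by apply/cvg_ex; eexists; exact: cvgD.
  apply: nearW => n; apply: weak_type_seq => // J /sD [BJ dJ]; split => //; exact: BF.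
apply: le_trans bD; apply: le_measure; rewrite ?inE.
- exact/measurable_rset/BF.
- rewrite (bigcup_exhaustion sD sc); apply: bigcup_measurable => n _.
  by apply: fin_bigcup_measurable => // J /= /sD; exact: mD.
- by move=> x /IOm/enlarged_dense[J [BJ Jx dJ]]; exists J.
Qed.

Lemma max_extensionP (anc : nat -> Rc) : (forall k, B (anc k)) -> rset (anc 0%N) `<=` Om ->
  (forall M : R, exists k0, forall k, (k0 <= k)%N -> (M%:E < mu (rset (anc k)))%E) ->
  ~ (rset (anc (max_extension rset anc Om').+1) `<=` Om').
Proof.
move=> Banc anc0 unb; set P := [set k | rset (anc k) `<=` Om' /\
  forall m, rset (anc m) `<=` Om' -> (m <= k)%N].
have fOmE : mu Om = (fine (mu Om))%:E by rewrite fineK// ge0_fin_numE.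
have [k0 hk0] := unb (256 * fine (mu Om)).
have bnd m : rset (anc m) `<=` Om' -> (m <= k0)%N.
  move=> h; rewrite leqNgt; apply/negP => /ltnW/hk0.
  by rewrite EFinM -fOmE ltNge (enlarged_bound (Banc m) h).
have [k Pk] : exists k, P k.
  pose p := fun m => `[< rset (anc m) `<=` Om' >].
  have exp : exists m, p m by exists 0%N; apply/asboolP; exact: sub_enlarged.
  have bp m : p m -> (m <= k0)%N by move=> /asboolP/bnd.
  case: (ex_maxnP exp bp) => k /asboolP pk maxk; exists k; split => // m h.
  by apply: maxk; apply/asboolP.
have [] : P (max_extension rset anc Om') by apply: xgetPex; exists k.
by move=> _ h /h; rewrite ltnn.
Qed.

End enlarged.

Section chained_family.
Context (U : set Rc).
Hypothesis UF : U `<=` F.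
Hypothesis chU : forall I J, U I -> U J -> I <> J ->
  S1 I `&` S1 J !=set0 -> S2 I `&` S2 J !=set0 -> S3 I `&` S3 J !=set0 ->
  (S1 I `<` S1 J /\ S2 J `<` S2 I) \/ (S1 J `<` S1 I /\ S2 I `<` S2 J).
Context (th : bool).
Hypothesis S3_cst : ~~ th -> forall I J, S3 I = S3 J.

Lemma sparse_seq (s : seq Rc) : uniq s -> (forall I, I \in s -> U I) ->
  exists G : seq Rc, [/\ uniq G, {subset G <= s}, sparse mu rset 8^-1 [set` G],
    (mu (\bigcup_(I in [set` s]) rset I) <= 84%:E * mu (\bigcup_(I in [set` G]) rset I))%E &
    (\int[mu]_x (psi th (gamma R) (\sum_(I <- G) \1_(rset I) x))%:E <=
     mu (\bigcup_(I in [set` G]) rset I))%E].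
Proof.
move=> us sU; pose e := tnth (in_tuple s).
have Ue k : U (e k) by apply: sU; exact: mem_tnth.
have Fe k : F (e k) by exact/UF/Ue.
have einj : injective e by move=> k l; apply/tuple_uniqP.
have m1e k : measurable (S1 (e k)) by exact/mS1/Fe.
have m2e k : measurable (S2 (e k)) by exact/mS2/Fe.
have m3e k : measurable (S3 (e k)) by exact/mS3/Fe.
have f1e k : (m1 (S1 (e k)) < +oo)%E by exact/fS1/Fe.
have f2e k : (m2 (S2 (e k)) < +oo)%E by exact/fS2/Fe.
have f3e k : (m3 (S3 (e k)) < +oo)%E by exact/fS3/Fe.
have l1e k l := lS1 (Fe k) (Fe l).
have l2e k l := lS2 (Fe k) (Fe l).
have l3e k l := lS3 (Fe k) (Fe l).
have r0e k : (0 < mu (boxset (S1 (e k)) (S2 (e k)) (S3 (e k))))%E.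
  by rewrite -rsetE; exact/rset_gt0/Fe.
have shE (A : {set 'I_(size s)}) : shadowK p1 p2 p3 (S1 \o e) (S2 \o e) (S3 \o e) A =
    \bigcup_(I in [set` [seq e k | k <- enum A]]) rset I.
  apply/seteqP; split => x.
    move=> [k /= kA xk]; exists (e k); last by rewrite rsetE.
    by apply: map_f; rewrite mem_enum.
  by move=> [_ /= /mapP[k + ->]]; rewrite mem_enum rsetE => kA xk; exists k.
have [G [E [mE Ers Edis Evol [Gs carG]]]] :=
  @sparse_shadow _ _ _ mu _ _ m1 _ _ m2 _ _ m3 p1 p2 p3 mbox boxE 'I_(size s)
  (S1 \o e) (S2 \o e) (S3 \o e) m1e m2e m3e f1e f2e f3e l1e l2e l3e r0e.
pose Gs' := [seq e k | k <- enum G].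
have chG : chainK (S1 \o e) (S2 \o e) (S3 \o e) G.
  by move=> k l _ _ kl; apply: chU => // /einj/eqP; rewrite (negPf kl).
have inGs' k : (e k \in Gs') = (k \in G) by rewrite mem_map// mem_enum.
have Gs'P I : I \in Gs' -> exists2 k, k \in G & I = e k.
  by move=> /mapP[k]; rewrite mem_enum => kG ->; exists k.
exists Gs'; split.
- by rewrite map_inj_uniq// enum_uniq.
- by move=> I /Gs'P[k _ ->]; exact: mem_tnth.
(* The sets E are indexed by positions in [s]. As [e] is injective, the union over the positions of
   a code has only one term. *)
- pose ix I : set T := \bigcup_(k in [set k | k \in G /\ e k = I]) E k.
  have ixE k : k \in G -> ix (e k) = E k.
    move=> kG; apply/seteqP; split => x; last by move=> xk; exists k.
    by move=> [l /= [_ /einj ->]].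
  exists ix; split.
  + by move=> _ /Gs'P[k kG ->]; rewrite ixE//; exact: mE.
  + by move=> _ /Gs'P[k kG ->]; rewrite ixE// rsetE; exact: Ers.
  + move=> _ _ /Gs'P[k kG ->] /Gs'P[l lG ->]; rewrite !ixE// => kl.
    by congr e; exact: Edis.
  + by move=> _ /Gs'P[k kG ->]; rewrite ixE// rsetE; exact: Evol.
- move: Gs; rewrite !shE; congr (mu _ <= _)%E; congr (bigcup _ _).
  by apply/seteqP; split => I /=; [move=> /mapP[k _ ->]; exact: mem_tnth|
    move=> /(tnthP (in_tuple s))[k ->]; apply: map_f; rewrite mem_enum finset.inE].
have W01 : forall k : 'I_(size s), 0 <= (1 : R) <= 1 by rewrite ler01 lexx.
have S3c : ~~ th -> forall k l, (S3 \o e) k = (S3 \o e) l by move=> h k l; exact: S3_cst.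
have t01 : 0 <= (1 : R) <= 1 by rewrite ler01 lexx.
have := @psi_integral _ _ _ mu _ _ m1 _ _ m2 _ _ m3 p1 p2 p3 mbox boxE 'I_(size s)
  (S1 \o e) (S2 \o e) (S3 \o e) m1e m2e m3e f1e f2e f3e l1e l2e l3e th G (fun=> 1) 1
  W01 carG chG S3c t01.
rewrite [in X in _ -> X](_ : \bigcup_(I in [set` Gs']) rset I =
  shadowK p1 p2 p3 (S1 \o e) (S2 \o e) (S3 \o e) G); last by rewrite shE.
rewrite mul1e mul1r; apply: le_trans; rewrite le_eqVlt; apply/orP; left; apply/eqP.
apply: eq_integral => x _.
congr (psi _ _ _)%:E; rewrite big_map big_enum; apply: eq_bigr => k _.
by rewrite mul1r rsetE.
Qed.

Section weighted_family.
Context (B : set Rc) (Om : set T).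
Hypothesis BF : B `<=` F.
Hypothesis mOm : measurable Om.
Hypothesis fOm : (mu Om < +oo)%E.
Hypothesis UOm : forall I, U I -> rset I `<=` Om.
Context (ext1 ext2 : nat -> Rc -> Rc).
Hypothesis Bext1 : forall k I, U I -> B (ext1 k I).
Hypothesis Bext2 : forall k I, U I -> B (ext2 k I).
Hypothesis ext11 : forall k I, U I -> S1 I `<=` S1 (ext1 k I).
Hypothesis ext12 : forall k I, S2 (ext1 k I) = S2 I.
Hypothesis ext13 : forall k I, S3 (ext1 k I) = S3 I.
Hypothesis ext21 : forall k I, S1 (ext2 k I) = S1 I.
Hypothesis ext22 : forall k I, U I -> S2 I `<=` S2 (ext2 k I).
Hypothesis ext23 : forall k I, S3 (ext2 k I) = S3 I.
Hypothesis ext10 : forall I, U I -> rset (ext1 0%N I) = rset I.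
Hypothesis ext20 : forall I, U I -> rset (ext2 0%N I) = rset I.
Hypothesis ext1_unb : forall I, U I -> forall M : R,
  exists k0, forall k, (k0 <= k)%N -> (M%:E < mu (rset (ext1 k I)))%E.
Hypothesis ext2_unb : forall I, U I -> forall M : R,
  exists k0, forall k, (k0 <= k)%N -> (M%:E < mu (rset (ext2 k I)))%E.
Context (s1 s2 : Rc -> int).
Hypothesis s1_mono : forall I J, F I -> F J -> S1 I `<` S1 J -> s1 I < s1 J.
Hypothesis s2_mono : forall I J, F I -> F J -> S2 I `<` S2 J -> s2 I < s2 J.
Hypothesis s1_ext : forall k I J, U I -> U J -> S1 I `&` S1 J !=set0 ->
  s1 I + k%:Z <= s1 J -> S1 (ext1 k I) `<=` S1 J.
Hypothesis s2_ext : forall k I J, U I -> U J -> S2 I `&` S2 J !=set0 ->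
  s2 I + k%:Z <= s2 J -> S2 (ext2 k I) `<=` S2 J.
Context (w : nat -> nat -> R).
Hypothesis w_ge0 : forall a b, 0 <= w a b.
Hypothesis w_nincl : forall a a' b, (a <= a')%N -> w a' b <= w a b.
Hypothesis w_nincr : forall a b b', (b <= b')%N -> w a b' <= w a b.
Hypothesis w_diag : forall N, \sum_(i < N.+1) w i (N - i)%N <= 1.

Local Notation Om' := (enlargement mu rset B Om).
Local Notation e1 I := (max_extension rset (fun k => ext1 k I) Om').
Local Notation e2 I := (max_extension rset (fun k => ext2 k I) Om').

Let w_le1 a b : w a b <= 1.
Proof.
apply: le_trans (w_diag (a + b)); have ab : (a < (a + b).+1)%N by rewrite ltnS leq_addr.
by rewrite (bigD1 (Ordinal ab))//= addKn lerDl sumr_ge0.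
Qed.

Let not_enlarged1 I : U I -> ~ (rset (ext1 (e1 I).+1 I) `<=` Om').
Proof.
move=> UI; apply: (max_extensionP BF mOm fOm (anc := fun k => ext1 k I)) => //.
- by move=> k; exact: Bext1.
- by rewrite ext10//; exact: UOm.
- exact: ext1_unb.
Qed.

Let not_enlarged2 I : U I -> ~ (rset (ext2 (e2 I).+1 I) `<=` Om').
Proof.
move=> UI; apply: (max_extensionP BF mOm fOm (anc := fun k => ext2 k I)) => //.
- by move=> k; exact: Bext2.
- by rewrite ext20//; exact: UOm.
- exact: ext2_unb.
Qed.

Lemma weighted_seq (s : seq Rc) (t : R) : uniq s -> (forall I, I \in s -> U I) ->
  0 <= t <= 1 ->
  (\int[mu]_x (psi th (t * gamma R)
     (\sum_(I <- s) w (e1 I) (e2 I) * \1_(rset I) x))%:E <=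
   t%:E * mu (\bigcup_(I in [set` s]) rset I))%E.
Proof.
move=> us sU t01; pose u := tnth (in_tuple s).
have Uu i : U (u i) by apply: sU; exact: mem_tnth.
have uinj : injective u by move=> k l; apply/tuple_uniqP.
(* The member [i] of [s], its first and its second extension which leave the enlargement. *)
pose K : finType := ('I_(size s) * 'I_3)%type.
pose k1 : 'I_3 := Ordinal (isT : (1 < 3)%N).
pose k2 : 'I_3 := Ordinal (isT : (2 < 3)%N).
pose e (k : K) := if k.2 == ord0 then u k.1 else
  if k.2 == k1 then ext1 (e1 (u k.1)).+1 (u k.1) else ext2 (e2 (u k.1)).+1 (u k.1).
have Fe k : F (e k).
  rewrite /e; case: ifP => _; first exact/UF/Uu.
  by case: ifP => _; apply: BF; [exact: Bext1|exact: Bext2].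
have m1e k : measurable (S1 (e k)) by exact/mS1/Fe.
have m2e k : measurable (S2 (e k)) by exact/mS2/Fe.
have m3e k : measurable (S3 (e k)) by exact/mS3/Fe.
have f1e k : (m1 (S1 (e k)) < +oo)%E by exact/fS1/Fe.
have f2e k : (m2 (S2 (e k)) < +oo)%E by exact/fS2/Fe.
have f3e k : (m3 (S3 (e k)) < +oo)%E by exact/fS3/Fe.
have l1e k l := lS1 (Fe k) (Fe l).
have l2e k l := lS2 (Fe k) (Fe l).
have l3e k l := lS3 (Fe k) (Fe l).
have r0e k : (0 < mu (boxset (S1 (e k)) (S2 (e k)) (S3 (e k))))%E.
  by rewrite -rsetE; exact/rset_gt0/Fe.
pose U0 := [set k : K | k.2 == ord0]%SET.
have U0P k : k \in U0 -> exists i, k = (i, ord0).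
  by case: k => i j; rewrite finset.inE /= => /eqP ->; exists i.
pose q (k : K) : K := if k.2 == ord0 then (k.1, k1) else k.
pose c (k : K) : K := if k.2 == ord0 then (k.1, k2) else k.
have shE : shadowK p1 p2 p3 (S1 \o e) (S2 \o e) (S3 \o e) U0 =
    \bigcup_(I in [set` s]) rset I.
  apply/seteqP; split => x.
    by move=> [k /= /U0P[i ->] xk]; exists (u i); [exact: mem_tnth|rewrite rsetE].
  move=> [_ /= /(tnthP (in_tuple s))[i ->]]; rewrite rsetE => xi.
  by exists (i, ord0) => //=; rewrite finset.inE.
have shOm : \bigcup_(I in [set` s]) rset I `<=` Om.
  by move=> x [I /= /sU UI]; exact: UOm.
(* The extensions refer to the whole of [Om]; their density bound is inherited by the smaller shadow
   of [s]. *)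
have dens I : B I -> ~ (rset I `<=` Om') ->
    (2%:E * mu (rset I `&` \bigcup_(I in [set` s]) rset I) <= mu (rset I))%E.
  move=> BI nI; apply: le_trans (density_of_not_enlarged BF mOm BI nI).
  have mI := measurable_rset (BF BI).
  rewrite lee_pmul2l//; apply: le_measure; rewrite ?inE//.
  - apply: measurableI => //; apply: fin_bigcup_measurable => // J /= /sU UJ.
    exact/measurable_rset/UF.
  - exact: measurableI.
  - by apply: setIS.
have S3c : ~~ th -> forall k l, (S3 \o e) k = (S3 \o e) l by move=> h k l; exact: S3_cst.
have chU0 : chainK (S1 \o e) (S2 \o e) (S3 \o e) U0.
  move=> _ _ /U0P[i ->] /U0P[j ->] ij; apply: chU => //; try exact: Uu.
  by move=> /uinj/= h; case/eqP: ij; rewrite h.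
(* Exponents of cubes may be negative. Adding the constant [M] makes those in question natural
   numbers and keeps all comparisons. *)
have scale (f : Rc -> int) : exists g : K -> nat, forall k l (n : nat),
    (g k + n <= g l)%N = (f (e k) + n%:Z <= f (e l)).
  pose M := \sum_k `|f (e k)|.
  have M0 k : 0 <= f (e k) + M.
    have : `|f (e k)| <= M by rewrite /M (bigD1 k)//= lerDl sumr_ge0.
    by rewrite -lerBlDl sub0r; apply: le_trans; rewrite -normrN ler_norm.
  exists (fun k => absz (f (e k) + M)) => k l n.
  by rewrite -lez_nat PoszD !gez0_abs// addrAC lerD2r.
have [g1 g1E] := scale s1; have [g2 g2E] := scale s2.
have car : carlesonK m1 m2 m3 (S1 \o e) (S2 \o e) (S3 \o e) U0
    (fun k => w (e1 (u k.1)) (e2 (u k.1))).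
  apply: (@weighted_carlesonK _ _ _ mu _ _ m1 _ _ m2 _ _ m3 p1 p2 p3 mbox boxE K
    (S1 \o e) (S2 \o e) (S3 \o e) m1e m2e m3e f1e f2e f3e l1e l2e l3e r0e w w_ge0 w_nincl
    w_nincr w_diag U0 q c g1 g2 (fun k => e1 (u k.1)) (fun k => e2 (u k.1))).
  - by move=> k; rewrite /= /q; case: ifP => k0; [rewrite /e k0 /=;
    exact: ext11|exact: subset_refl].
  - by move=> k; rewrite /= /q; case: ifP => // k0; rewrite /e k0 /=; exact: ext12.
  - by move=> k; rewrite /= /q; case: ifP => // k0; rewrite /e k0 /=; exact: ext13.
  - by move=> k; rewrite /= /c; case: ifP => // k0; rewrite /e k0 /=; exact: ext21.
  - by move=> k; rewrite /= /c; case: ifP => k0; [rewrite /e k0 /=;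
    exact: ext22|exact: subset_refl].
  - by move=> k; rewrite /= /c; case: ifP => // k0; rewrite /e k0 /=; exact: ext23.
  - move=> _ /U0P[i ->]; rewrite shE /= -!rsetE; apply: dens; first exact: Bext1.
    exact: not_enlarged1.
  - move=> _ /U0P[i ->]; rewrite shE /= -!rsetE; apply: dens; first exact: Bext2.
    exact: not_enlarged2.
  - exact: chU0.
  - move=> k l /= kl; have := s1_mono (Fe k) (Fe l) kl.
    by rewrite -addn1 g1E lezD1.
  - move=> k l /= kl; have := s2_mono (Fe k) (Fe l) kl.
    by rewrite -addn1 g2E lezD1.
  - move=> _ _ /U0P[i ->] /U0P[j ->] /= ij; rewrite -addnS g1E => h.
    by apply: s1_ext; rewrite //; exact: Uu.
  - move=> _ _ /U0P[i ->] /U0P[j ->] /= ij; rewrite -addnS g2E => h.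
    by apply: s2_ext; rewrite //; exact: Uu.
have W01 (k : K) : 0 <= w (e1 (u k.1)) (e2 (u k.1)) <= 1 by rewrite w_ge0 w_le1.
have := @psi_integral _ _ _ mu _ _ m1 _ _ m2 _ _ m3 p1 p2 p3 mbox boxE K
  (S1 \o e) (S2 \o e) (S3 \o e) m1e m2e m3e f1e f2e f3e l1e l2e l3e th U0
  (fun k => w (e1 (u k.1)) (e2 (u k.1))) t W01 car chU0 S3c t01.
rewrite [in X in _ -> X](_ : \bigcup_(I in [set` s]) rset I =
  shadowK p1 p2 p3 (S1 \o e) (S2 \o e) (S3 \o e) U0); last by rewrite shE.
apply: le_trans; rewrite le_eqVlt; apply/orP; left; apply/eqP.
apply: eq_integral => x _; congr (psi _ _ _)%:E; rewrite [LHS](big_tnth _ _ s).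
rewrite [RHS](reindex_onto (fun i => (i, ord0)) fst)/=; last first.
  by move=> _ /U0P[i ->].
apply: eq_big => [i|i _]; first by rewrite finset.inE !eqxx.
by rewrite -rsetE.
Qed.

Lemma weighted_integral (t : R) : 0 < t <= 1 ->
  (\int[mu]_x (psie th (t * gamma R)
     (weighted_height rset (fun I => w (e1 I) (e2 I)) U x)) <=
   t%:E * mu (shadow rset U))%E.
Proof.
move=> /andP[t0 t1]; have tg0 : 0 < t * gamma R by rewrite mulr_gt0// gamma_gt0.
have cU : countable U by apply: sub_countable countF; exact: subset_card_le.
have [s [su sU sh sc]] := countable_exhaustion cU.
pose H n x := \sum_(I <- s n) w (e1 I) (e2 I) * \1_(rset I) x.
have H0 n x : 0 <= H n x by apply: sumr_ge0 => I _; rewrite mulr_ge0.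
have ndH x : {homo H ^~ x : n m / (n <= m)%N >-> n <= m}.
  by apply: sum_exhaustion_homo => // I; rewrite mulr_ge0.
have nd x : {homo (fun n => (psi th (t * gamma R) (H n x))%:E) : n m / (n <= m)%N >-> (n <= m)%E}.
  by move=> n m nm; rewrite lee_fin psi_le ?(ltW tg0) ?H0 ?ndH.
rewrite (eq_integral (fun x => limn (fun n => (psi th (t * gamma R) (H n x))%:E))); last first.
  move=> x _; rewrite psie_limit//; congr psie.
  by rewrite -(esum_exhaustion su sU sh sc)// => I; rewrite mulr_ge0.
rewrite monotone_convergence//; last 2 first.
- move=> n; apply/measurable_EFinP; apply: (measurableT_comp (f := psi th _)).
    by apply: continuous_measurable_fun; exact: psi_continuous.
  by apply: measurable_weighted_sum => I /sU; exact: UF.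
- by move=> n x _; rewrite lee_fin psi_ge0 ?(ltW tg0).
apply: lime_le.
  apply: ereal_nondecreasing_is_cvgn => n m nm; apply: ge0_le_integral => //.
  - by move=> x _; rewrite lee_fin psi_ge0 ?(ltW tg0).
  - apply/measurable_EFinP; apply: (measurableT_comp (f := psi th _)).
      by apply: continuous_measurable_fun; exact: psi_continuous.
    by apply: measurable_weighted_sum => I /sU; exact: UF.
  - apply/measurable_EFinP; apply: (measurableT_comp (f := psi th _)).
      by apply: continuous_measurable_fun; exact: psi_continuous.
    by apply: measurable_weighted_sum => I /sU; exact: UF.
  - by move=> x _; exact: nd.
apply: nearW => n; apply: le_trans (weighted_seq (su n) (sU n) _) _.
  by rewrite (ltW t0).
rewrite lee_pmul2l ?lte_fin//; apply: le_measure; rewrite ?inE.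
- by apply: fin_bigcup_measurable => // I /= /sU UI; exact/measurable_rset/UF.
- rewrite /shadow (bigcup_exhaustion sU sc); apply: bigcup_measurable => k _.
  by apply: fin_bigcup_measurable => // I /= /sU UI; exact/measurable_rset/UF.
- by move=> x [I /= /sU UI Ix]; exists I.
Qed.

Lemma height_seq (s : seq Rc) x : uniq s ->
  height (R := R) rset [set` s] x = (\sum_(I <- s) \1_(rset I) x)%:E.
Proof.
move=> us; rewrite /height esum_fset; [|exact: finite_seq|by move=> I _; rewrite lee_fin].
by rewrite -sumEFin [RHS]fsbig_seq.
Qed.

Theorem sparse_domination (t : R) : 0 < t <= 1 -> 168 * t <= cosh1 (gamma R) ->
  exists G0 : set Rc, [/\ G0 `<=` U, sparse mu rset 8^-1 G0,
    (\int[mu]_x (psie th (t * gamma R)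
       (weighted_height rset (fun I => w (e1 I) (e2 I)) U x)) <=
     \int[mu]_x (psie th (gamma R) (height rset G0 x)))%E &
    (\int[mu]_x (psie th (gamma R) (height rset G0 x)) <= mu (shadow rset G0))%E].
Proof.
move=> t01 tg; have g0 := gamma_gt0 R; have /andP[t0 _] := t01.
have cU : countable U by apply: sub_countable countF; exact: subset_card_le.
have [s [su sU sh sc]] := countable_exhaustion cU.
have mU I : U I -> measurable (rset I) by move=> /UF; exact: measurable_rset.
have cv := measure_exhaustion_cvg sU sh sc (mu := mu) mU.
have fU : (mu (shadow rset U) < +oo)%E.
  apply: le_lt_trans fOm; apply: le_measure; rewrite ?inE//.
    rewrite /shadow (bigcup_exhaustion sU sc); apply: bigcup_measurable => k _.
    by apply: fin_bigcup_measurable => // I /= /sU; exact: mU.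
  by move=> x [I UI]; exact: UOm.
(* By continuity from below a finite part carries half of the shadow, which has finite measure as a
   part of [Om]. The selection takes place in this part, so [G0] is finite. This is the factor 2 in
   168 = 2 * 84. *)
have [n hn] : exists n, (mu (shadow rset U) <= 2%:E * mu (\bigcup_(I in [set` s n]) rset I))%E.
  apply: contrapT => /forallNP no.
  have fUE : mu (shadow rset U) = (fine (mu (shadow rset U)))%:E by rewrite fineK// ge0_fin_numE.
  have lt n : (mu (\bigcup_(I in [set` s n]) rset I) < (fine (mu (shadow rset U)) / 2)%:E)%E.
    rewrite ltNge; apply/negP => h; apply: (no n); rewrite fUE.
    have -> : fine (mu (shadow rset U)) = 2 * (fine (mu (shadow rset U)) / 2) by lra.
    by rewrite EFinM lee_pmul2l.
  have : (mu (shadow rset U) <= (fine (mu (shadow rset U)) / 2)%:E)%E.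
    rewrite -[leLHS](cvg_lim _ cv)//; apply: lime_le; first by apply/cvg_ex; eexists; exact: cv.
    by apply: nearW => n; exact/ltW/lt.
  rewrite {1}fUE lee_fin => le0; have := lt 0%N; rewrite ltNge => /negP; apply.
  by apply: (@le_trans _ _ 0%E); rewrite ?lee_fin//; lra.
have [G [uG Gs spG shG intG]] := sparse_seq (su n) (sU n).
have mG : measurable (\bigcup_(I in [set` G]) rset I).
  by apply: fin_bigcup_measurable => // I /= /Gs/sU; exact: mU.
have GF I : I \in G -> F I by move=> /Gs/sU/UF.
have mpsi : measurable_fun setT (fun x => (psi th (gamma R) (\sum_(I <- G) \1_(rset I) x))%:E).
  apply/measurable_EFinP; apply: (measurableT_comp (f := psi th _)).
    by apply: continuous_measurable_fun; exact: psi_continuous.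
  have := measurable_weighted_sum (fun=> 1) GF.
  by apply: eq_measurable_fun => x _; apply: eq_bigr => I _; rewrite mul1r.
have psiG : (\int[mu]_x (psie th (gamma R) (height rset [set` G] x)) =
    \int[mu]_x (psi th (gamma R) (\sum_(I <- G) \1_(rset I) x))%:E)%E.
  by apply: eq_integral => x _; rewrite height_seq// psie_fin.
exists [set` G]; split => //; first by move=> I /= /Gs/sU.
  apply: le_trans (weighted_integral t01) _.
  apply: (@le_trans _ _ ((cosh1 (gamma R))%:E * mu (\bigcup_(I in [set` G]) rset I))%E).
    apply: (@le_trans _ _ (t%:E * (2%:E * (84%:E * mu (\bigcup_(I in [set` G]) rset I))))%E).
      rewrite lee_pmul2l ?lte_fin//; apply: (le_trans hn).
      by rewrite lee_pmul2l.
    rewrite !muleA -!EFinM; apply: lee_wpmul2r => //; rewrite lee_fin; lra.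
  rewrite psiG -integral_cst// integral_mkcond; apply: ge0_le_integral => //.
  - by move=> x _; rewrite patchE; case: ifP => // _; rewrite lee_fin cosh1_ge0.
  - by apply/(measurable_restrictT _ mG).
  - move=> x _; rewrite patchE; case: ifPn => [|_].
      rewrite inE => -[I /= IG Ix]; rewrite lee_fin; apply: cosh1_le_psi; first exact: ltW.
      by rewrite (big_rem I)//= indicE mem_set//= lerDl sumr_ge0.
    by rewrite lee_fin psi_ge0 ?(ltW g0)// sumr_ge0.
by rewrite psiG.
Qed.

End weighted_family.
End chained_family.
End rectangle_system.

(** * Dyadic cubes *)

Section cubes.
Context (R : realType) (n : nat).
Implicit Types P Q : cube R n.

Lemma side_gt0 Q : 0 < side Q.
Proof. by rewrite /side exprz_gt0. Qed.

Lemma corner_in_cube Q : cube_set Q Q.1.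
Proof. by move=> i; rewrite lexx ltrDl side_gt0. Qed.

Lemma measurable_cube Q : measurable (cube_set Q).
Proof.
rewrite (_ : cube_set Q = \bigcap_(i in [set: 'I_n])
    ((@tnth _ (measurableTypeR R) ^~ i) @^-1` `[tnth Q.1 i, tnth Q.1 i + side Q[)); last first.
  apply/seteqP; split => x /= xB i; last by have := xB i Logic.I; rewrite /= in_itv.
  by move=> _; rewrite /= in_itv; exact: xB.
apply: fin_bigcap_measurable => // i _.
by rewrite -[X in measurable X]setTI; apply: measurable_tnth.
Qed.

Lemma lebesgue_cube Q : lebesgue_vec R n (cube_set Q) = (side Q ^+ n)%:E.
Proof.
rewrite lebesgue_vec_box; last by move=> i; rewrite lerDl ltW// side_gt0.
congr EFin; rewrite (eq_bigr (fun=> side Q)); last by move=> i _; rewrite addrC addKr.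
by rewrite prodr_const card_ord.
Qed.

Lemma lebesgue_cube_lty Q : (lebesgue_vec R n (cube_set Q) < +oo)%E.
Proof. by rewrite lebesgue_cube ltry. Qed.

Lemma lebesgue_cube_gt0 Q : (0 < lebesgue_vec R n (cube_set Q))%E.
Proof. by rewrite lebesgue_cube lte_fin exprn_gt0// side_gt0. Qed.

Lemma ler_side P Q : (side P <= side Q) = (P.2 <= Q.2).
Proof. by rewrite /side ler_eXz2l// ltr1n. Qed.

Context (D : set (cube R n)).
Hypothesis gD : dyadic_grid D.

Lemma cube_uniq P Q : D P -> D Q -> P.2 = Q.2 -> cube_set P `&` cube_set Q !=set0 -> P = Q.
Proof.
move=> DP DQ PQ [x [Px Qx]]; have [A [_ uA]] := dyadic_partition gD Q.2 x.
by rewrite -(uA P)// -(uA Q).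
Qed.

Hypothesis n_gt0 : (0 < n)%N.

Lemma cube_sub_exponent P Q : cube_set P `<=` cube_set Q -> P.2 <= Q.2.
Proof.
move=> PQ; have : (lebesgue_vec R n (cube_set P) <= lebesgue_vec R n (cube_set Q))%E.
  by apply: le_measure; rewrite ?inE//; exact: measurable_cube.
by rewrite !lebesgue_cube lee_fin ler_pXn2r ?nnegrE ?(ltW (side_gt0 _))// ler_side.
Qed.

Lemma cube_sub P Q : D P -> D Q -> cube_set P `&` cube_set Q !=set0 -> P.2 <= Q.2 ->
  cube_set P `<=` cube_set Q.
Proof.
move=> DP DQ PQ0 le; have [//|QP] := dyadic_nested gD DP DQ PQ0.
have e : P.2 = Q.2 by apply/eqP; rewrite eq_le le cube_sub_exponent.
by rewrite (cube_uniq DP DQ e).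
Qed.

Lemma cube_proper_exponent P Q : D P -> D Q -> cube_set P `<` cube_set Q -> P.2 < Q.2.
Proof.
move=> DP DQ [PQ nQP]; rewrite ltNge; apply/negP => le; apply: nQP.
apply: cube_sub => //; exists P.1; split; last exact: corner_in_cube.
by apply: PQ; exact: corner_in_cube.
Qed.

(** The grid has a cube of the required exponent through the lower corner of [Q]. It meets [Q] and
    is at least as large, so it contains [Q], and the default value of [ancestor] does not occur. *)
Lemma ancestorP k Q : D Q -> [/\ D (ancestor D k Q), (ancestor D k Q).2 = Q.2 + k%:Z &
  cube_set Q `<=` cube_set (ancestor D k Q)].
Proof.
move=> DQ; have sE P : side P = 2 ^+ k * side Q <-> P.2 = Q.2 + k%:Z.
  rewrite /side exprnP -expfzDr// [_ + Q.2]addrC; split => [|->//].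
  by apply: ieexprIz => //; rewrite ?pnatr_eq1.
have [P [[DP P2 Px] _]] := dyadic_partition gD (Q.2 + k%:Z) Q.1.
suff [? /sE ? ?] : [set P | [/\ D P, side P = (2 ^+ k * side Q)%R & cube_set Q `<=` cube_set P]]
    (ancestor D k Q) by split.
apply: xgetPex; exists P; split => //; first exact/sE.
apply: cube_sub => //; first by exists Q.1; split => //; exact: corner_in_cube.
by rewrite P2 lerDl.
Qed.

Lemma ancestor0 Q : D Q -> ancestor D 0 Q = Q.
Proof.
move=> DQ; have [DA A2 QA] := ancestorP 0 DQ; apply: cube_uniq => //; first by rewrite A2 addr0.
by exists Q.1; split; [apply: QA|]; exact: corner_in_cube.
Qed.

Lemma ancestor_sub k P Q : D P -> D Q -> cube_set P `&` cube_set Q !=set0 ->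
  P.2 + k%:Z <= Q.2 -> cube_set (ancestor D k P) `<=` cube_set Q.
Proof.
move=> DP DQ [x [Px Qx]] le; have [DA A2 PA] := ancestorP k DP.
apply: cube_sub => //; last by rewrite A2.
by exists x; split => //; exact: PA.
Qed.

(** The true factor is 2^(k n); linear growth is enough to make the measures of the extensions
    unbounded. *)
Lemma lebesgue_ancestor k Q : D Q ->
  ((k%:R : R)%:E * lebesgue_vec R n (cube_set Q) <= lebesgue_vec R n (cube_set (ancestor D k Q)))%E.
Proof.
move=> DQ; have [_ A2 _] := ancestorP k DQ.
rewrite !lebesgue_cube -EFinM lee_fin.
have -> : side (ancestor D k Q) = 2 ^+ k * side Q.
  by rewrite /side A2 expfzDr// mulrC exprnP.
rewrite exprMn ler_wpM2r ?exprn_ge0 ?(ltW (side_gt0 _))//.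
apply: (@le_trans _ _ (2 ^+ k)); first by rewrite -natrX ler_nat ltnW// ltn_expl.
by rewrite -[leLHS]expr1 ler_weXn2l// exprn_ege1 ?ler1n.
Qed.

(** A cube of the grid is determined by its exponent and any one of its points, and it contains a
    point with rational coordinates. *)
Lemma countable_grid : countable D.
Proof.
have /choice[r rP] : forall a : cube R n * 'I_n, exists q : rat,
    tnth a.1.1 a.2 < ratr q < tnth a.1.1 a.2 + side a.1.
  move=> [Q i] /=; have : tnth Q.1 i < tnth Q.1 i + side Q by rewrite ltrDl side_gt0.
  by move=> /rat_in_itvoo[q]; rewrite in_itv/=; exists q.
pose f (Q : cube R n) := pickle (Q.2, [tuple r (Q, i) | i < n]).
apply/countable_injP; exists f => P Q; rewrite !inE => DP DQ /(pcan_inj pickleK) fPQ.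
have /= PQ2 := congr1 fst fPQ.
apply: cube_uniq => //; exists [tuple ratr (r (P, i)) | i < n].
have rE i : r (P, i) = r (Q, i).
  by have /= := congr1 (fun a => tnth a.2 i) fPQ; rewrite !tnth_mktuple.
split => i; rewrite tnth_mktuple; first by have /andP[/ltW -> ->] := rP (P, i).
by rewrite rE; have /andP[/ltW -> ->] := rP (Q, i).
Qed.

End cubes.

(** * Dyadic rectangles with an abstract third side *)

Section dyadic_rectangles.
Context (R : realType) (n1 n2 : nat).
Hypothesis n1_gt0 : (0 < n1)%N.
Hypothesis n2_gt0 : (0 < n2)%N.
Context (D1 : set (cube R n1)) (D2 : set (cube R n2)).
Hypothesis gD1 : dyadic_grid D1.
Hypothesis gD2 : dyadic_grid D2.
Local Notation V1 := (vec R n1).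
Local Notation V2 := (vec R n2).
Local Notation m1 := (lebesgue_vec R n1).
Local Notation m2 := (lebesgue_vec R n2).
Context d (T : measurableType d) (mu : {measure set T -> \bar R}).
Context d3 (V3 : measurableType d3) (m3 : {measure set V3 -> \bar R}).
Context (p1 : T -> V1) (p2 : T -> V2) (p3 : T -> V3).
Local Notation boxset := (boxset p1 p2 p3).
Hypothesis mbox : forall B1 B2 B3, measurable B1 -> measurable B2 -> measurable B3 ->
  measurable (boxset B1 B2 B3).
Hypothesis boxE : forall B1 B2 B3, measurable B1 -> measurable B2 -> measurable B3 ->
  mu (boxset B1 B2 B3) = (m1 B1 * m2 B2 * m3 B3)%E.
Context (Rc : choiceType) (rset : Rc -> set T).
Context (Q1 : Rc -> cube R n1) (Q2 : Rc -> cube R n2) (S3 : Rc -> set V3).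
Hypothesis rsetE : forall I, rset I = boxset (cube_set (Q1 I)) (cube_set (Q2 I)) (S3 I).
Context (F B U0 : set Rc).
Hypothesis F1 : forall I, F I -> D1 (Q1 I).
Hypothesis F2 : forall I, F I -> D2 (Q2 I).
Hypothesis mS3 : forall I, F I -> measurable (S3 I).
Hypothesis fS3 : forall I, F I -> (m3 (S3 I) < +oo)%E.
Hypothesis S3_gt0 : forall I, F I -> (0 < m3 (S3 I))%E.
Hypothesis lS3 : forall I J, F I -> F J -> S3 I `&` S3 J !=set0 ->
  S3 I `<=` S3 J \/ S3 J `<=` S3 I.
Hypothesis countF : countable F.
Hypothesis BF : B `<=` F.
Hypothesis U0B : U0 `<=` B.
Hypothesis U0_S3 : forall I J, U0 I -> U0 J -> S3 I `&` S3 J !=set0 ->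
  (Q1 I).2 <= (Q1 J).2 -> (Q2 I).2 <= (Q2 J).2 -> S3 I `<=` S3 J.
Context (r1 : cube R n1 -> Rc -> Rc) (r2 : cube R n2 -> Rc -> Rc).
Hypothesis r11 : forall A I, Q1 (r1 A I) = A.
Hypothesis r12 : forall A I, Q2 (r1 A I) = Q2 I.
Hypothesis r13 : forall A I, S3 (r1 A I) = S3 I.
Hypothesis r21 : forall A I, Q1 (r2 A I) = Q1 I.
Hypothesis r22 : forall A I, Q2 (r2 A I) = A.
Hypothesis r23 : forall A I, S3 (r2 A I) = S3 I.
Hypothesis Br1 : forall A I, B I -> D1 A -> (Q1 I).2 <= A.2 -> B (r1 A I).
Hypothesis Br2 : forall A I, B I -> D2 A -> (Q2 I).2 <= A.2 -> B (r2 A I).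
Context (th : bool).
Hypothesis S3_cst : ~~ th -> forall I J, S3 I = S3 J.
Context (w : nat -> nat -> R).
Hypothesis w_ge0 : forall a b, 0 <= w a b.
Hypothesis w_nincl : forall a a' b, (a <= a')%N -> w a' b <= w a b.
Hypothesis w_nincr : forall a b b', (b <= b')%N -> w a b' <= w a b.
Hypothesis w_diag : forall N, \sum_(i < N.+1) w i (N - i)%N <= 1.

Let rsetE1 : forall I, rset I = boxset ((@cube_set R n1 \o Q1) I) ((@cube_set R n2 \o Q2) I) (S3 I)
  := rsetE.

Let muE I : F I -> mu (rset I) = (m1 (cube_set (Q1 I)) * m2 (cube_set (Q2 I)) * m3 (S3 I))%E.
Proof. by move=> FI; rewrite rsetE boxE//;
  [exact: measurable_cube|exact: measurable_cube|exact: mS3]. Qed.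

Let mu_gt0 I : F I -> (0 < mu (rset I))%E.
Proof. by move=> FI; rewrite muE// !mule_gt0 ?lebesgue_cube_gt0 ?S3_gt0. Qed.

Let mu_lty I : F I -> (mu (rset I) < +oo)%E.
Proof.
move=> FI; rewrite muE// -ge0_fin_numE ?mule_ge0// !fin_numM// ge0_fin_numE//.
- exact: lebesgue_cube_lty.
- exact: lebesgue_cube_lty.
- exact: fS3.
Qed.

Let unbounded (I : Rc) (J : nat -> Rc) : F I ->
  (forall k, ((k%:R : R)%:E * mu (rset I) <= mu (rset (J k)))%E) ->
  forall M : R, exists k0, forall k, (k0 <= k)%N -> (M%:E < mu (rset (J k)))%E.
Proof.
move=> FI h M; have I0 := mu_gt0 FI; have If := mu_lty FI.
have IE : mu (rset I) = (fine (mu (rset I)))%:E by rewrite fineK// ge0_fin_numE.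
set r := fine _ in IE; have r0 : 0 < r by rewrite -lte_fin -IE.
exists (Num.bound (`|M| / r)) => k kk; apply: lt_le_trans (h k).
rewrite IE -EFinM lte_fin; apply: (le_lt_trans (ler_norm M)).
rewrite -ltr_pdivrMr//; apply: (@lt_le_trans _ _ (Num.bound (`|M| / r))%:R).
  by apply: archi_boundP; rewrite divr_ge0// ltW.
by rewrite ler_nat.
Qed.

(** Intersecting cubes of a grid are ordered by their exponents. If neither of the first two
    exponents of I exceeded that of J, [U0_S3] would also give the inclusion of the third sides,
    hence of I in J. So the two exponents are in strictly opposite orders. *)
Lemma chain_of_incomparable (U : set Rc) : U `<=` U0 ->
  (forall I J, U I -> U J -> rset I `<=` rset J -> I = J) ->
  forall I J, U I -> U J -> I <> J ->
  cube_set (Q1 I) `&` cube_set (Q1 J) !=set0 -> cube_set (Q2 I) `&` cube_set (Q2 J) !=set0 ->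
  S3 I `&` S3 J !=set0 ->
  (cube_set (Q1 I) `<` cube_set (Q1 J) /\ cube_set (Q2 J) `<` cube_set (Q2 I)) \/
  (cube_set (Q1 J) `<` cube_set (Q1 I) /\ cube_set (Q2 I) `<` cube_set (Q2 J)).
Proof.
move=> UU0 inc; have D1U I : U I -> D1 (Q1 I) by move=> UI; exact/F1/BF/U0B/UU0.
have D2U I : U I -> D2 (Q2 I) by move=> UI; exact/F2/BF/U0B/UU0.
have key I J : U I -> U J -> I <> J -> cube_set (Q1 I) `&` cube_set (Q1 J) !=set0 ->
    cube_set (Q2 I) `&` cube_set (Q2 J) !=set0 -> S3 I `&` S3 J !=set0 ->
    (Q1 I).2 <= (Q1 J).2 -> (Q2 I).2 <= (Q2 J).2 -> False.
  move=> UI UJ IJ h1 h2 h3 le1 le2; apply: IJ; apply: inc => //; rewrite !rsetE.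
  move=> x [x1 x2 x3]; split.
  - by apply: (cube_sub gD1 n1_gt0 (D1U _ UI) (D1U _ UJ)).
  - by apply: (cube_sub gD2 n2_gt0 (D2U _ UI) (D2U _ UJ)).
  - by apply: (U0_S3 (UU0 _ UI) (UU0 _ UJ)).
have proper I J : U I -> U J -> I <> J -> cube_set (Q1 I) `&` cube_set (Q1 J) !=set0 ->
    cube_set (Q2 I) `&` cube_set (Q2 J) !=set0 -> S3 I `&` S3 J !=set0 ->
    (Q1 I).2 <= (Q1 J).2 ->
    cube_set (Q1 I) `<` cube_set (Q1 J) /\ cube_set (Q2 J) `<` cube_set (Q2 I).
  move=> UI UJ IJ h1 h2 h3 le1.
  have lt2 : (Q2 J).2 < (Q2 I).2 by rewrite ltNge; apply/negP => /(key I J UI UJ IJ h1 h2 h3 le1).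
  split; split.
  - exact: (cube_sub gD1 n1_gt0 (D1U _ UI) (D1U _ UJ)).
  - move=> /(cube_sub_exponent n1_gt0) ge1; apply: (key J I) => //; last exact: ltW.
    + by move=> e; apply: IJ.
    + by rewrite setIC.
    + by rewrite setIC.
    + by rewrite setIC.
  - by apply: (cube_sub gD2 n2_gt0 (D2U _ UJ) (D2U _ UI)); [rewrite setIC|exact: ltW].
  - by move=> /(cube_sub_exponent n2_gt0); rewrite leNgt lt2.
move=> I J UI UJ IJ h1 h2 h3; have [le1|/ltW le1] := leP (Q1 I).2 (Q1 J).2.
  by left; exact: proper.
right; apply: proper => //; try by rewrite setIC.
by move=> e; apply: IJ.
Qed.

(** [U0] holds the rectangles of the setting, [B] those of the maximal function, and [F] is a
    countable family containing both. Extending one side of a Zygmund rectangle breaks the equation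
    between its sides, but the result stays in [B], where the density bound is available. *)
Theorem dyadic_domination (Om : set T) (U : set Rc) (t : R) :
  admissible_pair mu rset U0 Om U -> 0 < t <= 1 -> 168 * t <= cosh1 (gamma R) ->
  exists G0 : set Rc, [/\ G0 `<=` U, sparse mu rset 8^-1 G0,
    (\int[mu]_x (psie th (t * gamma R) (weighted_height rset (fun I => w
       (max_extension rset (fun k => r1 (ancestor D1 k (Q1 I)) I) (enlargement mu rset B Om))
       (max_extension rset (fun k => r2 (ancestor D2 k (Q2 I)) I) (enlargement mu rset B Om)))
       U x)) <=
     \int[mu]_x (psie th (gamma R) (height rset G0 x)))%E &
    (\int[mu]_x (psie th (gamma R) (height rset G0 x)) <= mu (shadow rset G0))%E].
Proof.
move=> [mOm fOm UU0 UOm inc] t01 tg; have UF : U `<=` F by move=> I /UU0/U0B/BF.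
have UB : U `<=` B by move=> I /UU0/U0B.
have ext1P k I : U I -> [/\ B (r1 (ancestor D1 k (Q1 I)) I),
    cube_set (Q1 I) `<=` cube_set (ancestor D1 k (Q1 I)) &
    ((k%:R : R)%:E * mu (rset I) <= mu (rset (r1 (ancestor D1 k (Q1 I)) I)))%E].
  move=> UI; have DI := F1 (UF _ UI); have [DA A2 IA] := ancestorP gD1 n1_gt0 k DI.
  have BA : B (r1 (ancestor D1 k (Q1 I)) I) by apply: Br1 => //; [exact: UB|rewrite A2 lerDl].
  split => //; rewrite !muE; [|exact: BF|exact: UF].
  by rewrite r11 r12 r13 !muleA !lee_wpmul2r// (lebesgue_ancestor gD1 n1_gt0 k DI).
have ext2P k I : U I -> [/\ B (r2 (ancestor D2 k (Q2 I)) I),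
    cube_set (Q2 I) `<=` cube_set (ancestor D2 k (Q2 I)) &
    ((k%:R : R)%:E * mu (rset I) <= mu (rset (r2 (ancestor D2 k (Q2 I)) I)))%E].
  move=> UI; have DI := F2 (UF _ UI); have [DA A2 IA] := ancestorP gD2 n2_gt0 k DI.
  have BA : B (r2 (ancestor D2 k (Q2 I)) I) by apply: Br2 => //; [exact: UB|rewrite A2 lerDl].
  split => //; rewrite !muE; [|exact: BF|exact: UF].
  rewrite r21 r22 r23 !muleA [(_ * m1 _)%E]muleC -!muleA lee_wpmul2l// !muleA.
  by rewrite lee_wpmul2r// (lebesgue_ancestor gD2 n2_gt0 k DI).
apply: (@sparse_domination _ _ _ mu _ _ m1 _ _ m2 _ _ m3 p1 p2 p3 mbox _ Rc rset
  (@cube_set R n1 \o Q1) (@cube_set R n2 \o Q2) S3 rsetE1 F _ _ mS3 _ _ fS3 _ _ lS3 mu_gt0 countF U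
    UF _ th
  S3_cst B Om BF mOm fOm UOm (fun k I => r1 (ancestor D1 k (Q1 I)) I)
  (fun k I => r2 (ancestor D2 k (Q2 I)) I) _ _ _ _ _ _ _ _ _ _ _ _ (fun I => (Q1 I).2) (fun I =>
    (Q2 I).2)
  _ _ _ _ w w_ge0 w_nincl w_nincr w_diag t t01 tg).
- by move=> B1 B2 B3 mB1 mB2 mB3 _ _ _; exact: boxE.
- by move=> I _; exact: measurable_cube.
- by move=> I _; exact: measurable_cube.
- by move=> I _; exact: lebesgue_cube_lty.
- by move=> I _; exact: lebesgue_cube_lty.
- by move=> I J FI FJ; apply: (dyadic_nested gD1); exact: F1.
- by move=> I J FI FJ; apply: (dyadic_nested gD2); exact: F2.
- exact: chain_of_incomparable.
- by move=> k I /ext1P -/(_ k)[].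
- by move=> k I /ext2P -/(_ k)[].
- by move=> k I /ext1P -/(_ k)[]; rewrite /= r11.
- by move=> k I /=; rewrite r12.
- by move=> k I /=; rewrite r13.
- by move=> k I /=; rewrite r21.
- by move=> k I /ext2P -/(_ k)[]; rewrite /= r22.
- by move=> k I /=; rewrite r23.
- by move=> I UI; rewrite (ancestor0 gD1 n1_gt0 (F1 (UF _ UI))) !rsetE r11 r12 r13.
- by move=> I UI; rewrite (ancestor0 gD2 n2_gt0 (F2 (UF _ UI))) !rsetE r21 r22 r23.
- by move=> I UI; apply: (unbounded (UF _ UI)) => k; have [] := ext1P k I UI.
- by move=> I UI; apply: (unbounded (UF _ UI)) => k; have [] := ext2P k I UI.
- by move=> I J FI FJ; apply: (cube_proper_exponent gD1 n1_gt0); exact: F1.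
- by move=> I J FI FJ; apply: (cube_proper_exponent gD2 n2_gt0); exact: F2.
- move=> k I J UI UJ; rewrite /= r11.
  by apply: (ancestor_sub gD1 n1_gt0); exact/F1/UF.
- move=> k I J UI UJ; rewrite /= r22.
  by apply: (ancestor_sub gD2 n2_gt0); exact/F2/UF.
Qed.

End dyadic_rectangles.

(** * The two settings *)

Section normalization.
Context (R : realType).

Lemma completed_measurable d (T : measurableType d) (mu : {measure set T -> \bar R}) (A : set T) :
  measurable A -> measurable (A : set (caratheodory_type (mu^*)%mu)).
Proof. by move=> mA; apply: sub_caratheodory; apply: sub_sigma_algebra. Qed.

Lemma completed_measureE d (T : measurableType d) (mu : {measure set T -> \bar R}) (A : set T) :
  measurable A -> @completed_measure_extension _ _ _ mu A = mu A.
Proof. exact: measurable_mu_extE. Qed.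

Lemma ft_normE (w : nat -> nat -> R) : admissible_weight w -> (exists a b, w a b <> 0) ->
  exists f : R, [/\ 0 < f, ft_norm w = f%:E & forall N, \sum_(i < N.+1) w i (N - i)%N <= f].
Proof.
move=> [w0 _ _ wf] [a [b wab]].
have ub N : ((\sum_(i < N.+1) w i (N - i)%N)%:E <= ft_norm w)%E.
  by rewrite -sumEFin; apply: ereal_sup_ubound; exists N.
have ab : 0 < \sum_(i < (a + b).+1) w i (a + b - i)%N.
  have lt : (a < (a + b).+1)%N by rewrite ltnS leq_addr.
  rewrite (bigD1 (Ordinal lt))//= addKn ltr_pwDl//; last by apply: sumr_ge0.
  by rewrite lt_neqAle eq_sym w0 andbT; apply/eqP.
have f0 : (0 < ft_norm w)%E by apply: lt_le_trans (ub (a + b)%N); rewrite lte_fin.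
have fE : ft_norm w = (fine (ft_norm w))%:E by rewrite fineK// ge0_fin_numE// ltW.
exists (fine (ft_norm w)); split => //; first by rewrite -lte_fin -fE.
by move=> N; rewrite -lee_fin -fE.
Qed.

Lemma normalized_weight (w : nat -> nat -> R) (f : R) : admissible_weight w -> 0 < f ->
  (forall N, \sum_(i < N.+1) w i (N - i)%N <= f) ->
  let v a b := f^-1 * w a b in
  [/\ forall a b, 0 <= v a b, forall a a' b, (a <= a')%N -> v a' b <= v a b,
      forall a b b', (b <= b')%N -> v a b' <= v a b &
      forall N, \sum_(i < N.+1) v i (N - i)%N <= 1].
Proof.
move=> [w0 wl wr _] f0 wf /=; have fi0 : 0 <= f^-1 by rewrite invr_ge0 ltW.
split.
- by move=> a b; exact: mulr_ge0.
- by move=> a a' b aa; apply: ler_wpM2l; [|exact: wl].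
- by move=> a b b' bb; apply: ler_wpM2l; [|exact: wr].
- by move=> N; rewrite -mulr_sumr ler_pdivrMl// mulr1; exact: wf.
Qed.

Lemma weighted_heightZ d (T : measurableType d) (Rc : choiceType) (rset : Rc -> set T)
    (W : Rc -> R) (U : set Rc) (r : R) (x : T) : countable U ->
  (forall I, 0 <= W I) -> 0 <= r ->
  weighted_height rset (fun I => r * W I) U x = (r%:E * weighted_height rset W U x)%E.
Proof.
move=> /countable_exhaustion[s [su sU sh sc]] W0 r0; rewrite /weighted_height.
rewrite -(esumZl_exhaustion su sU sh sc)//; last by move=> I; rewrite mulr_ge0.
by apply: eq_esum => I _; rewrite mulrA.
Qed.

End normalization.

Section bi_parameter.
Context (R : realType) (d1 d2 : nat).
Hypothesis d1_gt0 : (0 < d1)%N.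
Hypothesis d2_gt0 : (0 < d2)%N.
Context (D1 : set (cube R d1)) (D2 : set (cube R d2)).
Hypothesis gD1 : dyadic_grid D1.
Hypothesis gD2 : dyadic_grid D2.

Let T := space2 R d1 d2.
Let p1 (x : T) : vec R d1 := x.1.
Let p2 (x : T) : vec R d2 := x.2.
(* The missing third side is a point, on which [lebesgue_vec R 0] is a Dirac mass. *)
Let p3 (x : T) : vec R 0 := [tuple].

Let boxsetE B1 B2 B3 : boxset p1 p2 p3 B1 B2 B3 =
  if [tuple] \in B3 then B1 `*` B2 else set0.
Proof.
apply/seteqP; split => x.
  by move=> [x1 x2 x3]; rewrite mem_set.
by case: ifP => // /set_mem x3 [x1 x2].
Qed.

Let mbox B1 B2 B3 : measurable B1 -> measurable B2 -> measurable B3 ->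
  measurable (boxset p1 p2 p3 B1 B2 B3).
Proof.
move=> mB1 mB2 mB3; rewrite boxsetE; case: ifP => // _.
by apply: completed_measurable; exact: measurableX.
Qed.

Let boxE B1 B2 B3 : measurable B1 -> measurable B2 -> measurable B3 ->
  leb2 R d1 d2 (boxset p1 p2 p3 B1 B2 B3) =
  (lebesgue_vec R d1 B1 * lebesgue_vec R d2 B2 * lebesgue_vec R 0 B3)%E.
Proof.
move=> mB1 mB2 mB3; rewrite boxsetE /= diracE; case: ifP => _; last by rewrite mule0 measure0.
rewrite mule1 /leb2 completed_measureE; last exact: measurableX.
exact: product_measure1E.
Qed.

Lemma biparameter_domination (w : nat -> nat -> R) (Om : set T) (U : set (rect2 R d1 d2)) (t : R) :
  admissible_weight w -> (exists a b, w a b <> 0) ->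
  admissible_pair (leb2 R d1 d2) rset2 (rects2 D1 D2) Om U ->
  0 < t <= 1 -> 168 * t <= cosh1 (gamma R) ->
  exists G0 : set (rect2 R d1 d2), [/\ G0 `<=` U, sparse (leb2 R d1 d2) rset2 8^-1 G0,
    (\int[leb2 R d1 d2]_x (psie false (t * gamma R) ((ft_norm w)^-1 * H2 D1 D2 w Om U x)) <=
     \int[leb2 R d1 d2]_x (psie false (gamma R) (height rset2 G0 x)))%E &
    (\int[leb2 R d1 d2]_x (psie false (gamma R) (height rset2 G0 x)) <=
     leb2 R d1 d2 (shadow rset2 G0))%E].
Proof.
move=> wa wn adm t01 tg; have [w0 _ _ _] := wa; have [f [f0 fE fub]] := ft_normE wa wn.
have fi0 : 0 <= f^-1 by rewrite invr_ge0 ltW.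
have cF : countable (rects2 D1 D2).
  have := countableX (countable_grid gD1) (countable_grid gD2).
  by congr countable; apply/seteqP; split => I.
have cU : countable U.
  by apply: sub_countable cF; apply: subset_card_le; have [] := adm.
have rE I : rset2 I = boxset p1 p2 p3 (cube_set I.1) (cube_set I.2) setT.
  by apply/seteqP; split => x; [case|move=> []].
have fT : (lebesgue_vec R 0 setT < +oo)%E by rewrite /= diracE mem_set// ltry.
have T_gt0 : (0 < lebesgue_vec R 0 setT)%E by rewrite /= diracE mem_set// lte01.
have [nw0 nwl nwr nwd] := normalized_weight wa f0 fub.
have [G0 [GU sp le1 le2]] := @dyadic_domination R d1 d2 d1_gt0 d2_gt0 D1 D2 gD1 gD2 _ T
  (leb2 R d1 d2) _ (vec R 0) (lebesgue_vec R 0) p1 p2 p3 mbox boxE (rect2 R d1 d2) rset2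
  fst snd (fun=> setT) rE (rects2 D1 D2) (rects2 D1 D2) (rects2 D1 D2)
  (fun I FI => FI.1) (fun I FI => FI.2) (fun _ _ => measurableT) (fun _ _ => fT)
  (fun _ _ => T_gt0) (fun _ _ _ _ _ => or_introl (@subset_refl _ _)) cF
  (@subset_refl _ _) (@subset_refl _ _) (fun _ _ _ _ _ _ _ => @subset_refl _ _)
  (fun A I => (A, I.2)) (fun A I => (I.1, A)) (fun _ _ => erefl) (fun _ _ => erefl)
  (fun _ _ => erefl) (fun _ _ => erefl) (fun _ _ => erefl) (fun _ _ => erefl)
  (fun A I BI DA _ => conj DA BI.2) (fun A I BI DA _ => conj BI.1 DA)
  false (fun _ _ _ => erefl) (fun a b => f^-1 * w a b) nw0 nwl nwr nwd Om U t adm t01 tg.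
exists G0; split => //; move: le1; congr (_ <= _)%E; apply: eq_integral => x _; congr psie.
by rewrite fE inver gt_eqF// /H2 -weighted_heightZ.
Qed.

End bi_parameter.

Section zygmund_setting.
Context (R : realType) (d1 d2 d3 : nat).
Hypothesis d1_gt0 : (0 < d1)%N.
Hypothesis d2_gt0 : (0 < d2)%N.
Hypothesis d3_gt0 : (0 < d3)%N.
Context (D1 : set (cube R d1)) (D2 : set (cube R d2)) (D3 : set (cube R d3)).
Hypothesis gD1 : dyadic_grid D1.
Hypothesis gD2 : dyadic_grid D2.
Hypothesis gD3 : dyadic_grid D3.

Let T := space3 R d1 d2 d3.
Let p1 (x : T) : vec R d1 := x.1.1.
Let p2 (x : T) : vec R d2 := x.1.2.
Let p3 (x : T) : vec R d3 := x.2.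

Let boxsetE B1 B2 B3 : boxset p1 p2 p3 B1 B2 B3 = B1 `*` B2 `*` B3.
Proof. by apply/seteqP; split => x; [case|move=> [[]]]. Qed.

Let mbox B1 B2 B3 : measurable B1 -> measurable B2 -> measurable B3 ->
  measurable (boxset p1 p2 p3 B1 B2 B3).
Proof.
move=> mB1 mB2 mB3; rewrite boxsetE; apply: completed_measurable.
by apply: measurableX => //; exact: measurableX.
Qed.

Let boxE B1 B2 B3 : measurable B1 -> measurable B2 -> measurable B3 ->
  leb3 R d1 d2 d3 (boxset p1 p2 p3 B1 B2 B3) =
  (lebesgue_vec R d1 B1 * lebesgue_vec R d2 B2 * lebesgue_vec R d3 B3)%E.
Proof.
move=> mB1 mB2 mB3; have mB12 : measurable (B1 `*` B2) by exact: measurableX.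
rewrite boxsetE /leb3 /= completed_measureE; last exact: measurableX.
transitivity (borel2 R d1 d2 (B1 `*` B2) * lebesgue_vec R d3 B3)%E.
  exact: product_measure1E.
by congr (_ * _)%E; exact: product_measure1E.
Qed.

Lemma zygmund_domination (w : nat -> nat -> R) (Om : set T) (U : set (rect3 R d1 d2 d3)) (t : R) :
  admissible_weight w -> (exists a b, w a b <> 0) ->
  admissible_pair (leb3 R d1 d2 d3) rset3 (zygmund_rects D1 D2 D3) Om U ->
  0 < t <= 1 -> 168 * t <= cosh1 (gamma R) ->
  exists G0 : set (rect3 R d1 d2 d3), [/\ G0 `<=` U, sparse (leb3 R d1 d2 d3) rset3 8^-1 G0,
    (\int[leb3 R d1 d2 d3]_x (psie true (t * gamma R) ((ft_norm w)^-1 * H3 D1 D2 D3 w Om U x)) <=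
     \int[leb3 R d1 d2 d3]_x (psie true (gamma R) (height rset3 G0 x)))%E &
    (\int[leb3 R d1 d2 d3]_x (psie true (gamma R) (height rset3 G0 x)) <=
     leb3 R d1 d2 d3 (shadow rset3 G0))%E].
Proof.
move=> wa wn adm t01 tg; have [w0 _ _ _] := wa; have [f [f0 fE fub]] := ft_normE wa wn.
have fi0 : 0 <= f^-1 by rewrite invr_ge0 ltW.
pose F : set (rect3 R d1 d2 d3) := [set I | [/\ D1 I.1.1, D2 I.1.2 & D3 I.2]].
have cF : countable F.
  have := countableX (countableX (countable_grid gD1) (countable_grid gD2)) (countable_grid gD3).
  by congr countable; apply/seteqP; split => I; [move=> [[]]|case].
have BF : subzygmund_rects D1 D2 D3 `<=` F by move=> I [].
have UB : zygmund_rects D1 D2 D3 `<=` subzygmund_rects D1 D2 D3.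
  by move=> I [D1I D2I D3I sI]; split => //; rewrite sI.
have cU : countable U.
  by apply: sub_countable cF; apply: subset_card_le; have [_ _ UZ _ _] := adm => I /UZ/UB/BF.
have rE I : rset3 I = boxset p1 p2 p3 (cube_set I.1.1) (cube_set I.1.2) (cube_set I.2).
  by rewrite boxsetE.
have F1 (I : rect3 R d1 d2 d3) : F I -> D1 I.1.1 by case.
have F2 (I : rect3 R d1 d2 d3) : F I -> D2 I.1.2 by case.
have F3 (I : rect3 R d1 d2 d3) : F I -> D3 I.2 by case.
have l3 (I J : rect3 R d1 d2 d3) : F I -> F J -> cube_set I.2 `&` cube_set J.2 !=set0 ->
    cube_set I.2 `<=` cube_set J.2 \/ cube_set J.2 `<=` cube_set I.2.
  by move=> /F3 ? /F3 ?; exact: (dyadic_nested gD3).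
(* The equation for the third side makes it increase with the first two, so that incomparability is
   decided by these. *)
have U3 (I J : rect3 R d1 d2 d3) : zygmund_rects D1 D2 D3 I -> zygmund_rects D1 D2 D3 J ->
    cube_set I.2 `&` cube_set J.2 !=set0 -> I.1.1.2 <= J.1.1.2 -> I.1.2.2 <= J.1.2.2 ->
    cube_set I.2 `<=` cube_set J.2.
  move=> [_ _ D3I sI] [_ _ D3J sJ] IJ le1 le2; apply: (cube_sub gD3 d3_gt0) => //.
  by rewrite -ler_side sI sJ ler_pM ?(ltW (side_gt0 _))// ler_side.
pose r1 (A : cube R d1) (I : rect3 R d1 d2 d3) : rect3 R d1 d2 d3 := (A, I.1.2, I.2).
pose r2 (A : cube R d2) (I : rect3 R d1 d2 d3) : rect3 R d1 d2 d3 := (I.1.1, A, I.2).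
(* Lengthening one of the first two sides preserves the inequality which defines
   [subzygmund_rects]. *)
have Br1 A I : subzygmund_rects D1 D2 D3 I -> D1 A -> I.1.1.2 <= A.2 ->
    subzygmund_rects D1 D2 D3 (r1 A I).
  move=> [D1I D2I D3I sI] DA le; split => //; apply: (le_trans sI).
  by rewrite ler_pM2r ?side_gt0// ler_side.
have Br2 A I : subzygmund_rects D1 D2 D3 I -> D2 A -> I.1.2.2 <= A.2 ->
    subzygmund_rects D1 D2 D3 (r2 A I).
  move=> [D1I D2I D3I sI] DA le; split => //; apply: (le_trans sI).
  by rewrite ler_pM2l ?side_gt0// ler_side.
have S3c : ~~ true -> forall I J : rect3 R d1 d2 d3, cube_set I.2 = cube_set J.2 by [].
have [nw0 nwl nwr nwd] := normalized_weight wa f0 fub.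
have [G0 [GU sp le1 le2]] := @dyadic_domination R d1 d2 d1_gt0 d2_gt0 D1 D2 gD1 gD2 _ T
  (leb3 R d1 d2 d3) _ (vec R d3) (lebesgue_vec R d3) p1 p2 p3 mbox boxE (rect3 R d1 d2 d3) rset3
  (fun I => I.1.1) (fun I => I.1.2) (fun I => cube_set I.2) rE F (subzygmund_rects D1 D2 D3)
  (zygmund_rects D1 D2 D3) F1 F2 (fun I _ => measurable_cube I.2)
  (fun I _ => lebesgue_cube_lty I.2) (fun I _ => lebesgue_cube_gt0 I.2) l3 cF BF UB U3 r1 r2
  (fun _ _ => erefl) (fun _ _ => erefl) (fun _ _ => erefl) (fun _ _ => erefl)
  (fun _ _ => erefl) (fun _ _ => erefl) Br1 Br2 true S3c
  (fun a b => f^-1 * w a b) nw0 nwl nwr nwd Om U t adm t01 tg.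
exists G0; split => //; move: le1; congr (_ <= _)%E; apply: eq_integral => x _; congr psie.
by rewrite fE inver gt_eqF// /H3 -weighted_heightZ.
Qed.

End zygmund_setting.

Local Open Scope ereal_scope.

Theorem theorem1p3 (R : realType) :
  exists c C : R, [/\ (0 < c)%R, (0 < C)%R &
  forall d1 d2 d3 : nat, (0 < d1)%N -> (0 < d2)%N -> (0 < d3)%N ->
  exists2 C' : R, (0 < C')%R &
  forall (D1 : set (cube R d1)) (D2 : set (cube R d2)) (D3 : set (cube R d3)),
  dyadic_grid D1 -> dyadic_grid D2 -> dyadic_grid D3 ->
  forall w : nat -> nat -> R,
  admissible_weight w -> (exists a b, w a b <> 0%R) ->
  (forall (Om : set (space2 R d1 d2)) (U : set (rect2 R d1 d2)),
     admissible_pair (leb2 R d1 d2) rset2 (rects2 D1 D2) Om U ->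
     exists G0 : set (rect2 R d1 d2),
       [/\ G0 `<=` U,
           sparse (leb2 R d1 d2) rset2 (8^-1)%R G0,
           \int[leb2 R d1 d2]_x
              (expeR (c%:E * (ft_norm w)^-1 * H2 D1 D2 w Om U x) - 1)
           <= \int[leb2 R d1 d2]_x
              (expeR (C%:E * height rset2 G0 x) - 1) &
           \int[leb2 R d1 d2]_x
              (expeR (C%:E * height rset2 G0 x) - 1)
           <= C'%:E * leb2 R d1 d2 (shadow rset2 G0)]) /\
  (forall (Om : set (space3 R d1 d2 d3)) (U : set (rect3 R d1 d2 d3)),
     admissible_pair (leb3 R d1 d2 d3) rset3
       (zygmund_rects D1 D2 D3) Om U ->
     exists G0 : set (rect3 R d1 d2 d3),
       [/\ G0 `<=` U,
           sparse (leb3 R d1 d2 d3) rset3 (8^-1)%R G0,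
           \int[leb3 R d1 d2 d3]_x
              (coshe (c%:E * sqrte ((ft_norm w)^-1 * H3 D1 D2 D3 w Om U x)) - 1)
           <= \int[leb3 R d1 d2 d3]_x
              (coshe (C%:E * sqrte (height rset3 G0 x)) - 1) &
           \int[leb3 R d1 d2 d3]_x
              (coshe (C%:E * sqrte (height rset3 G0 x)) - 1)
           <= C'%:E * leb3 R d1 d2 d3 (shadow rset3 G0)])].
Proof.
(* The factor [t] makes up for the loss 168 between the shadows of [U] and [G0]: the right-hand
   integrand is at least [cosh1 (gamma R)] on the shadow of [G0]. It depends on no dimension. *)
have g0 := gamma_gt0 R; pose t : R := (Num.min 1 (cosh1 (gamma R) / 168))%R.
have t01 : (0 < t <= 1)%R.
  by rewrite ge_min lexx andbT lt_min ltr01 divr_gt0// cosh1_gt0.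
have tg : (168 * t <= cosh1 (gamma R))%R.
  by rewrite mulrC -ler_pdivlMr// ge_min lexx orbT.
exists (t * gamma R)%R, (gamma R); split => //.
  by rewrite mulr_gt0//; case/andP: t01.
(* [gamma] is so small that the integral for a sparse family is at most the measure of its shadow,
   whence the constant 1 in every dimension. *)
move=> d1 d2 d3 d1_gt0 d2_gt0 d3_gt0; exists 1%R => // D1 D2 D3 gD1 gD2 gD3 w wa wn; split.
  move=> Om U adm.
  have [G0 [GU sp le1 le2]] := biparameter_domination d1_gt0 d2_gt0 gD1 gD2 wa wn adm t01 tg.
  exists G0; split => //; last by rewrite mul1e.
  move: le1; rewrite /psie; congr (_ <= _); apply: eq_integral => x _.
  by rewrite muleA.
move=> Om U adm.
have [G0 [GU sp le1 le2]] :=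
  zygmund_domination d1_gt0 d2_gt0 d3_gt0 gD1 gD2 gD3 wa wn adm t01 tg.
by exists G0; split => //; rewrite mul1e.
Qed.
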